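(* Let $I\subset\mathbb R$ be a finite (that is, bounded) interval and let $(W_n)$ be a sequence of graphons in $\mathcal W_I$. Then the following are equivalent: (a) $t(F,W_n)$ converges for all finite simple graphs $F$; (b) $(W_n)$ is a Cauchy sequence in the $\delta_\square$ metric; (c) there exists a $W\in\mathcal W_I$ such that $t(F,W_n)\to t(F,W)$ for all finite simple graphs $F$. Furthermore, for $W\in\mathcal W$, one has $t(F,W_n)\to t(F,W)$ for all finite simple graphs $F$ if and only if $\delta_\square(W_n,W)\to0$.
   Context: $\mathcal W$ denotes the space of all bounded measurable functions $W:[0,1]^2\to\mathbb R$ with $W(x,y)=W(y,x)$ for all $x,y\in[0,1]$ (graphons), and, for a bounded interval $I\subset\mathbb R$, $\mathcal W_I$ is the set of $W\in\mathcal W$ with $W(x,y)\in I$ for all $x,y$. For a simple graph $F$ (finite, no loops or multiple edges) with $V(F)=\{1,\dots,k\}$, $t(F,W)=\int_{[0,1]^k}\prod_{ij\in E(F)}W(x_i,x_j)\,dx_1\cdots dx_k$. The cut distance is $$\delta_\square(W,W')=\inf_{\mu\in\mathcal M}\ \sup_{S,T\subseteq[0,1]^2}\Bigl|\int_{(x,u)\in S,\ (y,v)\in T}\bigl(W(x,y)-W'(u,v)\bigr)\,d\mu(x,u)\,d\mu(y,v)\Bigr|,$$ where $\mathcal M$ is the set of probability measures on $[0,1]^2$ both of whose marginals are Lebesgue measure, and $S,T$ range over measurable sets. ($\delta_\square$ is a pseudometric, called a metric informally.)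
   Formalization: The implication (a)⇒(c) is stated only for closed I; it fails otherwise (I=(0,1], W_n=1/(n+1): all t(F,W_n) with an edge tend to 0, but t(K_2,W)>0 for W in W_I). All other implications hold for every bounded interval; ''measurable'' is read as Borel. *)

(* Defs.v *)
From HB Require Import structures.
From mathcomp Require Import all_boot all_order all_algebra.
From mathcomp Require Import all_classical all_reals all_analysis.

Set Implicit Arguments.
Unset Strict Implicit.
Unset Printing Implicit Defensive.

Import Order.TTheory GRing.Theory Num.Theory.
Import numFieldNormedType.Exports.

Local Open Scope classical_set_scope.
Local Open Scope ring_scope.

Record simple_graph := SimpleGraph {
  nverts : nat;
  edge : rel 'I_nverts;
  edge_sym : symmetric edge;
  edge_irr : irreflexive edge }.

(* Lebesgue measure on [0,1], as a Borel probability measure on R carried by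
   [0,1]. *)
Section lebesgue01.
Context (R : realType).

Definition lebesgue01 : set (measurableTypeR R) -> \bar R :=
  mrestr (@lebesgue_measure R) (measurable_itv `[0, 1]).

HB.instance Definition _ := Measure.on lebesgue01.

Let lebesgue01_setT : lebesgue01 setT = 1%E.
Proof.
rewrite /lebesgue01 /mrestr setTI.
have /= := lebesgue_measure_itv (`[0, 1] : interval R).
by rewrite lte_fin ltr01 oppr0 adde0.
Qed.

HB.instance Definition _ :=
  Measure_isProbability.Build _ _ _ lebesgue01 lebesgue01_setT.

End lebesgue01.
Arguments lebesgue01 R : clear implicits.

(* Product measures on n-tuples: the image of P \x P^n under (x, t) |-> x :: t. *)
Section power_measure.
Context d (T : measurableType d) (R : realType).

Definition cons_pair n (p : T * n.-tuple T) : n.+1.-tuple T :=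
  [tuple of p.1 :: p.2].

Lemma measurable_cons_pair n : measurable_fun setT (@cons_pair n).
Proof.
by apply: measurable_cons; [exact: measurable_fst|exact: measurable_snd].
Qed.

HB.instance Definition _ n :=
  isMeasurableFun.Build _ _ _ _ (@cons_pair n) (@measurable_cons_pair n).

Fixpoint power_measure (P : probability T R) n : probability (n.-tuple T) R :=
  if n is m.+1 then distribution (P \x power_measure P m)%E (@cons_pair m)
  else \d_([tuple] : 0.-tuple T).

End power_measure.

Section graphons.
Context (R : realType).
Local Notation T := (measurableTypeR R).

Definition unit_square : set (T * T) := `[0, 1]%classic `*` `[0, 1]%classic.

Definition unit_cube k : set (k.-tuple T) :=
  [set x | forall i, tnth x i \in `[0, 1]].

(* Graphons are represented by functions on all of R^2, whose values outside
   [0,1]^2 are irrelevant; measurability is Borel measurability. *)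
Definition graphon (W : T * T -> R) : Prop :=
  [/\ measurable_fun unit_square W,
      [bounded W p | p in unit_square] &
      forall x y, unit_square (x, y) -> W (x, y) = W (y, x)].

(* For I bounded but not closed, this class is not closed under convergence of
   homomorphism densities: with I = ]0, 1], the constants 1/(n+1) have as limit
   only graphons that vanish almost everywhere on [0,1]^2. *)
Definition graphon_in (I : set R) (W : T * T -> R) : Prop :=
  graphon W /\ forall p, unit_square p -> I (W p).

Definition hom_density (F : simple_graph) (W : T * T -> R) : R :=
  \int[power_measure (lebesgue01 R) (nverts F)]_(x in @unit_cube (nverts F))
    \prod_(ij : 'I_(nverts F) * 'I_(nverts F) | (ij.1 < ij.2)%N && edge ij.1 ij.2)
      W (tnth x ij.1, tnth x ij.2).

(* Such measures on R^2 are automatically carried by [0,1]^2. *)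
Definition coupling (mu : probability (T * T)%type R) : Prop :=
  forall A : set T, measurable A ->
    mu (fst @^-1` A) = lebesgue01 R A /\ mu (snd @^-1` A) = lebesgue01 R A.

Definition cut_discrepancy (mu : probability (T * T)%type R)
    (W W' : T * T -> R) : \bar R :=
  ereal_sup [set r | exists S U : set (T * T),
    [/\ measurable S, measurable U, S `<=` unit_square, U `<=` unit_square &
      r = `| \int[mu \x mu]_(p in S `*` U)
               (W (p.1.1, p.2.1) - W' (p.1.2, p.2.2))%:E |]]%E.

Definition cut_dist (W W' : T * T -> R) : \bar R :=
  ereal_inf [set cut_discrepancy mu W W' | mu in coupling].

Definition cut_cauchy (W_ : nat -> T * T -> R) : Prop :=
  forall eps : R, 0 < eps -> exists N : nat, forall m n : nat,
    (N <= m)%N -> (N <= n)%N -> (cut_dist (W_ m) (W_ n) < eps%:E)%E.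

End graphons.

(* Main.v *)
(* If W and W' are close in cut norm on some probability space, replacing W by
   W' edge by edge shows that their homomorphism densities are close; pulling
   both graphons back along a coupling gives the easy implications.

   Conversely, sample k points and draw a random graph G on them that takes the
   endpoint values of an interval containing I, with conditional mean W. The
   law of G is a fixed linear combination of the densities t(F, W). For k large,
   uniformly in W, G is with high probability close to W, in the sense that
   W is close in cut norm on [0,1] to G o (y x y) for some labelling
   y : [0,1] -> {1, ..., k} by classes of measure 1/k. To see this, approximate
   W by a step kernel U (weak regularity); the box norm of G - U at the sample
   points, which dominates the cut norm, has small expectation, because it is a
   four-cycle density and thus an average over nearly independent entries.
   Hence two graphons with close densities share a graph G that is close to
   both, and coupling their labellings conditionally on the label bounds their
   cut distance.

   For the limit object, choose graphs G_j close to both W_(n_j) and W_(n_(j+1))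
   and realise them on [0,1] by labellings Z_j such that (Z_j, Z_(j+1)) has the
   joint law of the labellings of W_(n_(j+1)). The resulting kernels are Cauchy
   in cut norm; their integrals over measurable sets converge to a measure whose
   Radon-Nikodym density is the limit graphon. *)

From HB Require Import structures.
Require Import Defs.
From mathcomp Require Import all_boot all_order all_algebra.
From mathcomp Require Import all_classical all_reals all_analysis.
From mathcomp Require Import measurable_realfun ring lra.
Set Implicit Arguments.
Unset Strict Implicit.
Unset Printing Implicit Defensive.
Import Order.TTheory GRing.Theory Num.Theory.
Import numFieldNormedType.Exports.
Local Open Scope classical_set_scope.
Local Open Scope ring_scope.


(** * Expectations of bounded measurable functions *)

(** The cut norm does not pull back along a coupling: a set in [0,1]^2 need not come from a set in
    [0,1]. The box norm does, being an iterated integral, and for kernels bounded by b the two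
    control each other, cut^4 <= box <= 4 b^3 cut. Every passage between probability spaces uses
    this comparison, whence the fourth powers in the tolerances. Drawing endpoint values instead of
    values of W leaves finitely many outcomes, so that close densities mean close laws. When both
    failure probabilities and the l1 distance of the laws are at most 1/4, some outcome is good for
    both kernels. Weak regularity supplies the labelling: for a merely measurable W there is no
    evident way to spread the sample points over [0,1], whereas for a step kernel only the
    frequencies of finitely many labels matter, and these concentrate by a variance bound. All
    classes of a labelling have measure 1/k, so two labellings by the same graph have the same law
    and can be coupled so as to agree. *)

Definition bounded_measurable d (T : measurableType d) (R : realType)
    (f : T -> R) : Prop :=
  measurable_fun setT f /\ exists C, forall x, `|f x| <= C.
Notation bm := bounded_measurable.

Definition expect d (T : measurableType d) (R : realType)
  (P : probability T R) (f : T -> R) : R := \int[P]_x f x.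
Arguments expect {d T R} P f.

Section bounded_measurable.
Context d (T : measurableType d) (R : realType).
Implicit Types (f g : T -> R) (P : probability T R).

Lemma bm_cst (r : R) : bm (fun _ : T => r).
Proof. by split; [exact: measurable_cst | exists `|r|]. Qed.

Lemma bmN f : bm f -> bm (fun x => - f x).
Proof.
case=> mf [C fC]; split; first exact: measurableT_comp.
by exists C => x; rewrite normrN.
Qed.

Lemma bmD f g : bm f -> bm g -> bm (fun x => f x + g x).
Proof.
case=> mf [C fC] [mg [D gD]]; split; first exact: measurable_funD.
by exists (C + D) => x; rewrite (le_trans (ler_normD _ _))// lerD.
Qed.

Lemma bmM f g : bm f -> bm g -> bm (fun x => f x * g x).
Proof.
case=> mf [C fC] [mg [D gD]]; split; first exact: measurable_funM.
by exists (C * D) => x; rewrite normrM ler_pM.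
Qed.

Lemma bmX f n : bm f -> bm (fun x => f x ^+ n).
Proof.
move=> bf; elim: n => [|n ih]; first exact: bm_cst.
by under [X in bm X]eq_fun do rewrite exprS; exact: bmM.
Qed.

Lemma bm_norm f : bm f -> bm (fun x => `|f x|).
Proof.
case=> mf [C fC]; split; first exact: measurableT_comp.
by exists C => x; rewrite normr_id.
Qed.

Lemma bm_sum (I : Type) (s : seq I) (p : pred I) (F : I -> T -> R) :
  (forall i, bm (F i)) -> bm (fun x => \sum_(i <- s | p i) F i x).
Proof.
move=> bF; elim: s => [|i s ih].
  by under [X in bm X]eq_fun do rewrite big_nil; exact: bm_cst.
under [X in bm X]eq_fun do rewrite big_cons.
by case: (p i) => //; exact: bmD.
Qed.

Lemma bm_prod (I : Type) (s : seq I) (p : pred I) (F : I -> T -> R) :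
  (forall i, bm (F i)) -> bm (fun x => \prod_(i <- s | p i) F i x).
Proof.
move=> bF; elim: s => [|i s ih].
  by under [X in bm X]eq_fun do rewrite big_nil; exact: bm_cst.
under [X in bm X]eq_fun do rewrite big_cons.
by case: (p i) => //; exact: bmM.
Qed.

Lemma bm_indic (A : set T) : measurable A -> bm (\1_A : T -> R).
Proof.
move=> mA; split; first exact: measurable_indic.
by exists 1 => x; rewrite indicE; case: (x \in A); rewrite ?normr1 ?normr0.
Qed.

Lemma bm_integrable P f : bm f -> P.-integrable setT (EFin \o f).
Proof.
case=> mf [C fC]; apply: measurable_bounded_integrable => //.
  by rewrite (le_lt_trans (probability_le1 P measurableT))// ltry.
by exists C; split; rewrite ?num_real// => D /ltW CD x _; exact: le_trans CD.
Qed.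

Lemma expectD P f g : bm f -> bm g ->
  expect P (fun x => f x + g x) = expect P f + expect P g.
Proof. by move=> bf bg; apply: RintegralD => //; exact: bm_integrable. Qed.

Lemma expectB P f g : bm f -> bm g ->
  expect P (fun x => f x - g x) = expect P f - expect P g.
Proof. by move=> bf bg; apply: RintegralB => //; exact: bm_integrable. Qed.

Lemma expectZl P f r : bm f -> expect P (fun x => r * f x) = r * expect P f.
Proof. by move=> bf; apply: RintegralZl => //; exact: bm_integrable. Qed.

Lemma expectZr P f r : bm f -> expect P (fun x => f x * r) = expect P f * r.
Proof. by move=> bf; apply: RintegralZr => //; exact: bm_integrable. Qed.

Lemma expect_cst P r : expect P (fun _ => r) = r.
Proof.
rewrite /expect Rintegral_cst//.
rewrite -[RHS]mulr1; congr (r * _).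
by transitivity (fine (1%E : \bar R)) => //; congr fine; exact: probability_setT.
Qed.

Lemma eq_expect P f g : f =1 g -> expect P f = expect P g.
Proof. by move=> fg; apply: eq_Rintegral => x _. Qed.

Lemma expect_sum P (I : Type) (s : seq I) (p : pred I) (F : I -> T -> R) :
  (forall i, bm (F i)) ->
  expect P (fun x => \sum_(i <- s | p i) F i x) =
  \sum_(i <- s | p i) expect P (F i).
Proof.
move=> bF; elim: s => [|i s ih].
  by rewrite big_nil -[RHS](expect_cst P); apply: eq_expect => x; rewrite big_nil.
rewrite big_cons -ih; case: ifPn => pi.
  rewrite -expectD//; last exact: bm_sum.
  by apply: eq_expect => x; rewrite big_cons pi.
by apply: eq_expect => x; rewrite big_cons (negbTE pi).
Qed.

Lemma ge0_expect P f : (forall x, 0 <= f x) -> 0 <= expect P f.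
Proof. by move=> f0; apply: Rintegral_ge0. Qed.

Lemma ler_expect P f g : bm f -> bm g -> (forall x, f x <= g x) ->
  expect P f <= expect P g.
Proof. by move=> bf bg fg; apply: le_Rintegral => //; exact: bm_integrable. Qed.

Lemma ler_norm_expect P f : bm f -> `|expect P f| <= expect P (fun x => `|f x|).
Proof. by move=> bf; apply: le_normr_Rintegral => //; exact: bm_integrable. Qed.

Lemma expect_le P f r : bm f -> (forall x, f x <= r) -> expect P f <= r.
Proof.
by move=> bf fr; rewrite -[leRHS](expect_cst P) ler_expect//; exact: bm_cst.
Qed.

Lemma expect_normr_le P f r : bm f -> (forall x, `|f x| <= r) -> `|expect P f| <= r.
Proof.
move=> bf fr; apply: le_trans (ler_norm_expect _ bf) _.
by apply: expect_le => //; exact: bm_norm.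
Qed.

Lemma expect_indic P (A : set T) : measurable A ->
  expect P \1_A = fine (P A).
Proof.
move=> mA; rewrite /expect/Rintegral integral_indic// setIT//.
Qed.

(** The difference of the two sides is the variance of [f]. *)
Lemma expect_sqr_le P f : bm f -> expect P f ^+ 2 <= expect P (fun x => f x ^+ 2).
Proof.
move=> bf; rewrite -subr_ge0.
suff -> : expect P (fun x => f x ^+ 2) - expect P f ^+ 2 =
    expect P (fun x => (f x - expect P f) ^+ 2).
  by apply: ge0_expect => x; exact: sqr_ge0.
set m := expect P f.
transitivity (expect P (fun x => f x ^+ 2 + (- (2 * m)) * f x + m ^+ 2)).
  rewrite expectD; [|apply: bmD; [exact: bmX|by apply: bmM => //; exact: bm_cst]
    |exact: bm_cst].
  rewrite expectD; [|exact: bmX|by apply: bmM => //; exact: bm_cst].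
  by rewrite expect_cst expectZl// -/m; ring.
by apply: eq_expect => x; ring.
Qed.

End bounded_measurable.

Lemma bm_comp d d' (T : measurableType d) (T' : measurableType d') (R : realType)
    (D : T' -> R) (h : T -> T') :
  bm D -> measurable_fun setT h -> bm (fun x => D (h x)).
Proof.
case=> mD [C DC] mh; split; first exact: measurableT_comp.
by exists C => x.
Qed.

Section measurable_maps.
Context d d1 d2 (T : measurableType d) (T1 : measurableType d1)
  (T2 : measurableType d2).

Lemma measurable_fun_fst (h : T -> T1 * T2) :
  measurable_fun setT h -> measurable_fun setT (fun x => (h x).1).
Proof. by move=> mh; exact: (measurableT_comp measurable_fst). Qed.

Lemma measurable_fun_snd (h : T -> T1 * T2) :
  measurable_fun setT h -> measurable_fun setT (fun x => (h x).2).
Proof. by move=> mh; exact: (measurableT_comp measurable_snd). Qed.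

Lemma measurable_fun_tnth n (h : T -> n.-tuple T1) i :
  measurable_fun setT h -> measurable_fun setT (fun x => tnth (h x) i).
Proof. by move=> mh; exact: (measurableT_comp (measurable_tnth i)). Qed.

Lemma measurable_fun_cons n (h1 : T -> T1) (h2 : T -> n.-tuple T1) :
  measurable_fun setT h1 -> measurable_fun setT h2 ->
  measurable_fun setT (fun x => cons_pair (h1 x, h2 x)).
Proof. by move=> m1 m2; exact: measurable_cons. Qed.

Lemma measurable_fun_comp1 (h : T -> T1) (g : T1 -> T2) :
  measurable_fun setT g -> measurable_fun setT h ->
  measurable_fun setT (fun x => g (h x)).
Proof. by move=> m1 m2; exact: (measurableT_comp m1 m2). Qed.

End measurable_maps.

Lemma bm_expect d1 d2 (T1 : measurableType d1) (T2 : measurableType d2)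
    (R : realType) (Q : probability T2 R) (f : T1 -> T2 -> R) :
  bm (fun p : T1 * T2 => f p.1 p.2) -> bm (fun x => expect Q (f x)).
Proof.
move=> bf; have [mf [C fC]] := bf.
have bx x : bm (f x).
  apply: (@bm_comp _ _ _ _ _ (fun p : T1 * T2 => f p.1 p.2) (fun y => (x, y))) => //.
  exact: measurable_fun_pair.
split; last by exists C => x; apply: expect_normr_le => // y; exact: fC (x, y).
(* Tonelli gives measurability of partial integrals of nonnegative functions; adding the bound [C]
   makes [f] nonnegative. *)
pose g (p : T1 * T2) := (f p.1 p.2 + C)%:E.
have g0 p : (0 <= g p)%E.
  by rewrite lee_fin -lerBlDr sub0r; have := fC p; rewrite ler_norml => /andP[].
have mg : measurable_fun setT g.
  by apply/measurable_EFinP; apply: measurable_funD => //; exact: measurable_cst.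
have /= mF := measurable_fun_fubini_tonelli_F (m2 := Q) g mg g0.
rewrite (_ : (fun x => _) = fun x => fine (fubini_F Q g x) - C).
  apply: measurable_funB; last exact: measurable_cst.
  by apply: measurableT_comp mF; exact: fine_measurable.
apply/funext => x; rewrite -[LHS](addrK C) -[X in _ + X - _](expect_cst Q).
by rewrite -expectD//; exact: bm_cst.
Qed.

Section expect_prod.
Context d1 d2 (T1 : measurableType d1) (T2 : measurableType d2) (R : realType).
Variables (P : probability T1 R) (Q : probability T2 R).

Lemma expect_prod (f : T1 * T2 -> R) : bm f ->
  expect (P \x Q)%E f = expect P (fun x => expect Q (fun y => f (x, y))).
Proof.
move=> bf; have /integral12_prod_meas1 := bm_integrable (P \x Q)%E bf.
rewrite /expect {1}/Rintegral => <-; congr fine; apply: eq_integral => x _.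
rewrite /fubini_F fineK//.
apply: integrable_fin_num => //; apply: (@bm_integrable _ _ _ Q (fun y => f (x, y))).
by apply: bm_comp bf _; exact: measurable_fun_pair.
Qed.

Lemma expect_swap (f : T1 -> T2 -> R) : bm (fun p : T1 * T2 => f p.1 p.2) ->
  expect P (fun x => expect Q (f x)) =
  expect Q (fun y => expect P (f^~ y)).
Proof.
move=> bf; rewrite -(expect_prod bf).
have /integral21_prod_meas1 := bm_integrable (P \x Q)%E bf.
rewrite /expect {1}/Rintegral => <-; congr fine; apply: eq_integral => x _.
rewrite /fubini_G fineK//.
apply: integrable_fin_num => //; apply: (@bm_integrable _ _ _ P (fun y => f y x)).
apply: (@bm_comp _ _ _ _ _ (fun p : T1 * T2 => f p.1 p.2) (fun y => (y, x))) bf _.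
exact: measurable_fun_pair.
Qed.

End expect_prod.

Definition measure_preserving d d' (T : measurableType d) (T' : measurableType d')
    (R : realType) (P : probability T R) (Q : probability T' R) (h : T -> T') :=
  measurable_fun setT h /\ forall A, measurable A -> P (h @^-1` A) = Q A.

Lemma expect_preserving d d' (T : measurableType d) (T' : measurableType d')
    (R : realType) (P : probability T R) (Q : probability T' R) (h : T -> T')
    (f : T' -> R) : measure_preserving P Q h -> bm f ->
  expect Q f = expect P (fun x => f (h x)).
Proof.
move=> [mh hP] bf; rewrite /expect/Rintegral; congr fine.
rewrite -[RHS](@integral_pushforward _ _ _ _ _ _ mh P setT (EFin \o f))//.
- apply: eq_measure_integral => A mA _; rewrite /= /pushforward hP//.
- exact/measurable_EFinP/bf.1.
- rewrite preimage_setT; apply: (bm_integrable P (f := fun x => f (h x))).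
  exact: bm_comp.
Qed.

(** * Product measures on tuples *)

Ltac measurable_map := solve [repeat first
  [ exact: measurable_id | assumption | exact: measurable_cst
  | apply: measurable_fun_pair | apply: measurable_fun_fst
  | apply: measurable_fun_snd | apply: measurable_fun_tnth
  | apply: measurable_fun_cons ]].

(** Works on the shape of the integrand. A function already known to be bounded and measurable may
    be composed with any map built from projections, pairings and tuple entries. *)
Ltac bm_step := cbv beta; first
  [ match goal with
    | H : bounded_measurable ?f |- bounded_measurable ?f => exact: H
    end
  | match goal with
    | H : bounded_measurable ?D |- bounded_measurable (fun x => ?D (@?h x)) =>
        apply: (bm_comp (h := h) H); measurable_map
    | H : bounded_measurable (fun p => ?D p.1 p.2)
        |- bounded_measurable (fun x => ?D (@?h x) (@?g x)) =>
        apply: (bm_comp (h := fun x => (h x, g x)) H); measurable_map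
    end
  | lazymatch goal with
    | |- bounded_measurable (fun x => _ + _) => apply: bmD
    | |- bounded_measurable (fun x => _ * _) => apply: bmM
    | |- bounded_measurable (fun x => - _) => apply: bmN
    | |- bounded_measurable (fun x => _ ^+ _) => apply: bmX
    | |- bounded_measurable (fun x => `| _ |) => apply: bm_norm
    | |- bounded_measurable (fun x => \sum_(i <- _ | _) _) =>
        apply: bm_sum => ?
    | |- bounded_measurable (fun x => \prod_(i <- _ | _) _) =>
        apply: bm_prod => ?
    | |- bounded_measurable (fun x => expect ?Q (@?f x)) =>
        apply: (@bm_expect _ _ _ _ _ Q f)
    | |- bounded_measurable (\1_ _) => apply: bm_indic
    | |- bounded_measurable (fun x => \1_?S (@?h x)) =>
        apply: (bm_comp (D := \1_S) (h := h)); [apply: bm_indic|measurable_map]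
    end
  | exact: bm_cst ].

Ltac bmt := repeat bm_step.

(** Fubini with the uncurried integrand [g] supplied by hand, in a form that [bmt] can analyse,
    while rewriting matches the curried one. *)
Lemma expect_swapP d1 d2 (T1 : measurableType d1) (T2 : measurableType d2)
    (R : realType) (P : probability T1 R) (Q : probability T2 R)
    (f : T1 -> T2 -> R) (g : T1 * T2 -> R) : bm g ->
  (forall x y, f x y = g (x, y)) ->
  expect P (fun x => expect Q (fun y => f x y)) =
  expect Q (fun y => expect P (fun x => f x y)).
Proof.
move=> bg fg; apply: expect_swap.
suff -> : (fun p => f p.1 p.2) = g by [].
by apply/funext => -[x y] /=.
Qed.

Section power.
Context d (T : measurableType d) (R : realType) (P : probability T R).

Lemma expect_power0 (f : 0.-tuple T -> R) : bm f ->
  expect (power_measure P 0) f = f [tuple].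
Proof.
move=> [mf _]; rewrite /expect /Rintegral /= integral_dirac//.
  by rewrite diracT mul1e.
exact/measurable_EFinP.
Qed.

Lemma expect_powerS n (f : n.+1.-tuple T -> R) : bm f ->
  expect (power_measure P n.+1) f =
  expect P (fun x => expect (power_measure P n) (fun t => f (cons_pair (x, t)))).
Proof.
move=> bf.
rewrite -(expect_prod P (power_measure P n) (f := fun p => f (cons_pair p))); last first.
  exact: bm_comp bf (measurable_cons_pair (n := n)).
apply: expect_preserving => //; split=> //; exact: measurable_cons_pair.
Qed.

Definition tset n (t : n.-tuple T) (i : 'I_n) (u : T) : n.-tuple T :=
  [tuple if j == i then u else tnth t j | j < n].

Lemma tnth_tset n (t : n.-tuple T) i u j :
  tnth (tset t i u) j = if j == i then u else tnth t j.
Proof. by rewrite tnth_mktuple. Qed.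

Lemma tset_cons0 n x (t : n.-tuple T) u :
  tset (cons_pair (x, t)) ord0 u = cons_pair (u, t).
Proof.
apply: eq_from_tnth => j; rewrite tnth_tset.
case: (unliftP ord0 j) => [k ->|->]; last by rewrite eqxx tnth0.
by rewrite eq_sym (negbTE (neq_lift _ _)) !tnthS.
Qed.

Lemma tset_consS n x (t : n.-tuple T) i u :
  tset (cons_pair (x, t)) (lift ord0 i) u = cons_pair (x, tset t i u).
Proof.
apply: eq_from_tnth => j; rewrite tnth_tset.
case: (unliftP ord0 j) => [k ->|->]; last by rewrite !tnth0.
by rewrite !tnthS tnth_tset (inj_eq lift_inj).
Qed.

Lemma measurable_tset d' (T' : measurableType d') n i (h : T' -> n.-tuple T) (g : T' -> T) :
  measurable_fun setT h -> measurable_fun setT g ->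
  measurable_fun setT (fun p => tset (h p) i (g p)).
Proof.
move=> mh mg; apply/measurable_fun_tnthP => j.
rewrite [X in measurable_fun _ X](_ : _ =
    if j == i then g else fun p => tnth (h p) j).
  by case: ifP => _ //; exact: measurable_fun_tnth.
by apply/funext => p; rewrite /= tnth_tset; case: ifP.
Qed.

(** A fresh independent value in place of coordinate [i] does not change the law of the tuple. This
    gives access to any chosen coordinates without reordering the product measure. *)
Lemma expect_resample n (i : 'I_n) (f : n.-tuple T -> R) : bm f ->
  expect (power_measure P n) f =
  expect (power_measure P n) (fun t => expect P (fun u => f (tset t i u))).
Proof.
elim: n i f => [[]//|n ih] i f bf.
have bfs : bm (fun t => expect P (fun u => f (tset t i u))).
  apply: bm_expect; apply: (bm_comp (h := fun p => tset p.1 i p.2) bf).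
  by apply: measurable_tset; measurable_map.
rewrite !expect_powerS//.
case: (unliftP ord0 i) => [k|] ->.
  apply: eq_expect => x; rewrite (ih k).
    by apply: eq_expect => t; apply: eq_expect => u; rewrite tset_consS.
  by bmt.
transitivity (expect (power_measure P n) (fun t => expect P (fun u => f (cons_pair (u, t))))).
  apply: (@expect_swapP _ _ _ _ _ _ _ _ (fun p => f (cons_pair p))) => //.
  exact: bm_comp bf (measurable_cons_pair (n := n)).
(* [tset] overwrites the head, so the old head [x] is a dummy variable that integrates out. *)
rewrite -[LHS](expect_cst P); apply: eq_expect => x; apply: eq_expect => t.
by apply: eq_expect => u; rewrite tset_cons0.
Qed.

End power.

(** Used with the two projections of a coupling: both densities can then be read off one sample of
    pairs. *)
Lemma expect_power_map d d' (T : measurableType d) (T' : measurableType d')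
    (R : realType) (P : probability T R) (Q : probability T' R) (h : T -> T')
    n (f : n.-tuple T' -> R) : measure_preserving P Q h -> bm f ->
  expect (power_measure Q n) f =
  expect (power_measure P n) (fun t => f [tuple h (tnth t i) | i < n]).
Proof.
move=> hP; have [mh _] := hP; elim: n f => [|n ih] f bf.
  rewrite !expect_power0//; first by rewrite [in RHS]tuple0.
  by apply: bm_comp bf _; apply/measurable_fun_tnthP => -[].
have bfm m (g : m.-tuple T' -> R) : bm g ->
    bm (fun t : m.-tuple T => g [tuple h (tnth t i) | i < m]).
  move=> bg; apply: bm_comp bg _; apply/measurable_fun_tnthP => i.
  rewrite [X in measurable_fun _ X](_ : _ = fun t => h (tnth t i)).
    by apply: measurable_fun_comp1 => //; measurable_map.
  by apply/funext => t; rewrite /= tnth_mktuple.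
have bfm' := bfm _ _ bf.
rewrite !expect_powerS// (expect_preserving hP); last by bmt.
apply: eq_expect => x; rewrite ih; last first.
  by bmt.
apply: eq_expect => t; congr f; apply: eq_from_tnth => j.
rewrite tnth_mktuple; case: (unliftP ord0 j) => [k ->|->]; last by rewrite !tnth0.
by rewrite !tnthS tnth_mktuple.
Qed.

(** * The cut norm and the box norm *)

Section cut_norm.
Context d (T : measurableType d) (R : realType) (mu : probability T R).
Implicit Types (D : T * T -> R) (f g h : T -> R).

Definition kform D f g : R :=
  expect mu (fun x => expect mu (fun y => D (x, y) * (f x * g y))).

(** The cut norm enters only through upper bounds, which avoids a supremum. *)
Definition cut_le D (c : R) : Prop := forall S U : set T,
  measurable S -> measurable U -> `|kform D \1_S \1_U| <= c.

Definition codegree D (y y' : T) : R :=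
  expect mu (fun x => D (x, y) * D (x, y')).

(* The homomorphism density of the four-cycle in the bipartite kernel D, that
   is, the fourth power of its box (Gowers) norm. *)
Definition box D : R :=
  expect mu (fun y => expect mu (fun y' => codegree D y y' ^+ 2)).

Lemma kformE D f g : bm D -> bm f -> bm g ->
  kform D f g = expect mu (fun x => f x * expect mu (fun y => D (x, y) * g y)).
Proof.
move=> bD bf bg; apply: eq_expect => x.
rewrite -expectZl; last by bmt.
by apply: eq_expect => y; ring.
Qed.

Lemma kformEr D f g : bm D -> bm f -> bm g ->
  kform D f g = expect mu (fun y => g y * expect mu (fun x => D (x, y) * f x)).
Proof.
move=> bD bf bg; rewrite /kform.
rewrite (expect_swapP mu mu (g := fun p => D (p.1, p.2) * (f p.1 * g p.2))); [|by bmt|by []].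
apply: eq_expect => y; rewrite -expectZl; last by bmt.
by apply: eq_expect => x; ring.
Qed.

Lemma bm_kform_inner D f : bm D -> bm f ->
  bm (fun x => expect mu (fun y => D (x, y) * f y)).
Proof. by move=> bD bf; bmt. Qed.

Lemma kformDl D D' f g : bm D -> bm D' -> bm f -> bm g ->
  kform (fun p => D p + D' p) f g = kform D f g + kform D' f g.
Proof.
move=> bD bD' bf bg; rewrite /kform -expectD; [|by bmt..].
apply: eq_expect => x; rewrite -expectD; [|by bmt..].
by apply: eq_expect => y; ring.
Qed.

Lemma kformZ D f g r : bm D -> bm f -> bm g ->
  kform (fun p => r * D p) f g = r * kform D f g.
Proof.
move=> bD bf bg; rewrite /kform -expectZl; [|by bmt..].
apply: eq_expect => x; rewrite -expectZl; [|by bmt..].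
by apply: eq_expect => y; ring.
Qed.

Lemma kformN D f g : bm D -> bm f -> bm g ->
  kform (fun p => - D p) f g = - kform D f g.
Proof.
move=> bD bf bg; rewrite -mulN1r -kformZ; [|exact: bD|exact: bf|exact: bg].
by apply: eq_expect => x; apply: eq_expect => y; ring.
Qed.

Lemma kformB D D' f g : bm D -> bm D' -> bm f -> bm g ->
  kform (fun p => D p - D' p) f g = kform D f g - kform D' f g.
Proof.
move=> bD bD' bf bg; rewrite -kformN -?kformDl; [by []|by bmt..].
Qed.

Lemma eq_kform D D' f g : D =1 D' -> kform D f g = kform D' f g.
Proof.
by move=> DD; apply: eq_expect => x; apply: eq_expect => y; rewrite DD.
Qed.

Lemma eq_cut_le D D' c : D =1 D' -> cut_le D c -> cut_le D' c.
Proof. by move=> DD h S U mS mU; rewrite -(eq_kform _ _ DD); exact: h. Qed.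

Lemma cut_leD D D' c c' : bm D -> bm D' -> cut_le D c -> cut_le D' c' ->
  cut_le (fun p => D p + D' p) (c + c').
Proof.
move=> bD bD' h h' S U mS mU; rewrite kformDl//; try exact: bm_indic.
by apply: le_trans (ler_normD _ _) _; apply: lerD; [exact: h|exact: h'].
Qed.

Lemma cut_leN D c : bm D -> cut_le D c -> cut_le (fun p => - D p) c.
Proof.
move=> bD h S U mS mU; rewrite kformN//; try exact: bm_indic.
by rewrite normrN; exact: h.
Qed.

Lemma cut_leB D D' c c' : bm D -> bm D' -> cut_le D c -> cut_le D' c' ->
  cut_le (fun p => D p - D' p) (c + c').
Proof. by move=> bD bD' h h'; apply: cut_leD; [by bmt|by bmt|exact: h|exact: cut_leN]. Qed.

Lemma cut_le_trans D c c' : c <= c' -> cut_le D c -> cut_le D c'.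
Proof. by move=> cc h S U mS mU; apply: le_trans cc; exact: h. Qed.

Lemma measurable_gt0 f : bm f -> measurable [set x | 0 < f x].
Proof.
move=> [mf _]; rewrite (_ : [set x | _] = f @^-1` `]0, +oo[).
  by rewrite -[X in measurable X]setTI; exact: mf.
by apply/seteqP; split => x /=; rewrite in_itv/= andbT.
Qed.

(** Among weights with values in [0,1], the indicator of the set where [h] is positive maximises the
    integral. *)
Lemma expect_le_pos_part f h : bm f -> bm h -> (forall x, 0 <= f x <= 1) ->
  expect mu (fun x => f x * h x) <=
  expect mu (fun x => \1_[set x | 0 < h x] x * h x).
Proof.
move=> bf bh f01; have mh := measurable_gt0 bh; apply: ler_expect; [by bmt..|].
move=> x; have /andP[f0 f1] := f01 x; rewrite indicE.
have [hx|hx] := ltP 0 (h x).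
  by rewrite mem_set// mul1r ler_piMl// ltW.
rewrite memNset ?mul0r ?mulr_ge0_le0//=.
by apply/negP; rewrite -leNgt.
Qed.

(** The form is linear in each argument, so first [f] and then [g] can be rounded to an indicator
    without decreasing it. *)
Lemma kform_le_cut D f g c : bm D -> bm f -> bm g ->
  (forall x, 0 <= f x <= 1) -> (forall x, 0 <= g x <= 1) ->
  cut_le D c -> kform D f g <= c.
Proof.
move=> bD bf bg f01 g01 Dc.
have bh := bm_kform_inner bD bg.
rewrite kformE//; apply: le_trans (expect_le_pos_part bf bh f01) _.
set S := [set x | _]; have mS : measurable S by exact: measurable_gt0.
have bS : bm (\1_S : T -> R) by exact: bm_indic.
rewrite -kformE// kformEr//.
have bh' : bm (fun y => expect mu (fun x => D (x, y) * (\1_S x))) by bmt.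
apply: le_trans (expect_le_pos_part bg bh' g01) _.
set U := [set x | _]; have mU : measurable U by exact: measurable_gt0.
by rewrite -kformEr//; [apply: le_trans (ler_norm _) _; exact: Dc|exact: bm_indic].
Qed.

Lemma kform_norm_cut01 D f g c : bm D -> bm f -> bm g ->
  (forall x, 0 <= f x <= 1) -> (forall x, 0 <= g x <= 1) ->
  cut_le D c -> `|kform D f g| <= c.
Proof.
move=> bD bf bg f01 g01 Dc; rewrite ler_norml; apply/andP; split.
  rewrite lerNl -kformN; [|by bmt..].
  by apply: kform_le_cut bf bg f01 g01 _; [bmt|exact: cut_leN].
exact: kform_le_cut.
Qed.

(** A number t in [-1,1] is (1 + t)/2 - (1 - t)/2, a difference of two numbers in [0,1]. Doing this
    for [f / a] and [g / b] splits the form into four, hence the factor 4. *)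
Lemma kform_norm_cut D f g a b c : bm D -> bm f -> bm g -> 0 < a -> 0 < b ->
  (forall x, `|f x| <= a) -> (forall x, `|g x| <= b) ->
  cut_le D c -> `|kform D f g| <= 4 * a * b * c.
Proof.
move=> bD bf bg a0 b0 fa gb Dc.
pose s (e t : R) := (1 + e * t) / 2.
have s01 e t r : 0 < r -> `|e| = 1 -> `|t| <= r -> 0 <= s e (t / r) <= 1.
  move=> r0 e1 tr; have : `|e * (t / r)| <= 1.
    by rewrite normrM e1 mul1r normrM normfV (gtr0_norm r0) ler_pdivrMr// mul1r.
  by rewrite ler_norml /s => /andP[? ?]; lra.
have bs e r h : bm h -> bm (fun x => s e (h x / r)).
  by move=> bh; rewrite /s; bmt.
have n1 : `|1 : R| = 1 by rewrite normr1.
have nN1 : `|-1 : R| = 1 by rewrite normrN1.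
pose k e e' := kform D (fun x => s e (f x / a)) (fun x => s e' (g x / b)).
have kc e e' : `|e| = 1 -> `|e'| = 1 -> `|k e e'| <= c.
  by move=> he he'; apply: kform_norm_cut01 => //; try exact: bs;
    move=> x; exact: s01.
have -> : kform D f g = a * b * (k 1 1 - k 1 (-1) - k (-1) 1 + k (-1) (-1)).
  have bK e e' : bm (fun x => expect mu (fun y =>
      D (x, y) * (s e (f x / a) * s e' (g y / b)))) by rewrite /s; bmt.
  rewrite /k /kform -expectB; [|exact: bK|exact: bK].
  rewrite -expectB; [|apply: bmD; [exact: bK|apply: bmN; exact: bK]|exact: bK].
  rewrite -expectD; [|apply: bmD; [apply: bmD; [exact: bK|apply: bmN; exact: bK]
    |apply: bmN; exact: bK]|exact: bK].
  rewrite -expectZl; last by rewrite /s; bmt.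
  have bK' e e' x : bm (fun y =>
      D (x, y) * (s e (f x / a) * s e' (g y / b))) by rewrite /s; bmt.
  apply: eq_expect => x; rewrite -expectB; [|exact: bK'|exact: bK'].
  rewrite -expectB; [|apply: bmD; [exact: bK'|apply: bmN; exact: bK']|exact: bK'].
  rewrite -expectD; [|apply: bmD; [apply: bmD; [exact: bK'|apply: bmN; exact: bK']
    |apply: bmN; exact: bK']|exact: bK'].
  rewrite -expectZl; last by rewrite /s; bmt.
  apply: eq_expect => y; rewrite /s; field.
  by rewrite (gt_eqF a0) (gt_eqF b0).
rewrite normrM (gtr0_norm (mulr_gt0 a0 b0)).
rewrite (_ : 4 * a * b * c = a * b * (c + c + c + c)); last by ring.
rewrite ler_pM2l ?mulr_gt0//.
apply: le_trans (ler_normD _ _) _; apply: lerD; last exact: kc.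
apply: le_trans (ler_normB _ _) _; apply: lerD; last exact: kc.
by apply: le_trans (ler_normB _ _) _; apply: lerD; exact: kc.
Qed.

Lemma box_ge0 D : 0 <= box D.
Proof. by apply: ge0_expect => y; apply: ge0_expect => y'; exact: sqr_ge0. Qed.

Lemma bm_codegree D : bm D -> bm (fun p => codegree D p.1 p.2).
Proof. by move=> bD; rewrite /codegree; bmt. Qed.

(** Cauchy-Schwarz twice: squaring in x removes [f] and duplicates y, which brings in the codegree;
    squaring in y and y' then removes [g]. *)
Lemma kform_le_box D f g : bm D -> bm f -> bm g ->
  (forall x, `|f x| <= 1) -> (forall x, `|g x| <= 1) ->
  kform D f g ^+ 4 <= box D.
Proof.
move=> bD bf bg f1 g1.
have bh := bm_kform_inner bD bg; have bc := bm_codegree bD.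
set h := fun x => _ in bh.
have sq1 (f' : T -> R) x : `|f' x| <= 1 -> f' x ^+ 2 <= 1.
  by move=> f'1; rewrite -real_normK ?num_real// expr_le1.
have le1 : kform D f g ^+ 2 <= expect mu (fun x => h x ^+ 2).
  rewrite kformE//; apply: le_trans (expect_sqr_le _ _) _; first by bmt.
  apply: ler_expect; [by bmt..|] => x.
  by rewrite exprMn ler_piMl ?sqr_ge0 ?sq1.
have eq1 : expect mu (fun x => h x ^+ 2) =
    expect mu (fun y => expect mu (fun y' => (g y * g y') * codegree D y y')).
  transitivity (expect mu (fun x => expect mu (fun y => expect mu (fun y' =>
      (D (x, y) * g y) * (D (x, y') * g y'))))).
    apply: eq_expect => x; rewrite expr2 -expectZr; last by bmt.
    apply: eq_expect => y; rewrite -expectZl//; last by bmt.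
  rewrite (expect_swapP mu mu (g := fun p => expect mu (fun y' =>
      (D (p.1, p.2) * g p.2) * (D (p.1, y') * g y')))); [|by bmt|by []].
  apply: eq_expect => y.
  rewrite (expect_swapP mu mu (g := fun p =>
      (D (p.1, y) * g y) * (D (p.1, p.2) * g p.2))); [|by bmt|by []].
  apply: eq_expect => y'; rewrite -expectZl; last by bmt.
  by apply: eq_expect => x; ring.
rewrite (_ : 4%N = (2 * 2)%N)// exprM.
apply: (@le_trans _ _ (expect mu (fun x => h x ^+ 2) ^+ 2)).
  by rewrite ler_pXn2r// ?nnegrE ?sqr_ge0// ge0_expect// => x; exact: sqr_ge0.
rewrite eq1 /box /codegree; apply: le_trans (expect_sqr_le _ _) _; first by bmt.
apply: ler_expect; [by bmt..|] => y.
apply: le_trans (expect_sqr_le _ _) _; first by bmt.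
apply: ler_expect; [by bmt..|] => y'.
by rewrite exprMn ler_piMl ?sqr_ge0// exprMn mulr_ile1 ?sqr_ge0 ?sq1.
Qed.

Lemma cut_le_box D c : bm D -> 0 <= c -> box D <= c ^+ 4 -> cut_le D c.
Proof.
move=> bD c0 Dc S U mS mU.
have i1 (A : set T) x : `|\1_A x : R| <= 1.
  by rewrite indicE; case: (_ \in _); rewrite ?normr1 ?normr0.
have := kform_le_box bD (bm_indic R mS) (bm_indic R mU) (i1 _) (i1 _).
move=> /le_trans/(_ Dc) h; rewrite -(@ler_pXn2r _ 4) ?nnegrE//.
by rewrite -normrX ger0_norm// exprn_even_ge0.
Qed.

(** With the corner (x', y') of the four-cycle fixed, the edge (x, y) is tested against the edges
    (x, y') and (x', y), which depend on x alone and on y alone. This is what lets the cut norm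
    bound the box norm. *)
Lemma boxE D : bm D -> box D = expect mu (fun x' => expect mu (fun y' =>
  D (x', y') * kform D (fun x => D (x, y')) (fun y => D (x', y)))).
Proof.
move=> bD; rewrite /box /codegree /kform.
pose F x x' y y' := D (x, y) * D (x, y') * (D (x', y) * D (x', y')).
transitivity (expect mu (fun y => expect mu (fun y' => expect mu (fun x =>
    expect mu (fun x' => F x x' y y'))))).
  apply: eq_expect => y; apply: eq_expect => y'.
  rewrite expr2 -expectZr; last by bmt.
  by apply: eq_expect => x; rewrite -expectZl//; bmt.
rewrite (expect_swapP mu mu (g := fun p => expect mu (fun x =>
    expect mu (fun x' => F x x' p.1 p.2)))); [|by rewrite /F; bmt|by []].
transitivity (expect mu (fun y' => expect mu (fun x' => expect mu (fun y =>
    expect mu (fun x => F x x' y y'))))).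
  apply: eq_expect => y'.
  rewrite [RHS](expect_swapP mu mu (g := fun p => expect mu (fun x => F x p.1 p.2 y')));
    [|by rewrite /F; bmt|by []].
  apply: eq_expect => y.
  by rewrite (expect_swapP mu mu (g := fun p => F p.1 p.2 y y')); [|by rewrite /F; bmt|by []].
rewrite (expect_swapP mu mu (g := fun p => expect mu (fun y => expect mu (fun x =>
  F x p.2 y p.1)))); [|by rewrite /F; bmt|by []].
apply: eq_expect => x'; apply: eq_expect => y'.
rewrite (expect_swapP mu mu (g := fun p => F p.2 x' p.1 y')); [|by rewrite /F; bmt|by []].
rewrite -expectZl; last by bmt.
apply: eq_expect => x; rewrite -expectZl; last by bmt.
by apply: eq_expect => y; rewrite /F; ring.
Qed.

Lemma box_le_cut D b c : bm D -> 0 < b -> (forall p, `|D p| <= b) ->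
  cut_le D c -> box D <= 4 * b ^+ 3 * c.
Proof.
move=> bD b0 Db Dc; rewrite boxE//; apply: le_trans (ler_norm _) _.
rewrite (_ : 4 * b ^+ 3 * c = b * (4 * b * b * c)); last by ring.
apply: expect_normr_le; first by rewrite /kform; bmt.
move=> x'; apply: expect_normr_le; first by rewrite /kform; bmt.
move=> y'; rewrite normrM ler_pM//.
by apply: kform_norm_cut => //; bmt.
Qed.

Definition L1norm D : R := expect mu (fun x => expect mu (fun y => `|D (x, y)|)).

Lemma kform_le_L1 D f g : bm D -> bm f -> bm g ->
  (forall x, `|f x| <= 1) -> (forall x, `|g x| <= 1) ->
  `|kform D f g| <= L1norm D.
Proof.
move=> bD bf bg f1 g1; apply: le_trans (ler_norm_expect _ _) _; first by bmt.
apply: ler_expect; [by bmt..|] => x.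
apply: le_trans (ler_norm_expect _ _) _; first by bmt.
apply: ler_expect; [by bmt..|] => y.
by rewrite normrM ler_piMr// normrM mulr_ile1.
Qed.

Lemma cut_le_L1 D c : bm D -> L1norm D <= c -> cut_le D c.
Proof.
move=> bD Dc S U mS mU; apply: le_trans Dc.
by apply: kform_le_L1 => //; try exact: bm_indic;
  move=> x; rewrite indicE; case: (_ \in _); rewrite ?normr1 ?normr0.
Qed.

(** Meant for the difference of two kernels bounded by [b] that agree whenever both points avoid the
    exceptional set [N]. *)
Lemma L1norm_mismatch D (N : set T) b : bm D -> measurable N ->
  (forall x y, `|D (x, y)| <= 2 * b * (\1_N x + \1_N y)) ->
  L1norm D <= 4 * b * expect mu \1_N.
Proof.
move=> bD mN Db; have bN := bm_indic R mN.
apply: (@le_trans _ _ (expect mu (fun x => expect mu (fun y =>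
    2 * b * (\1_N x + \1_N y))))).
  apply: ler_expect; [by bmt..|] => x.
  by apply: ler_expect; [by bmt..|] => y.
under eq_expect => x.
  rewrite expectZl; last by bmt.
  rewrite expectD; [|exact: bm_cst|exact: bN].
  rewrite expect_cst.
over.
rewrite expectZl; last by bmt.
rewrite expectD; [|exact: bN|exact: bm_cst].
by rewrite expect_cst; lra.
Qed.

End cut_norm.

Lemma box_comp d d' (T : measurableType d) (T' : measurableType d')
    (R : realType) (P : probability T R) (Q : probability T' R) (h : T -> T')
    (D : T' * T' -> R) : measure_preserving P Q h -> bm D ->
  box P (fun p => D (h p.1, h p.2)) = box Q D.
Proof.
move=> hP bD; have [mh _] := hP; rewrite /box /codegree.
rewrite [RHS](expect_preserving hP); last by bmt.
apply: eq_expect => y; rewrite [RHS](expect_preserving hP); last by bmt.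
apply: eq_expect => y'; rewrite [in RHS](expect_preserving hP)//; bmt.
Qed.

(** * The counting lemma *)

Section counting.
Context d (T : measurableType d) (R : realType) (mu : probability T R) (n : nat).
Local Notation pairs := ('I_n * 'I_n)%type.
Implicit Types (K : pairs -> T * T -> R) (s : seq pairs) (e : pairs).

(** The kernel may vary with the edge, as it does in the hybrids between two kernels in the counting
    lemma. *)
Definition edge_product K s (x : n.-tuple T) : R :=
  \prod_(e <- s) K e (tnth x e.1, tnth x e.2).

Lemma bm_edge_product K s : (forall e, bm (K e)) -> bm (edge_product K s).
Proof.
move=> bK; apply: bm_prod => e.
apply: (bm_comp (h := fun x : n.-tuple T => (tnth x e.1, tnth x e.2)) (bK e)).
measurable_map.
Qed.

(** In a simple graph no edge other than [e0] joins the two ends of [e0]. With the remaining points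
    frozen, each factor therefore depends on at most one of u and v. Since 1 <= [b], the same power
    of [b] bounds both [f] and [g]. *)
Lemma edge_product_factors K s (b : R) (e0 : pairs) (t : n.-tuple T) :
  (forall e, bm (K e)) -> 1 <= b -> (forall e p, `|K e p| <= b) ->
  (e0.1 < e0.2)%N -> all (fun e => e.1 < e.2)%N s ->
  exists f g : T -> R,
    [/\ bm f, bm g, (forall u, `|f u| <= b ^+ size s),
        (forall v, `|g v| <= b ^+ size s) &
        forall u v, \prod_(e <- s | e != e0)
          K e (tnth (tset (tset t e0.1 u) e0.2 v) e.1,
               tnth (tset (tset t e0.1 u) e0.2 v) e.2) = f u * g v].
Proof.
move=> bK b1 Kb e0lt; elim: s => [_|e s ih /= /andP[elt /ih[f [g [bf bg fb gb fg]]]]].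
  exists (fun=> 1), (fun=> 1); split; try exact: bm_cst.
  - by move=> u; rewrite normr1 expr0.
  - by move=> u; rewrite normr1 expr0.
  - by move=> u v; rewrite big_nil mulr1.
have b0 : 0 <= b by exact: le_trans b1.
have bS h : (forall u : T, `|h u| <= b ^+ size s) ->
    forall u, `|h u| <= b ^+ (size s).+1.
  by move=> hb u; rewrite exprS (le_trans (hb u))// ler_peMl ?exprn_ge0.
have [ee0|ee0] := eqVneq e e0.
  exists f, g; split=> //; try exact: bS.
  by move=> u v; rewrite big_cons ee0 eqxx fg.
pose co (i a : 'I_n) (u : T) := if a == i then u else tnth t a.
have mco i a : measurable_fun setT (co i a).
  by rewrite /co; case: (a == i); [exact: measurable_id|exact: measurable_cst].
have bco i : bm (fun u => K e (co i e.1 u, co i e.2 u)).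
  apply: (bm_comp (h := fun u => (co i e.1 u, co i e.2 u)) (bK e)).
  exact: measurable_fun_pair.
have prodb (h h' : T -> R) : (forall u, `|h u| <= b ^+ size s) ->
    (forall u, `|h' u| <= b) -> forall u, `|h u * h' u| <= b ^+ (size s).+1.
  by move=> hb h'b u; rewrite normrM exprSr ler_pM.
have [je|je] := boolP ((e.1 == e0.2) || (e.2 == e0.2)).
- exists f, (fun v => g v * K e (co e0.2 e.1 v, co e0.2 e.2 v)); split=> //.
  + exact: bmM.
  + exact: bS.
  + exact: prodb.
  + move=> u v; rewrite big_cons ee0 fg !tnth_tset /co mulrC -mulrA.
    congr (_ * (_ * _)).
    (* An edge through [e0.2] that also met [e0.1] would equal [e0], because both pairs are
       increasing. *)
    have [i1 i2] : e.1 != e0.1 /\ e.2 != e0.1.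
      case/orP: je => /eqP je; split; apply/eqP => ie.
      * by move: e0lt; rewrite -je ie ltnn.
      * by move: elt; rewrite je ie => /(ltn_trans e0lt); rewrite ltnn.
      * by case/eqP: ee0; rewrite [e]surjective_pairing ie je -surjective_pairing.
      * by move: e0lt; rewrite -je ie ltnn.
    by rewrite (negbTE i1) (negbTE i2).
- exists (fun u => f u * K e (co e0.1 e.1 u, co e0.1 e.2 u)), g; split=> //.
  + exact: bmM.
  + exact: prodb.
  + exact: bS.
  + move: je; rewrite negb_or => /andP[j1 j2] u v.
    rewrite big_cons ee0 fg !tnth_tset /co (negbTE j1) (negbTE j2).
    by rewrite mulrA; congr (_ * _); rewrite mulrC.
Qed.

(** Resampling the two ends of [e0] turns the integrand, for each frozen tuple, into [D (u, v)]
    times a function of u times a function of v, so the cut norm applies. *)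
Lemma expect_edge_exchange K (D : T * T -> R) s b c e0 :
  (forall e, bm (K e)) -> bm D -> 1 <= b -> (forall e p, `|K e p| <= b) ->
  (e0.1 < e0.2)%N -> all (fun e => e.1 < e.2)%N s -> cut_le mu D c ->
  `|expect (power_measure mu n) (fun x => D (tnth x e0.1, tnth x e0.2) *
      \prod_(e <- s | e != e0) K e (tnth x e.1, tnth x e.2))| <=
  4 * b ^+ size s * b ^+ size s * c.
Proof.
move=> bK bD b1 Kb e0lt slt Dc.
set F := fun x => _.
have bF : bm F.
  apply: bmM; first by bmt.
  apply: bm_prod => e.
  apply: (bm_comp (h := fun x : n.-tuple T => (tnth x e.1, tnth x e.2)) (bK e)).
  measurable_map.
have bF1 : bm (fun t => expect mu (fun u => F (tset t e0.1 u))).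
  apply: bm_expect; apply: (bm_comp (h := fun p => tset p.1 e0.1 p.2) bF).
  by apply: measurable_tset; measurable_map.
have bF2 : bm (fun p : n.-tuple T * T => expect mu (fun v => F (tset (tset p.1 e0.1 p.2) e0.2 v))).
  apply: bm_expect.
  apply: (bm_comp (h := fun p => tset (tset p.1.1 e0.1 p.1.2) e0.2 p.2) bF).
  by apply: measurable_tset; [apply: measurable_tset|]; measurable_map.
rewrite (expect_resample mu e0.2 bF).
have bF3 : bm (fun t => expect mu (fun v => F (tset t e0.2 v))).
  apply: bm_expect; apply: (bm_comp (h := fun p => tset p.1 e0.2 p.2) bF).
  by apply: measurable_tset; measurable_map.
rewrite (expect_resample mu e0.1 bF3).
apply: expect_normr_le; first exact: (@bm_expect _ _ _ _ _ mu (fun t u =>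
  expect mu (fun v => F (tset (tset t e0.1 u) e0.2 v)))).
move=> t; have [f [g [bf bg fb gb fg]]] := edge_product_factors t bK b1 Kb e0lt slt.
have -> : expect mu (fun u => expect mu (fun v =>
    F (tset (tset t e0.1 u) e0.2 v))) = kform mu D f g.
  apply: eq_expect => u; apply: eq_expect => v; rewrite /F fg; congr (D (_, _) * _).
    by rewrite !tnth_tset eqxx; case: eqVneq e0lt => // ->; rewrite ltnn.
  by rewrite tnth_tset eqxx.
have b0 : 0 < b by exact: lt_le_trans b1.
by apply: kform_norm_cut => //; rewrite exprn_gt0.
Qed.

Lemma counting_lemma (W W' : T * T -> R) s b c :
  bm W -> bm W' -> 1 <= b -> (forall p, `|W p| <= b) -> (forall p, `|W' p| <= b) ->
  all (fun e => e.1 < e.2)%N s -> uniq s ->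
  cut_le mu (fun p => W p - W' p) c ->
  `|expect (power_measure mu n) (edge_product (fun=> W) s) -
    expect (power_measure mu n) (edge_product (fun=> W') s)| <=
  (size s)%:R * (4 * b ^+ size s * b ^+ size s * c).
Proof.
move=> bW bW' b1 Wb W'b slt us Dc; set C := (X in _ * X).
(* Hybrid number [m] uses [W'] on the first [m] edges and [W] on the others; consecutive hybrids
   differ on one edge. *)
pose K m e := if (index e s < m)%N then W' else W.
have bK m e : bm (K m e) by rewrite /K; case: ifP.
have Kb m e p : `|K m e p| <= b by rewrite /K; case: ifP.
pose A m := expect (power_measure mu n) (edge_product (K m) s).
have A0 : A 0%N = expect (power_measure mu n) (edge_product (fun=> W) s).
  by [].
have As : A (size s) = expect (power_measure mu n) (edge_product (fun=> W') s).
  apply: eq_expect => x; apply: eq_big_seq => e es.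
  by rewrite /K index_mem es.
rewrite -A0 -As.
suff step m : (m <= size s)%N -> `|A 0%N - A m| <= m%:R * C by exact: step.
elim: m => [_|m ih ms]; first by rewrite subrr normr0 mul0r.
rewrite (_ : A 0%N - A m.+1 = (A 0%N - A m) + (A m - A m.+1)); last by ring.
apply: le_trans (ler_normD _ _) _; rewrite -addn1 natrD mulrDl mul1r.
apply: lerD; first by apply: ih; exact: ltnW.
(* As [m < size s], the list has a head, which serves as the default of [nth]. *)
case: s slt us @C @K bK Kb @A A0 As ih ms => // e1 s1.
set s := e1 :: s1 => slt us C K bK Kb A A0 As ih ms.
pose e0 := nth e1 s m.
have e0s : e0 \in s by exact: mem_nth.
rewrite /A -expectB; [|exact: bm_edge_product|exact: bm_edge_product].
have := expect_edge_exchange (bK m) (bmD bW (bmN bW')) b1 (Kb m)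
  (allP slt _ e0s) slt Dc.
congr (`|_| <= _); apply: eq_expect => x.
rewrite /edge_product (bigD1_seq e0)//= [in RHS](bigD1_seq e0)//=.
have -> : \prod_(i <- s | i != e0) K (m + 1)%N i (tnth x i.1, tnth x i.2) =
    \prod_(i <- s | i != e0) K m i (tnth x i.1, tnth x i.2).
  rewrite big_seq_cond [RHS]big_seq_cond; apply: eq_bigr => e /andP[es ee0].
  rewrite /K addn1 ltnS leq_eqVlt; case: eqP => // em.
  by case/eqP: ee0; rewrite /e0 -em nth_index.
by rewrite /K addn1 ltnS index_uniq// leqnn ltnn -mulrBl.
Qed.

End counting.

(** * Weak regularity *)

Definition labelling d (T : measurableType d) (L : finType) (z : T -> L) : Prop :=
  forall a, measurable (z @^-1` [set a]).

Section labelling.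
Context d (T : measurableType d) (R : realType) (mu : probability T R).
Variable L : finType.
Implicit Types (z : T -> L) (a : L).

Definition mass z a : R := expect mu \1_(z @^-1` [set a]).

Lemma indic_label z a x : \1_(z @^-1` [set a]) x = (z x == a)%:R :> R.
Proof.
rewrite indicE; congr (nat_of_bool _)%:R.
by apply/idP/eqP => [/set_mem//|zx]; exact/mem_set.
Qed.

Lemma label_sum z (f : L -> R) x :
  f (z x) = \sum_a f a * \1_(z @^-1` [set a]) x.
Proof.
rewrite (bigD1 (z x))//= big1 => [|a za]; last first.
  by rewrite indic_label eq_sym (negbTE za) mulr0.
by rewrite indic_label eqxx mulr1 addr0.
Qed.

Lemma bm_label z (f : L -> R) : labelling z -> bm (fun x => f (z x)).
Proof.
move=> mz; under [X in bm X]eq_fun do rewrite label_sum.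
apply: bm_sum => a; have mza := mz a; bmt; exact: mza.
Qed.

Lemma expect_label z (f : L -> R) : labelling z ->
  expect mu (fun x => f (z x)) = \sum_a f a * mass z a.
Proof.
move=> mz; under eq_expect => x do rewrite label_sum.
rewrite expect_sum => [|a]; last by apply: bmM; [exact: bm_cst|exact: bm_indic].
by apply: eq_bigr => a _; rewrite expectZl//; exact: bm_indic.
Qed.

Lemma mass_ge0 z a : 0 <= mass z a.
Proof. by apply: ge0_expect => x; rewrite indicE. Qed.

Lemma sum_mass z : labelling z -> \sum_a mass z a = 1.
Proof.
move=> mz; have := expect_label (fun=> 1) mz; rewrite expect_cst => ->.
by apply: eq_bigr => a _; rewrite mul1r.
Qed.

Lemma labelling_measurable z (A : set L) : labelling z -> measurable (z @^-1` A).
Proof.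
move=> mz; rewrite (_ : z @^-1` A = \bigcup_(a in A) (z @^-1` [set a])).
  by apply: fin_bigcup_measurable => // a _; exact: mz.
by apply/seteqP; split => [x Ax|x [a Aa /= ->]//]; exists (z x).
Qed.

End labelling.

Lemma labelling_pair d (T : measurableType d) (L L' : finType) (z : T -> L) (z' : T -> L') :
  labelling z -> labelling z' -> labelling (fun x => (z x, z' x)).
Proof.
move=> mz mz' [a b]; rewrite (_ : _ @^-1` _ =
    (z @^-1` [set a]) `&` (z' @^-1` [set b])); first exact: measurableI.
by apply/seteqP; split => [x /= [-> ->]//|x [/= -> ->]].
Qed.

Lemma bm_label2 d (T : measurableType d) d' (T' : measurableType d') (R : realType)
  (L L' : finType) (z : T -> L) (z' : T' -> L') (G : L -> L' -> R) :
  labelling z -> labelling z' -> bm (fun p => G (z p.1) (z' p.2)).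
Proof.
move=> mz mz'.
have mzz' : labelling (fun p : T * T' => (z p.1, z' p.2)).
  apply: (@labelling_pair _ _ _ _ (z \o fst) (z' \o snd)) => a.
    by rewrite comp_preimage -[X in measurable X]setTI; apply: measurable_fst.
  by rewrite comp_preimage -[X in measurable X]setTI; apply: measurable_snd.
exact: (bm_label (fun ab => G ab.1 ab.2) mzz').
Qed.

Section regularity.
Context d (T : measurableType d) (R : realType) (mu : probability T R).
Implicit Types (D W : T * T -> R).

Definition energy D : R := expect mu (fun x => expect mu (fun y => D (x, y) ^+ 2)).

Lemma energy_ge0 D : 0 <= energy D.
Proof. by apply: ge0_expect => y; apply: ge0_expect => y'; exact: sqr_ge0. Qed.

(** Expanding the square gives -2 t k + t^2 times a measure at most 1, where k is the value of the
    form. As t has absolute value [eps] and the sign of k, this is at most -2 eps^2 + eps^2. *)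
Lemma energy_decrement D (S U : set T) eps t : bm D -> measurable S -> measurable U ->
  0 < eps -> eps < `|kform mu D \1_S \1_U| ->
  t = eps * Num.sg (kform mu D \1_S \1_U) ->
  energy (fun p => D p - t * (\1_S p.1 * \1_U p.2)) <= energy D - eps ^+ 2.
Proof.
move=> bD mS mU eps0 big tE.
have bS := bm_indic R mS; have bU := bm_indic R mU.
have bK : bm (fun x => expect mu (fun y => D (x, y) * (\1_S x * \1_U y))) by bmt.
have -> : energy (fun p => D p - t * (\1_S p.1 * \1_U p.2)) =
    energy D + (- (2 * t)) * kform mu D \1_S \1_U +
    t ^+ 2 * expect mu (fun x => expect mu (fun y => (\1_S x * \1_U y) ^+ 2)).
  rewrite /energy /kform -expectZl; last by bmt.
  rewrite -expectD; [|by bmt..].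
  rewrite -expectZl; last by bmt.
  rewrite -expectD; [|by bmt..].
  apply: eq_expect => x /=; rewrite -expectZl; last by bmt.
  rewrite -expectD; [|by bmt..].
  rewrite -expectZl; last by bmt.
  rewrite -expectD; [|by bmt..].
  by apply: eq_expect => y /=; ring.
set k := kform _ _ _ _ in big tE *.
have le1 : expect mu (fun x => expect mu (fun y => (\1_S x * \1_U y) ^+ 2)) <= 1 :> R.
  apply: expect_le => [|x]; first by bmt.
  apply: expect_le => [|y]; first by bmt.
  by rewrite !indicE; case: (_ \in _); case: (_ \in _);
    rewrite ?mulr1 ?mulr0 ?expr1n ?expr0n.
have k0 : k != 0 by rewrite -normr_gt0 (lt_trans eps0).
have t2 : t ^+ 2 = eps ^+ 2 by rewrite tE exprMn sqr_sg k0 mulr1.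
have tk : t * k = eps * `|k| by rewrite tE -mulrA -normrEsg.
have : eps ^+ 2 < t * k by rewrite tk expr2 ltr_pM2l.
have : t ^+ 2 * expect mu (fun x => expect mu (fun y => (\1_S x * \1_U y) ^+ 2)) <=
    eps ^+ 2 by rewrite t2 ler_piMr// sqr_ge0.
lra.
Qed.

(** As long as some pair of sets violates the cut bound, subtract the corresponding rectangle. Each
    round costs eps^2 of a nonnegative energy, so fewer than [n] rounds can occur. *)
Lemma greedy_approximation n D eps : bm D -> 0 < eps ->
  energy D < n%:R * eps ^+ 2 ->
  exists (c : nat -> R) (S U : nat -> set T),
    [/\ forall i, measurable (S i), forall i, measurable (U i) &
      cut_le mu (fun p => D p -
        \sum_(i < n) c i * (\1_(S i) p.1 * \1_(U i) p.2)) eps].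
Proof.
move=> + eps0; elim: n D => [|n ih] D bD.
  by rewrite mul0r ltNge energy_ge0.
have [Dcut _|Dcut en] := pselect (cut_le mu D eps).
  (* When the process stops early, the remaining terms are padded with zeros. *)
  exists (fun=> 0), (fun=> set0), (fun=> set0); split; [by []|by []|].
  apply: eq_cut_le Dcut => p; rewrite big1 ?subr0// => i _; exact: mul0r.
have [S [U [mS mU big]]] : exists S U : set T,
    [/\ measurable S, measurable U & eps < `|kform mu D \1_S \1_U|].
  apply: contrapT => h; apply: Dcut => S U mS mU; rewrite leNgt; apply/negP => ?.
  by apply: h; exists S, U.
pose t := eps * Num.sg (kform mu D \1_S \1_U).
have dec := energy_decrement bD mS mU eps0 big (erefl t).
have bS := bm_indic R mS; have bU := bm_indic R mU.
have [||c [S' [U' [mS' mU' cut]]]] := ih (fun p => D p - t * (\1_S p.1 * \1_U p.2)).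
- by bmt.
- by apply: le_lt_trans dec _; rewrite ltrBlDr; move: en; rewrite -addn1 natrD mulrDl mul1r.
exists (fun i => if (i < n)%N then c i else t),
  (fun i => if (i < n)%N then S' i else S), (fun i => if (i < n)%N then U' i else U).
split=> [i|i|]; try by case: ifP.
apply: eq_cut_le cut => p; rewrite big_ord_recr/= ltnn.
under [in RHS]eq_bigr => i _ do rewrite ltn_ord.
by rewrite opprD addrA addrAC.
Qed.

Section averages.
Variables (L : finType) (z : T -> L).
Hypothesis mz : labelling z.
Let cell a : set T := z @^-1` [set a].
Let bcell a : bm (\1_(cell a) : T -> R). Proof. by apply: bm_indic; exact: mz. Qed.
Let m := mass mu z.

(** On blocks of measure zero the division yields 0. *)
Definition block_average W (a b : L) : R :=
  kform mu W \1_(cell a) \1_(cell b) / (m a * m b).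

(** The conditional expectation of the indicator of [S] given the label, with value 0 on null
    cells. *)
Definition cond_indic (S : set T) (x : T) : R :=
  expect mu (fun y => \1_S y * \1_(cell (z x)) y) / m (z x).

Lemma cell_mass (S : set T) a : measurable S ->
  0 <= expect mu (fun y => \1_S y * \1_(cell a) y) <= m a.
Proof.
move=> mS; have bS := bm_indic R mS; have bca := bcell a; apply/andP; split.
  by apply: ge0_expect => x; rewrite mulr_ge0// indicE.
apply: ler_expect; [by bmt|by []|] => x.
by rewrite ler_piMl// indicE// lern1 leq_b1.
Qed.

Lemma cond_indic01 S x : measurable S -> 0 <= cond_indic S x <= 1.
Proof.
move=> mS; have /andP[s0 sm] := cell_mass (z x) mS.
rewrite /cond_indic; have [m0|m0] := eqVneq (m (z x)) 0.
  by rewrite m0 invr0 mulr0 lexx ler01.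
have mp : 0 < m (z x) by rewrite lt0r m0; exact: mass_ge0.
by rewrite divr_ge0 ?(ltW mp)// ler_pdivrMr// mul1r.
Qed.

Lemma bm_cond_indic S : bm (cond_indic S).
Proof.
exact: (bm_label (fun a => expect mu (fun y => \1_S y * \1_(cell a) y) / m a) mz).
Qed.

Lemma expect_cond_indic S a : measurable S ->
  expect mu (fun x => cond_indic S x * \1_(cell a) x) =
  expect mu (fun x => \1_S x * \1_(cell a) x).
Proof.
move=> mS; set s := expect mu (fun x => \1_S x * _).
transitivity (expect mu (fun x => s / m a * \1_(cell a) x)).
  apply: eq_expect => x; rewrite /cell indic_label.
  by case: eqP => [zx|]; rewrite ?mulr0// /cond_indic zx.
(* On a null cell [s] is squeezed between 0 and 0, so both sides vanish. *)
rewrite expectZl//; have [m0|m0] := eqVneq (m a) 0; last by rewrite divfK.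
have := cell_mass a mS; rewrite m0 -/s -eq_le => /eqP <-.
by rewrite !mul0r.
Qed.

Lemma kform_label (G : L -> L -> R) (f g : T -> R) : bm f -> bm g ->
  kform mu (fun p => G (z p.1) (z p.2)) f g =
  \sum_a \sum_b G a b * (expect mu (fun x => f x * \1_(cell a) x) *
                        expect mu (fun x => g x * \1_(cell b) x)).
Proof.
move=> bf bg.
transitivity (expect mu (fun x => \sum_a \sum_b G a b *
    ((f x * \1_(cell a) x) * expect mu (fun y => g y * \1_(cell b) y)))).
  apply: eq_expect => x /=.
  transitivity (expect mu (fun y => \sum_a \sum_b G a b *
    ((f x * \1_(cell a) x) * (g y * \1_(cell b) y)))).
    apply: eq_expect => y; rewrite (label_sum z (fun a => G a (z y)))/= mulr_suml.
    apply: eq_bigr => a _; rewrite (label_sum z (fun b => G a b)) !mulr_suml.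
    by apply: eq_bigr => b _; rewrite -/(cell a) -/(cell b); ring.
  rewrite expect_sum => [|a]; last by bmt; exact: mz.
  apply: eq_bigr => a _; rewrite expect_sum => [|b]; last by bmt; exact: mz.
  apply: eq_bigr => b _; rewrite expectZl; last by bmt; exact: mz.
  by rewrite expectZl//; bmt; exact: mz.
rewrite expect_sum => [|a]; last by bmt; exact: mz.
apply: eq_bigr => a _; rewrite expect_sum => [|b]; last by bmt; exact: mz.
apply: eq_bigr => b _; rewrite expectZl; last by bmt; exact: mz.
by rewrite expectZr//; bmt; exact: mz.
Qed.

Lemma kform_simple W (f g : L -> R) : bm W ->
  kform mu W (fun x => f (z x)) (fun x => g (z x)) =
  \sum_a \sum_b f a * g b * kform mu W \1_(cell a) \1_(cell b).
Proof.
move=> bW.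
transitivity (expect mu (fun x => \sum_a \sum_b f a * g b *
    expect mu (fun y => W (x, y) * (\1_(cell a) x * \1_(cell b) y)))).
  apply: eq_expect => x /=.
  transitivity (expect mu (fun y => \sum_a \sum_b f a * g b *
      (W (x, y) * (\1_(cell a) x * \1_(cell b) y)))).
    apply: eq_expect => y; rewrite (label_sum z f) (label_sum z g).
    rewrite mulr_suml mulr_sumr; apply: eq_bigr => a _.
    rewrite mulr_sumr mulr_sumr; apply: eq_bigr => b _.
    by rewrite -/(cell a) -/(cell b); ring.
  rewrite expect_sum => [|a]; last by bmt; exact: mz.
  apply: eq_bigr => a _; rewrite expect_sum => [|b]; last by bmt; exact: mz.
  by apply: eq_bigr => b _; rewrite expectZl//; bmt; exact: mz.
rewrite expect_sum => [|a]; last by bmt; exact: mz.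
apply: eq_bigr => a _; rewrite expect_sum => [|b]; last by bmt; exact: mz.
by apply: eq_bigr => b _; rewrite expectZl//; bmt; exact: mz.
Qed.

(** Averaging is self-adjoint: it can be moved from the kernel to the test functions. *)
Lemma kform_block_average W S U : bm W -> measurable S -> measurable U ->
  kform mu (fun p => block_average W (z p.1) (z p.2)) \1_S \1_U =
  kform mu W (cond_indic S) (cond_indic U).
Proof.
move=> bW mS mU; rewrite kform_label; [|exact: (bm_indic R mS)|exact: (bm_indic R mU)].
rewrite (kform_simple (fun a => expect mu (fun y => \1_S y * \1_(cell a) y) / m a)
  (fun a => expect mu (fun y => \1_U y * \1_(cell a) y) / m a))//.
apply: eq_bigr => a _; apply: eq_bigr => b _; rewrite /block_average invfM.
by ring.
Qed.

(* The averaging operator is an L^infinity contraction that fixes the kernels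
   constant on blocks, so it at most doubles their distance to W. *)
Lemma cut_le_block_average W (G : L -> L -> R) eps : bm W ->
  cut_le mu (fun p => W p - G (z p.1) (z p.2)) eps ->
  cut_le mu (fun p => W p - block_average W (z p.1) (z p.2)) (eps + eps).
Proof.
move=> bW cut S U mS mU.
have bG : bm (fun p => G (z p.1) (z p.2)).
  exact: (@bm_label2 _ _ _ _ _ _ _ _ _ G mz mz).
have bA : bm (fun p => block_average W (z p.1) (z p.2)).
  exact: (@bm_label2 _ _ _ _ _ _ _ _ _ (block_average W) mz mz).
have bS := bm_indic R mS; have bU := bm_indic R mU.
have bcS := bm_cond_indic S; have bcU := bm_cond_indic U.
rewrite (kformB _ bW bA bS bU) kform_block_average//.
have eG : kform mu (fun p => G (z p.1) (z p.2)) (cond_indic S) (cond_indic U) =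
    kform mu (fun p => G (z p.1) (z p.2)) \1_S \1_U.
  rewrite !kform_label//; apply: eq_bigr => a _; apply: eq_bigr => b _.
  by rewrite !expect_cond_indic.
rewrite (_ : _ - _ = kform mu (fun p => W p - G (z p.1) (z p.2)) \1_S \1_U -
    kform mu (fun p => W p - G (z p.1) (z p.2)) (cond_indic S) (cond_indic U)).
  apply: le_trans (ler_normB _ _) _; apply: lerD; first exact: cut.
  apply: (kform_norm_cut01 (bmD bW (bmN bG)) bcS bcU _ _ cut) => x;
    exact: cond_indic01.
refine (eq_trans _ (esym (f_equal2 (fun u v : R => u - v)
  (kformB mu bW bG bS bU) (kformB mu bW bG bcS bcU)))).
rewrite eG; move: (kform mu W \1_S \1_U)
  (kform mu W (cond_indic S) (cond_indic U))
  (kform mu (fun p => G (z p.1) (z p.2)) \1_S \1_U) => k1 k2 k3; ring.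
Qed.

Lemma block_average_bounded W C a b : bm W -> (forall p, `|W p| <= C) ->
  `|block_average W a b| <= C.
Proof.
move=> bW WC; have bca := bcell a; have bcb := bcell b.
(* A probability space has a point, and evaluating the bound there gives 0 <= [C]. *)
have [[x _]|no] := pselect (exists x : T, True); last first.
  have: expect mu (fun=> 1) = 0 :> R.
    rewrite (_ : (fun=> 1) = fun=> 0) ?expect_cst//.
    by apply/funext => x; exfalso; apply: no; exists x.
  by rewrite expect_cst => /eqP; rewrite oner_eq0.
have C0 : 0 <= C by exact: le_trans (WC (x, x)).
have le : `|kform mu W \1_(cell a) \1_(cell b)| <= C * (m a * m b).
  rewrite /kform; apply: le_trans (ler_norm_expect _ _) _; first by bmt.
  rewrite (_ : C * (m a * m b) = expect mu (fun x => expect mu (fun y =>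
      C * (\1_(cell a) x * \1_(cell b) y)))); last first.
    rewrite -expectZr// -expectZl; last by bmt.
    apply: eq_expect => x'; rewrite expectZl; last by bmt.
    by rewrite expectZl.
  apply: ler_expect; [by bmt..|] => x'.
  apply: le_trans (ler_norm_expect _ _) _; first by bmt.
  apply: ler_expect; [by bmt..|] => y.
  rewrite normrM [X in _ * X]ger0_norm; last by rewrite mulr_ge0// indicE.
  by rewrite ler_wpM2r// mulr_ge0// indicE.
have [m0|m0] := eqVneq (m a * m b) 0.
  by rewrite /block_average m0 invr0 mulr0 normr0.
have mp : 0 < m a * m b by rewrite lt0r m0 mulr_ge0//; exact: mass_ge0.
by rewrite /block_average normrM normfV (gtr0_norm mp) ler_pdivrMr.
Qed.

Lemma block_average_sym W a b : bm W -> (forall x y, W (x, y) = W (y, x)) ->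
  block_average W a b = block_average W b a.
Proof.
move=> bW Ws; rewrite /block_average; apply: (f_equal2 (fun u v => u / v)); last exact: mulrC.
have bca := bcell a; have bcb := bcell b.
rewrite {1}/kform (expect_swapP mu mu (g := fun p => W (p.1, p.2) *
  (\1_(cell a) p.1 * \1_(cell b) p.2))); [|by bmt|by []].
by apply: eq_expect => x; apply: eq_expect => y; rewrite Ws; congr (_ * _); rewrite mulrC.
Qed.

End averages.

(** The label of a point records its membership in the sets of a greedy approximation. Passing to
    block averages doubles the error, but makes the step kernel symmetric and bounded by [C], which
    the greedy sum need not be. The label set is chosen before [W], so that later the sample size
    can be uniform in [W]. *)
Lemma weak_regularity (C eps : R) : 0 < eps -> exists L : finType,
  forall W, bm W -> (forall p, `|W p| <= C) -> (forall x y, W (x, y) = W (y, x)) ->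
  exists (z : T -> L) (M : L -> L -> R),
    [/\ labelling z, forall a b, M a b = M b a, forall a b, `|M a b| <= C &
        cut_le mu (fun p => W p - M (z p.1) (z p.2)) eps].
Proof.
move=> eps0; pose e := eps / 2; have e0 : 0 < e by rewrite divr_gt0.
(* The energy of [W] is at most C^2, which is less than (n + 1) e^2. *)
pose n := Num.trunc (C ^+ 2 / e ^+ 2); exists {ffun 'I_n.+1 -> bool * bool}.
move=> W bW WC Ws.
have en : energy W < n.+1%:R * e ^+ 2.
  rewrite -ltr_pdivrMr ?exprn_gt0//.
  apply: (@le_lt_trans _ _ (C ^+ 2 / e ^+ 2)); last exact: truncnS_gt.
  rewrite ler_pM2r ?invr_gt0 ?exprn_gt0//.
  apply: expect_le => [|x]; first by bmt.
  apply: expect_le => [|y]; first by bmt.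
  by rewrite -real_normK ?num_real// ler_sqr ?nnegrE// (le_trans _ (WC (x, y))).
have [c [S [U [mS mU cut]]]] := greedy_approximation bW e0 en.
pose z x := [ffun i : 'I_n.+1 => (x \in S i, x \in U i)].
have mz : labelling z.
  move=> a; rewrite (_ : z @^-1` [set a] = \bigcap_(i : 'I_n.+1)
      ((if (a i).1 then S i else ~` S i) `&` (if (a i).2 then U i else ~` U i))).
    apply: fin_bigcap_measurable => // i _; apply: measurableI; case: ifP => _ //;
      exact: measurableC.
  apply/seteqP; split => x /= => [<- i _|h].
    by rewrite ffunE/=; split; case: ifPn => // [/set_mem//|/negP h ?]; apply: h;
      exact/mem_set.
  apply/ffunP => i; rewrite ffunE; have [h1 h2] := h i I.
  rewrite [a i]surjective_pairing; congr (_, _).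
    by case: (a i).1 h1 => h1; [exact/mem_set|apply/negbTE/negP => /set_mem].
  by case: (a i).2 h2 => h2; [exact/mem_set|apply/negbTE/negP => /set_mem].
pose G (a b : {ffun 'I_n.+1 -> bool * bool}) :=
  \sum_(i < n.+1) c i * ((a i).1%:R * (b i).2%:R).
exists z, (block_average z W); split=> //.
- by move=> a b; exact: block_average_sym.
- by move=> a b; exact: block_average_bounded.
- rewrite [eps](_ : _ = e + e); last by rewrite /e; lra.
  apply: (cut_le_block_average mz (G := G) bW _).
  apply: eq_cut_le cut => p; congr (_ - _); apply: eq_bigr => i _.
  by rewrite !ffunE !indicE.
Qed.

End regularity.

(** * Splitting Lebesgue measure *)

Section atomless.
Context (R : realType).
Local Notation T := (measurableTypeR R).
Local Notation lam := (lebesgue01 R).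

Definition pr d (Om : measurableType d) (mu : probability Om R) (A : set Om) : R :=
  fine (mu A).

Section pr.
Context d (Om : measurableType d) (mu : probability Om R).

Lemma prE A : measurable A -> (pr mu A)%:E = mu A.
Proof. by move=> mA; rewrite /pr fineK// fin_num_measure. Qed.

Lemma pr_expect A : measurable A -> pr mu A = expect mu \1_A.
Proof. by move=> mA; rewrite expect_indic. Qed.

Lemma pr_setD A B : measurable A -> measurable B -> B `<=` A ->
  pr mu (A `\` B) = pr mu A - pr mu B.
Proof.
move=> mA mB BA; rewrite !pr_expect//; last exact: measurableD.
rewrite -expectB; [|exact: bm_indic|exact: bm_indic].
apply: eq_expect => x; rewrite !indicE in_setD.
have [xB|xB] := boolP (x \in B); last by rewrite andbT subr0.
by rewrite andbF [x \in A]mem_set ?subrr//; apply: BA; exact/set_mem.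
Qed.

Lemma pr_le A B : measurable A -> measurable B -> A `<=` B -> pr mu A <= pr mu B.
Proof.
move=> mA mB AB; rewrite -lee_fin !prE//; apply: le_measure => //; exact/mem_set.
Qed.

End pr.

Lemma lebesgue01_itv (A : set T) (x y : R) : measurable A -> x <= y ->
  pr lam (A `&` `]x, y]) <= y - x.
Proof.
move=> mA xy; have mxy : measurable (`]x, y] : set T) by exact: measurable_itv.
rewrite -lee_fin prE; last exact: measurableI.
apply: (@le_trans _ _ (lebesgue_measure (`]x, y] : set T))).
  apply: le_measure; rewrite ?inE//.
  - by apply: measurableI; [exact: measurableI|exact: measurable_itv].
  - by move=> u [[]].
rewrite lebesgue_measure_itv/= lte_fin; case: ifP => _ //.
by rewrite lee_fin subr_ge0.
Qed.

(** The measure of the part of [A] left of x is a 1-Lipschitz function of x, running from 0 at 0 to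
    the measure of [A] at 1; the intermediate value theorem picks the cut point. *)
Lemma lebesgue01_split (A : set T) (w : R) : measurable A -> 0 <= w <= pr lam A ->
  exists B, [/\ measurable B, B `<=` A & pr lam B = w].
Proof.
move=> mA /andP[w0 wA].
have mray x : measurable (`]-oo, x] : set T) by exact: measurable_itv.
have mAx x : measurable (A `&` `]-oo, x]) by exact: measurableI.
pose F x := pr lam (A `&` `]-oo, x]).
have Flip x y : x <= y -> 0 <= F y - F x <= y - x.
  move=> xy; have sub : A `&` `]-oo, x] `<=` A `&` `]-oo, y].
    by move=> u [Au]; rewrite /= !in_itv/= => ux; split => //; exact: le_trans xy.
  rewrite -pr_setD//; apply/andP; split; first by rewrite fine_ge0.
  apply: le_trans (lebesgue01_itv mA xy); apply: pr_le.
  - exact: measurableD.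
  - by apply: measurableI => //; exact: measurable_itv.
  - move=> u [[Au uy] h]; split => //; move: uy h; rewrite /= !in_itv/= => -> h.
    by rewrite andbT ltNge; apply/negP => ux; apply: h; split => //; rewrite /= in_itv.
have Fd x y : `|F x - F y| <= `|x - y|.
  have [xy|/ltW yx] := leP x y.
    have /andP[h1 h2] := Flip _ _ xy.
    by rewrite distrC ger0_norm// distrC ger0_norm// subr_ge0.
  have /andP[h1 h2] := Flip _ _ yx.
  by rewrite ger0_norm// ger0_norm// subr_ge0.
have Fc : continuous F.
  move=> x; apply/cvgrPdist_le => e e0; near=> y; apply: le_trans (Fd _ _) _.
  near: y; exact: cvgr_dist_le.
have F0 : F 0 = 0.
  have F00 : 0 <= F 0 by rewrite fine_ge0.
  apply/eqP; rewrite eq_le F00 andbT -lee_fin prE//.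
  apply: (@le_trans _ _ (lebesgue_measure [set (0 : R)])); last by rewrite lebesgue_measure_set1.
  apply: le_measure; rewrite ?inE//.
  - by apply: measurableI => //; exact: measurable_itv.
  - move=> u [[_]] /=; rewrite !in_itv/= => u0 /andP[u0' _].
    by apply/eqP; rewrite eq_le u0.
have F1 : F 1 = pr lam A.
  rewrite /F /pr; congr fine; rewrite /lebesgue01 /mrestr; congr (lebesgue_measure _).
  apply/seteqP; split => u [Au]; first by case: Au.
  by move=> u01; split => //; split => //; move: u01; rewrite /= !in_itv/= => /andP[].
have [|||c _ Fc_w] := @IVT R F 0 1 w; rewrite ?ler01//.
- exact: continuous_subspaceT.
- by rewrite F0 F1 ge_min le_max w0 wA orbT.
by exists (A `&` `]-oo, c]); split => // u [].
Unshelve. all: by end_near. Qed.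

Lemma lebesgue01_split_labels k (w : 'I_k.+1 -> R) (A : set T) : measurable A ->
  (forall i, 0 <= w i) -> \sum_i w i = pr lam A ->
  exists v : T -> 'I_k.+1, labelling v /\
    forall i, pr lam (A `&` v @^-1` [set i]) = w i.
Proof.
elim: k w A => [|k ih] w A mA w0 wA.
  exists (fun=> ord0); split=> [i|i].
    by rewrite (ord1 i) (_ : _ @^-1` _ = setT)//; apply/seteqP; split.
  rewrite (ord1 i) (_ : _ @^-1` _ = setT); last by apply/seteqP; split.
  by rewrite setIT -wA big_ord_recl big_ord0 addr0.
rewrite big_ord_recl in wA.
have S0 : 0 <= \sum_(i < k.+1) w (lift ord0 i) by rewrite sumr_ge0.
have [B [mB BA Bw]] : exists B, [/\ measurable B, B `<=` A & pr lam B = w ord0].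
  by apply: lebesgue01_split => //; rewrite w0 -wA lerDl.
have [|||v [mv vw]] := ih (w \o lift ord0) (A `\` B).
- exact: measurableD.
- by move=> i /=.
- by rewrite pr_setD// Bw -wA addrC addKr.
exists (fun x => if x \in B then ord0 else lift ord0 (v x)).
have v0 : (fun x => if x \in B then ord0 else lift ord0 (v x)) @^-1` [set ord0] = B.
  apply/seteqP; split => x /=; first by case: ifP => // /set_mem.
  by move=> xB; rewrite mem_set.
have vS i : (fun x => if x \in B then ord0 else lift ord0 (v x)) @^-1`
    [set lift ord0 i] = v @^-1` [set i] `\` B.
  apply/seteqP; split => x /=.
    by case: ifPn => [_ //|/negP xB /lift_inj ->]; split => // /mem_set.
  by move=> [<- xB]; rewrite memNset.
split=> i; case: (unliftP ord0 i) => [j ->|->].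
- by rewrite vS; apply: measurableD => //; exact: mv.
- by rewrite v0.
- rewrite vS -[RHS]vw; congr (pr _ _).
  by apply/seteqP; split => x /= [] => [? []|[]] *; split.
- by rewrite v0 setIidr.
Qed.

Lemma mass_pr d (Om : measurableType d) (mu : probability Om R) (L : finType)
  (z : Om -> L) a : labelling z -> mass mu z a = pr mu (z @^-1` [set a]).
Proof. by move=> mz; rewrite /mass pr_expect. Qed.

(** Splitting each cell of [p] separately realises any joint law with the right first marginal on
    [0,1] itself, without enlarging the probability space. *)
Lemma lebesgue01_joint_label (L : finType) k (p : T -> L) (w : L -> 'I_k.+1 -> R) :
  labelling p -> (forall a i, 0 <= w a i) ->
  (forall a, \sum_i w a i = mass lam p a) ->
  exists z : T -> 'I_k.+1, labelling z /\
    forall a i, mass lam (fun x => (p x, z x)) (a, i) = w a i.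
Proof.
move=> mp w0 wp.
have /choice[v vP] : forall a, exists v : T -> 'I_k.+1, labelling v /\
    forall i, pr lam (p @^-1` [set a] `&` v @^-1` [set i]) = w a i.
  move=> a; apply: lebesgue01_split_labels => //; by rewrite wp mass_pr.
pose z x := v (p x) x.
have mz : labelling z.
  move=> i; rewrite (_ : z @^-1` _ = \bigcup_(a in setT) (p @^-1` [set a] `&` v a @^-1` [set i])).
    apply: fin_bigcup_measurable => // a _; apply: measurableI; first exact: mp.
    by have [mva _] := vP a; exact: mva.
  apply/seteqP; split => x /=; first by move=> zx; exists (p x).
  by move=> [a _ [/= <-]].
exists z; split=> // a i; rewrite mass_pr; last exact: labelling_pair.
have [_ <-] := vP a; congr (pr _ _); apply/seteqP; split => x /=.
  by move=> [<- <-].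
by move=> [pa]; rewrite /z pa => ->.
Qed.

End atomless.

(** * Random graphs sampled from a kernel *)

Section random_graph.
Context d (T : measurableType d) (R : realType) (mu : probability T R).
Variables (lo hi : R) (n : nat).
Hypothesis lohi : lo < hi.
Local Notation pairs := ('I_n * 'I_n)%type.
Local Notation graph := {ffun pairs -> bool}.
Implicit Types (G : graph) (e : pairs) (W U : T * T -> R) (x : n.-tuple T).

(* A bit s stands for the endpoint "value s" of [lo, hi]; it is drawn with
   weights "coin s w" so as to have mean w. *)
Definition value (s : bool) : R := if s then hi else lo.

Definition coin (s : bool) (w : R) : R :=
  (if s then w - lo else hi - w) / (hi - lo).

(** The diagonal gets [lo] so that all values lie in [lo, hi]. *)
Definition graph_kernel G (i j : 'I_n) : R :=
  if (i < j)%N then value (G (i, j)) else if (j < i)%N then value (G (j, i)) else lo.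

(* The unused bits of G (those of e with e.1 >= e.2) are forced to be false. *)
Definition edge_weight W x e (s : bool) : R :=
  if (e.1 < e.2)%N then coin s (W (tnth x e.1, tnth x e.2)) else (~~ s)%:R.

Definition graph_weight W x G : R := \prod_e edge_weight W x e (G e).

Lemma graph_kernel_sym G i j : graph_kernel G i j = graph_kernel G j i.
Proof. by rewrite /graph_kernel; case: (ltngtP i j). Qed.

Lemma coin_sum w : coin true w + coin false w = 1.
Proof. by rewrite /coin; field; rewrite subr_eq0 gt_eqF. Qed.

Lemma coin_mean w : coin true w * hi + coin false w * lo = w.
Proof. by rewrite /coin; field; rewrite subr_eq0 gt_eqF. Qed.

Lemma coin_ge0 s w : lo <= w <= hi -> 0 <= coin s w.
Proof.
move=> /andP[lw wh]; rewrite /coin divr_ge0 ?subr_ge0 ?(ltW lohi)//.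
by case: s; rewrite subr_ge0.
Qed.

Lemma sum_edge_weight W x e : \sum_s edge_weight W x e s = 1.
Proof.
rewrite big_bool /edge_weight; case: ifP => _; first exact: coin_sum.
exact: add0r.
Qed.

(** Given the sample points the bits are independent, so the mean of a product over distinct pairs
    factors. Algebraically this is distributivity. *)
Lemma sum_graph_weight_prod W x (s : seq pairs) (phi : pairs -> bool -> R) : uniq s ->
  \sum_(G : graph) graph_weight W x G * \prod_(e <- s) phi e (G e) =
  \prod_(e <- s) \sum_b edge_weight W x e b * phi e b.
Proof.
move=> us; rewrite [RHS]big_uniq//= [RHS]big_mkcond/=.
transitivity (\sum_(G : graph) \prod_e (edge_weight W x e (G e) *
    if e \in s then phi e (G e) else 1)).
  apply: eq_bigr => G _; rewrite big_split/=; congr (_ * _).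
  by rewrite [LHS]big_uniq//= [LHS]big_mkcond.
rewrite -(bigA_distr_bigA (fun e b => edge_weight W x e b * if e \in s then phi e b else 1)).
apply: eq_bigr => e _; case: ifP => _ //.
by under eq_bigr do rewrite mulr1; exact: sum_edge_weight.
Qed.

Lemma sum_graph_weight W x  : \sum_(G : graph) graph_weight W x G = 1.
Proof.
transitivity (\prod_(e <- [::] : seq pairs) \sum_b edge_weight W x e b * 1); last first.
  by rewrite big_nil.
rewrite -(@sum_graph_weight_prod W x [::] (fun _ _ => 1) isT).
by apply: eq_bigr => G _; rewrite big_nil mulr1.
Qed.

Lemma graph_weight_ge0 W x G : (forall p, lo <= W p <= hi) -> 0 <= graph_weight W x G.
Proof.
move=> Wlh; apply: prodr_ge0 => e _; rewrite /edge_weight; case: ifP => // _.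
exact: coin_ge0.
Qed.

Lemma bm_graph_weight W G : bm W -> bm (fun x => graph_weight W x G).
Proof.
move=> bW; apply: bm_prod => e; rewrite /edge_weight /coin.
by case: (e.1 < e.2)%N; case: (G e); bmt.
Qed.

Definition residual U G x (i j : 'I_n) : R :=
  graph_kernel G i j - U (tnth x i, tnth x j).

(** This is n^4 times the box norm of the residual matrix, viewed as a step kernel with n steps of
    equal measure. *)
Definition graph_box U G x : R :=
  \sum_i \sum_i' \sum_j \sum_j' residual U G x i j * residual U G x i' j *
    (residual U G x i j' * residual U G x i' j').

Lemma bm_residual U G i j : bm U -> bm (fun x => residual U G x i j).
Proof. by move=> bU; rewrite /residual; bmt. Qed.

(** The position of the bit that [graph_kernel] reads for two distinct vertices. *)
Definition ordered_pair (i j : 'I_n) : pairs := if (i < j)%N then (i, j) else (j, i).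

Lemma ordered_pair_inj i j k l : ordered_pair i j = ordered_pair k l ->
  (i = k /\ j = l) \/ (i = l /\ j = k).
Proof.
by rewrite /ordered_pair; case: ifP => _; case: ifP => _ [-> ->]; [left|right|right|left].
Qed.

(** Four distinct indices give four distinct bits. These are independent given the points, and each
    residual has mean [W - U] at its pair of points. *)
Lemma mean_residual_prod W U x (i i' j j' : 'I_n) :
  (forall u v, W (u, v) = W (v, u)) -> (forall u v, U (u, v) = U (v, u)) ->
  uniq [:: i; i'; j; j'] ->
  \sum_(G : graph) graph_weight W x G * (residual U G x i j * residual U G x i' j *
      (residual U G x i j' * residual U G x i' j')) =
  let D p := W p - U p in
  D (tnth x i, tnth x j) * D (tnth x i', tnth x j) *
    (D (tnth x i, tnth x j') * D (tnth x i', tnth x j')).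
Proof.
move=> Ws Us; rewrite /= !inE !negb_or => /and4P[/and3P[ii' ij ij'] /andP[i'j i'j'] jj' _].
pose s := [:: ordered_pair i j; ordered_pair i' j; ordered_pair i j'; ordered_pair i' j'].
have us : uniq s.
  rewrite /= !inE !negb_or; apply/and4P; split => //.
  - apply/and3P; split; apply/eqP => /ordered_pair_inj[] [] e1 e2;
      by [move: ii'; rewrite e1 eqxx|move: jj'; rewrite e2 eqxx|move: ij'; rewrite e1 eqxx
         |move: ij; rewrite e1 eqxx | move: i'j; rewrite -e2 eqxx| move: jj'; rewrite -e2 eqxx].
  - apply/andP; split; apply/eqP => /ordered_pair_inj[] [] e1 e2;
      by [move: ii'; rewrite e1 eqxx|move: jj'; rewrite e2 eqxx|move: i'j'; rewrite e1 eqxx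
         |move: ij; rewrite e2 eqxx].
  - apply/eqP => /ordered_pair_inj[] [] e1 e2;
      by [move: ii'; rewrite e1 eqxx|move: ij'; rewrite e1 eqxx].
pose phi e b := value b - U (tnth x e.1, tnth x e.2).
have rphi G k l : k != l -> residual U G x k l = phi (ordered_pair k l) (G (ordered_pair k l)).
  move=> kl; rewrite /residual /phi /graph_kernel /ordered_pair.
  case: ltngtP => // /eqP; last by rewrite val_eqE (negbTE kl).
  by move=> _; rewrite Us.
transitivity (\sum_(G : graph) graph_weight W x G * \prod_(e <- s) phi e (G e)).
  apply: eq_bigr => G _; congr (_ * _).
  by rewrite /s !big_cons big_nil !rphi// mulr1 !mulrA.
rewrite sum_graph_weight_prod//.
have ophi k l : k != l -> \sum_b edge_weight W x (ordered_pair k l) b * phi (ordered_pair k l) b =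
    W (tnth x k, tnth x l) - U (tnth x k, tnth x l).
  move=> kl; set e := ordered_pair k l.
  have elt : (e.1 < e.2)%N.
    rewrite /e /ordered_pair; case: ifPn => //=; rewrite -leqNgt leq_eqVlt.
    by rewrite val_eqE eq_sym (negbTE kl).
  have -> : \sum_b edge_weight W x e b * phi e b =
      W (tnth x e.1, tnth x e.2) - U (tnth x e.1, tnth x e.2).
    rewrite big_bool/= /edge_weight elt /phi /value.
    rewrite -[in RHS](coin_mean (W _)) -[in RHS](mul1r (U _)).
    by rewrite -[in RHS](coin_sum (W (tnth x e.1, tnth x e.2))); ring.
  by rewrite /e /ordered_pair; case: ifP => //= _; rewrite Ws Us.
by rewrite /s !big_cons big_nil !ophi// mulr1 !mulrA.
Qed.

End random_graph.

(** * Moments of an independent sample *)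

Section sampling_box.
Context d (T : measurableType d) (R : realType) (mu : probability T R) (n : nat).

Lemma bm_resample (i : 'I_n) (f : n.-tuple T -> R) : bm f ->
  bm (fun t => expect mu (fun u => f (tset t i u))).
Proof.
move=> bf; apply: bm_expect; apply: (bm_comp (h := fun p => tset p.1 i p.2) bf).
by apply: measurable_tset; measurable_map.
Qed.

Lemma expect_box (D : T * T -> R) (i i' j j' : 'I_n) : bm D -> uniq [:: i; i'; j; j'] ->
  expect (power_measure mu n) (fun x =>
    D (tnth x i, tnth x j) * D (tnth x i', tnth x j) *
    (D (tnth x i, tnth x j') * D (tnth x i', tnth x j'))) = box mu D.
Proof.
move=> bD; rewrite /= !inE !negb_or => /and4P[/and3P[ii' ij ij'] /andP[i'j i'j'] jj' _].
set f := fun x => _.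
have b1 : bm f by rewrite /f; bmt.
rewrite (expect_resample mu i b1).
have b2 := bm_resample i b1; rewrite (expect_resample mu i' b2).
have b3 := bm_resample i' b2; rewrite (expect_resample mu j b3).
have b4 := bm_resample j b3; rewrite (expect_resample mu j' b4).
rewrite -[RHS](expect_cst (power_measure mu n)); apply: eq_expect => t.
rewrite /box; apply: eq_expect => y'; apply: eq_expect => y.
rewrite /codegree expr2 -expectZl; last by bmt.
apply: eq_expect => x'; rewrite -expectZr; last by bmt.
apply: eq_expect => x; rewrite /f !tnth_tset !eqxx.
have sy (a b : 'I_n) : a != b -> (b == a) = false by move=> /negbTE; rewrite eq_sym.
rewrite (sy _ _ ii') (sy _ _ ij) (sy _ _ ij') (sy _ _ i'j) (sy _ _ i'j') (sy _ _ jj').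
by ring.
Qed.

Lemma expect_distinct2 (h : T -> R) (i j : 'I_n) : bm h -> expect mu h = 0 ->
  i != j -> expect (power_measure mu n) (fun x => h (tnth x i) * h (tnth x j)) = 0.
Proof.
move=> bh h0 ij; set f := fun x => _.
have b1 : bm f by rewrite /f; bmt.
rewrite (expect_resample mu i b1) -[RHS](expect_cst (power_measure mu n)).
apply: eq_expect => t.
transitivity (expect mu (fun u => h u * h (tnth t j))).
  by apply: eq_expect => u; rewrite /f !tnth_tset eqxx eq_sym (negbTE ij).
by rewrite expectZr// h0 mul0r.
Qed.

(** Independent centred variables have no cross terms, which leaves n diagonal terms, each at most
    n^-2. *)
Lemma expect_sqr_mean (h : T -> R) : bm h -> expect mu h = 0 ->
  (forall u, `|h u| <= 1) ->
  expect (power_measure mu n) (fun x => (n%:R^-1 * \sum_i h (tnth x i)) ^+ 2) <=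
  n%:R^-1.
Proof.
move=> bh h0 h1.
have bij i j : bm (fun x : n.-tuple T => h (tnth x i) * h (tnth x j)) by bmt.
have bij' i j : bm (fun x : n.-tuple T => n%:R^-1 ^+ 2 * (h (tnth x i) * h (tnth x j))).
  by bmt.
have -> : expect (power_measure mu n) (fun x => (n%:R^-1 * \sum_i h (tnth x i)) ^+ 2) =
    \sum_i \sum_j n%:R^-1 ^+ 2 *
      expect (power_measure mu n) (fun x => h (tnth x i) * h (tnth x j)).
  transitivity (expect (power_measure mu n) (fun x => \sum_i \sum_j
      n%:R^-1 ^+ 2 * (h (tnth x i) * h (tnth x j)))).
    apply: eq_expect => x; rewrite exprMn expr2 [X in _ * X]expr2.
    rewrite mulr_suml mulr_sumr; apply: eq_bigr => i _.
    by rewrite mulr_sumr mulr_sumr; apply: eq_bigr => j _; ring.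
  rewrite expect_sum => [|i]; last by apply: bm_sum.
  apply: eq_bigr => i _; rewrite expect_sum//.
  by apply: eq_bigr => j _; rewrite expectZl.
apply: (@le_trans _ _ (\sum_(i < n) n%:R^-1 ^+ 2)).
  apply: ler_sum => i _; rewrite (bigD1 i)//= big1 ?addr0 => [|j ji].
    rewrite ler_piMr ?sqr_ge0//; apply: expect_le => // x.
    by apply: le_trans (ler_norm _) _; rewrite normrM mulr_ile1.
  by rewrite expect_distinct2 ?mulr0// eq_sym.
rewrite sumr_const card_ord -(mulr_natl (_ ^+ 2)) expr2.
have [->|n0] := eqVneq n 0%N; first by rewrite mul0r invr0.
by rewrite mulVKf// pnatr_eq0.
Qed.

Definition frequency (L : finType) (z : T -> L) (x : n.-tuple T) (a : L) : R :=
  n%:R^-1 * \sum_i (z (tnth x i) == a)%:R.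

Definition discrepancy (L : finType) (z : T -> L) (x : n.-tuple T) : R :=
  \sum_a (frequency z x a - mass mu z a) ^+ 2.

Lemma frequency_centered (L : finType) (z : T -> L) (x : n.-tuple T) (a : L) : (0 < n)%N ->
  frequency z x a - mass mu z a =
  n%:R^-1 * \sum_i ((z (tnth x i) == a)%:R - mass mu z a).
Proof.
move=> n0; rewrite sumrB sumr_const card_ord -(mulr_natl (mass mu z a)) mulrBr.
by rewrite mulKf// pnatr_eq0 -lt0n.
Qed.

Lemma bm_discrepancy (L : finType) (z : T -> L) : labelling z ->
  bm (discrepancy z).
Proof.
move=> mz; apply: bm_sum => a; apply: bmX; apply: bmD; last exact: bm_cst.
apply: bmM; first exact: bm_cst.
apply: bm_sum => i.
apply: (bm_comp (h := fun x : n.-tuple T => tnth x i)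
  (bm_label (fun b => (b == a)%:R : R) mz)).
measurable_map.
Qed.

Lemma expect_discrepancy (L : finType) (z : T -> L) : (0 < n)%N -> labelling z ->
  expect (power_measure mu n) (discrepancy z) <= #|L|%:R * n%:R^-1.
Proof.
move=> n0 mz.
have bh a : bm (fun u => (z u == a)%:R - mass mu z a).
  by have bz := bm_label (fun b => (b == a)%:R : R) mz; bmt.
have bza a : bm (fun x : n.-tuple T => (frequency z x a - mass mu z a) ^+ 2).
  under [X in bm X]eq_fun do rewrite frequency_centered//.
  have bha := bh a; apply: bmX; apply: bmM; first exact: bm_cst.
  apply: bm_sum => i; apply: (bm_comp (h := fun x : n.-tuple T => tnth x i) bha).
  measurable_map.
rewrite expect_sum//.
apply: (@le_trans _ _ (\sum_(a : L) n%:R^-1)); last by rewrite sumr_const mulr_natl.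
apply: ler_sum => a _.
under eq_expect do rewrite frequency_centered//.
apply: (expect_sqr_mean (bh a)).
  rewrite expectB; [|exact: (bm_label (fun b => (b == a)%:R : R) mz)|exact: bm_cst].
  rewrite expect_cst; apply/eqP; rewrite subr_eq0; apply/eqP.
  by apply: eq_expect => u; rewrite indic_label.
move=> u; have m0 := mass_ge0 mu z a.
have m1 : mass mu z a <= 1.
  by rewrite -(sum_mass mu mz) (bigD1 a)//= lerDl sumr_ge0// => b _; exact: mass_ge0.
by case: (z u == a); rewrite /= ?mulr1n ?mulr0n ler_norml; apply/andP; split; lra.
Qed.

End sampling_box.

Section quadruple_sum.
Context (R : realType) (n : nat).

Lemma sum_ord_cst (c : R) : \sum_(i < n) c = n%:R * c.
Proof. by rewrite sumr_const card_ord mulr_natl. Qed.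

Lemma sum_ord_eql (i : 'I_n) : \sum_(j < n) (i == j)%:R = 1 :> R.
Proof.
rewrite (bigD1 i)//= eqxx big1 ?addr0// => j ji.
by rewrite eq_sym (negbTE ji).
Qed.

(** A quadruple with a repetition satisfies one of six equalities, and each equality holds for n^3
    quadruples. *)
Lemma sum_quadruples (F : 'I_n -> 'I_n -> 'I_n -> 'I_n -> R) (b c : R) :
  0 <= b -> 0 <= c ->
  (forall i i' j j', uniq [:: i; i'; j; j'] -> F i i' j j' <= b) ->
  (forall i i' j j', F i i' j j' <= c) ->
  \sum_i \sum_i' \sum_j \sum_j' F i i' j j' <= n%:R ^+ 4 * b + 6 * n%:R ^+ 3 * c.
Proof.
move=> b0 c0 Fb Fc.
pose E (i j : 'I_n) : R := (i == j)%:R.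
apply: (@le_trans _ _ (\sum_i \sum_i' \sum_j \sum_j'
  (b + c * (E i i' + E i j + E i j' + E i' j + E i' j' + E j j')))).
  apply: ler_sum => i _; apply: ler_sum => i' _; apply: ler_sum => j _.
  apply: ler_sum => j' _.
  have [u|nu] := boolP (uniq [:: i; i'; j; j']).
    by apply: le_trans (Fb _ _ _ _ u) _; rewrite lerDl mulr_ge0// !addr_ge0.
  apply: le_trans (Fc _ _ _ _) _; apply: (@le_trans _ _ (b + c * 1)).
    by rewrite mulr1 lerDr.
  rewrite lerD2l ler_wpM2l//; move: nu; rewrite /= !inE /E.
  by case: (i == i'); case: (i == j); case: (i == j'); case: (i' == j);
    case: (i' == j'); case: (j == j') => //= _; lra.
have s1 (f : 'I_n -> R) : \sum_(i < n) (b + c * f i) = n%:R * b + c * \sum_i f i.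
  by rewrite big_split/= sum_ord_cst mulr_sumr.
have eqE k : \sum_(j < n) E k j = 1 by exact: sum_ord_eql.
have eqS (A : R) (f : 'I_n -> R) : \sum_(j < n) (A + f j) = n%:R * A + \sum_j f j.
  by rewrite big_split/= sum_ord_cst.
have -> : \sum_i \sum_i' \sum_j \sum_j'
    (b + c * (E i i' + E i j + E i j' + E i' j + E i' j' + E j j')) =
    \sum_i \sum_i' \sum_j (n%:R * b + c * 3 + c * n%:R * (E i i') + c * n%:R * (E i j + E i' j)).
  apply: eq_bigr => i _; apply: eq_bigr => i' _; apply: eq_bigr => j _.
  rewrite s1 !big_split/= !sum_ord_cst !eqE; ring.
have -> : \sum_i \sum_i' \sum_j
      (n%:R * b + c * 3 + c * n%:R * (E i i') + c * n%:R * (E i j + E i' j)) =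
    \sum_i \sum_i' (n%:R * (n%:R * b + c * 3) + c * n%:R * 2 + c * n%:R ^+ 2 * E i i').
  apply: eq_bigr => i _; apply: eq_bigr => i' _.
  rewrite big_split/= sum_ord_cst -mulr_sumr big_split/= !eqE; ring.
have -> : \sum_i \sum_i' (n%:R * (n%:R * b + c * 3) + c * n%:R * 2 + c * n%:R ^+ 2 * E i i') =
    \sum_(i < n) (n%:R * (n%:R * (n%:R * b + c * 3) + c * n%:R * 2) + c * n%:R ^+ 2).
  apply: eq_bigr => i _.
  by rewrite big_split/= sum_ord_cst -mulr_sumr eqE mulr1.
by rewrite sum_ord_cst le_eqVlt; apply/orP; left; apply/eqP; ring.
Qed.

End quadruple_sum.

(** * Approximating a kernel by a sampled graph *)

Lemma sqr_sum_le (R : realType) (L : finType) (t : L -> R) :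
  (\sum_a t a) ^+ 2 <= #|L|%:R * \sum_a t a ^+ 2.
Proof.
apply: (@le_trans _ _ (\sum_a \sum_b (2^-1 * t a ^+ 2 + 2^-1 * t b ^+ 2))).
  rewrite expr2 mulr_suml; apply: ler_sum => a _.
  rewrite mulr_sumr; apply: ler_sum => b _.
  rewrite -subr_ge0 (_ : _ - _ = 2^-1 * (t a - t b) ^+ 2); last by field.
  by rewrite mulr_ge0 ?sqr_ge0.
rewrite le_eqVlt; apply/orP; left; apply/eqP; set S := \sum_a t a ^+ 2.
transitivity (\sum_a (#|L|%:R * (2^-1 * t a ^+ 2) + 2^-1 * S)).
  apply: eq_bigr => a _; rewrite big_split/= sumr_const -mulr_sumr.
  by congr (_ + _); rewrite mulr_natl.
rewrite big_split/= sumr_const -mulr_sumr -mulr_sumr -/S -(mulr_natl (_ * S)).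
by field.
Qed.

(* Couples the law m on L with the image of the uniform law under q, moving
   as little mass as possible. *)
Lemma transport_plan (R : realType) (L : finType) (n : nat) (m : L -> R) (q : 'I_n -> L) :
  (0 < n)%N -> (forall a, 0 <= m a) -> \sum_a m a = 1 ->
  let nu a := n%:R^-1 * \sum_i (q i == a)%:R in
  exists w : L -> 'I_n -> R,
    [/\ forall a i, 0 <= w a i, forall a, \sum_i w a i = m a,
        forall i, \sum_a w a i = n%:R^-1 &
        \sum_a \sum_i (a != q i)%:R * w a i <= \sum_a `|nu a - m a|].
Proof.
move=> n0 m0 m1 nu; have nR0 : 0 < n%:R :> R by rewrite ltr0n.
have nI0 : 0 < n%:R^-1 :> R by rewrite invr_gt0.
have nu0 a : 0 <= nu a by rewrite mulr_ge0 ?(ltW nI0)// sumr_ge0.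
(* The mass that can stay in place at each label. *)
pose mn a := Order.min (m a) (nu a).
have mn0 a : 0 <= mn a by rewrite le_min m0 nu0.
have mnm a : mn a <= m a by rewrite ge_min lexx.
have mnnu a : mn a <= nu a by rewrite ge_min lexx orbT.
(* The fraction of each index with label a that is matched to a; below, [r] and [s] are the
   unmatched masses of labels and of indices. *)
pose rho a := mn a / nu a.
have rho_nu a : rho a * nu a = mn a.
  rewrite /rho; have [nua|nua] := eqVneq (nu a) 0; last by rewrite divfK.
  by have := mnnu a; rewrite nua mulr0 => h; apply/eqP; rewrite eq_le mn0 h.
have rho0 a : 0 <= rho a by rewrite divr_ge0.
have rho1 a : rho a <= 1.
  rewrite /rho; have [nua|nua] := eqVneq (nu a) 0; first by rewrite nua invr0 mulr0.
  by rewrite ler_pdivrMr ?mul1r// lt0r nua nu0.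
pose r a := m a - mn a; have r0 a : 0 <= r a by rewrite subr_ge0.
pose s i := n%:R^-1 * (1 - rho (q i)).
have s0 i : 0 <= s i by rewrite mulr_ge0 ?(ltW nI0)// subr_ge0.
pose rr := \sum_a r a; have rr0 : 0 <= rr by rewrite sumr_ge0.
have srr : \sum_i s i = rr.
  rewrite -mulr_sumr sumrB sumr_const card_ord mulrBr -[1 *+ n]/(n%:R) mulVf ?gt_eqF//.
  rewrite /rr sumrB m1; congr (_ - _).
  transitivity (\sum_a n%:R^-1 * \sum_i rho a * (q i == a)%:R).
    rewrite -mulr_sumr; congr (_ * _); rewrite exchange_big/=; apply: eq_bigr => i _.
    rewrite (bigD1 (q i))//= eqxx mulr1 big1 ?addr0// => a aq.
    by rewrite eq_sym (negbTE aq) mulr0.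
  apply: eq_bigr => a _; rewrite -rho_nu -mulr_sumr /nu; ring.
(* If [rr] is 0, then so is every leftover mass, and division by 0 is harmless. *)
have divrr t : 0 <= t -> t <= rr -> t / rr * rr = t.
  move=> t0 trr; have [rr00|rr00] := eqVneq rr 0; last by rewrite divfK.
  by rewrite rr00 mulr0; apply/eqP; rewrite eq_le t0 -rr00 trr.
(* The leftovers have equal total [rr] and are matched independently; only they can contribute to
   the cost. *)
exists (fun a i => n%:R^-1 * (rho a * (q i == a)%:R) + r a / rr * s i); split.
- move=> a i; apply: addr_ge0.
    by apply: mulr_ge0; [exact: ltW|apply: mulr_ge0].
  by apply: mulr_ge0 => //; apply: divr_ge0.
- move=> a; rewrite big_split/= -mulr_sumr -mulr_sumr -mulr_sumr srr.
  rewrite divrr//; last by rewrite /rr (bigD1 a)//= lerDl sumr_ge0.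
  by rewrite /r -rho_nu /nu; ring.
- move=> i; rewrite big_split/= -mulr_sumr -mulr_suml -mulr_suml -/rr.
  rewrite (bigD1 (q i))//= eqxx mulr1 big1 ?addr0 => [|a aq]; last first.
    by rewrite eq_sym (negbTE aq) mulr0.
  have si : s i <= rr by rewrite -srr (bigD1 i)//= lerDl sumr_ge0.
  rewrite (_ : rr / rr * s i = s i / rr * rr); last by ring.
  by rewrite divrr// /s; ring.
- apply: (@le_trans _ _ (\sum_a \sum_i r a / rr * s i)).
    apply: ler_sum => a _; apply: ler_sum => i _.
    have [->|aq] := eqVneq a (q i); first by rewrite mul0r mulr_ge0// divr_ge0.
    by rewrite !mulr0 add0r mul1r.
  under eq_bigr do rewrite -mulr_sumr srr.
  apply: ler_sum => a _; rewrite divrr//; last by rewrite /rr (bigD1 a)//= lerDl sumr_ge0.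
  rewrite /r /mn; case: (leP (m a) (nu a)) => _; first by rewrite subrr.
  by rewrite distrC ler_norm.
Qed.

Lemma box_label d (T : measurableType d) (R : realType) (mu : probability T R)
    (L : finType) (y : T -> L) (H : L -> L -> R) : labelling y ->
  box mu (fun p => H (y p.1) (y p.2)) =
  \sum_j (\sum_j' (\sum_i H i j * H i j' * mass mu y i) ^+ 2 * mass mu y j') * mass mu y j.
Proof.
move=> my; rewrite /box /codegree /=.
rewrite -(expect_label mu (fun j =>
  \sum_j' (\sum_i H i j * H i j' * mass mu y i) ^+ 2 * mass mu y j') my).
apply: eq_expect => v.
rewrite -(expect_label mu (fun j' => (\sum_i H i (y v) * H i j' * mass mu y i) ^+ 2) my).
apply: eq_expect => v'.
by rewrite -(expect_label mu (fun i => H i (y v) * H i (y v')) my).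
Qed.

Lemma mass_marginal d (T : measurableType d) (R : realType) (mu : probability T R)
    (L L' : finType) (z : T -> L) (y : T -> L') (g : L -> L' -> R) :
    labelling z -> labelling y ->
  expect mu (fun x => g (z x) (y x)) =
  \sum_a \sum_i g a i * mass mu (fun x => (z x, y x)) (a, i).
Proof.
move=> mz my; have mzy := labelling_pair mz my.
rewrite pair_big/= (expect_label mu (fun ai => g ai.1 ai.2) mzy).
by apply: eq_bigr => -[].
Qed.

Lemma mass_snd d (T : measurableType d) (R : realType) (mu : probability T R)
    (L L' : finType) (z : T -> L) (y : T -> L') i : labelling z -> labelling y ->
  mass mu y i = \sum_a mass mu (fun x => (z x, y x)) (a, i).
Proof.
move=> mz my.
transitivity (expect mu (fun x => (fun (_ : L) j => (j == i)%:R) (z x) (y x)) : R).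
  by apply: eq_expect => x; rewrite indic_label.
rewrite (mass_marginal mu (fun (_ : L) j => (j == i)%:R) mz my); apply: eq_bigr => a _.
rewrite (bigD1 i)//= eqxx mul1r big1 ?addr0// => j ji.
by rewrite (negbTE ji) mul0r.
Qed.

Section graph_approximation.
Context (R : realType).
Local Notation T := (measurableTypeR R).
Local Notation lam := (lebesgue01 R).
Implicit Types (W : T * T -> R).

Definition uniform_label k (y : T -> 'I_k.+1) : Prop :=
  labelling y /\ forall i, mass lam y i = k.+1%:R^-1.

Definition approximated W k (G : 'I_k.+1 -> 'I_k.+1 -> R) (eps : R) : Prop :=
  exists2 y : T -> 'I_k.+1, uniform_label y &
    cut_le lam (fun p => W p - G (y p.1) (y p.2)) eps.

Lemma graph_boxE lo hi n (U : T * T -> R) (G : {ffun 'I_n * 'I_n -> bool}) x :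
  graph_box lo hi U G x =
  \sum_j \sum_j' (\sum_i residual lo hi U G x i j * residual lo hi U G x i j') ^+ 2.
Proof.
rewrite /graph_box; set N := residual lo hi U G x.
transitivity (\sum_i \sum_j \sum_j' \sum_i' N i j * N i j' * (N i' j * N i' j')).
  apply: eq_bigr => i _; rewrite exchange_big/=; apply: eq_bigr => j _.
  rewrite exchange_big/=; apply: eq_bigr => j' _; apply: eq_bigr => i' _; ring.
rewrite exchange_big/=; apply: eq_bigr => j _.
rewrite exchange_big/=; apply: eq_bigr => j' _.
by rewrite expr2 mulr_suml; apply: eq_bigr => i _; rewrite mulr_sumr.
Qed.

Lemma graph_box_ge0 lo hi n (U : T * T -> R) (G : {ffun 'I_n * 'I_n -> bool}) x :
  0 <= graph_box lo hi U G x.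
Proof.
rewrite graph_boxE; apply: sumr_ge0 => j _; apply: sumr_ge0 => j' _; exact: sqr_ge0.
Qed.

Lemma realize_sample lo hi k (L : finType) (z : T -> L) (M : L -> L -> R) (C e : R)
    (G : {ffun 'I_k.+1 * 'I_k.+1 -> bool}) (x : k.+1.-tuple T) :
  labelling z -> (forall a b, `|M a b| <= C) -> 0 <= e ->
  graph_box lo hi (fun p => M (z p.1) (z p.2)) G x <= k.+1%:R ^+ 4 * e ^+ 4 ->
  #|L|%:R * discrepancy lam z x <= e ^+ 4 ->
  approximated (fun p => M (z p.1) (z p.2)) (graph_kernel lo hi G) (4 * C * e ^+ 2 + e).
Proof.
move=> mz MC e0 boxe disce; pose n : R := k.+1%:R; pose q i := z (tnth x i).
have n0 : 0 < n by rewrite ltr0n.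
have [w [w0 wm wu wd]] := transport_plan q (ltn0Sn k) (mass_ge0 lam z) (sum_mass lam mz).
have [y [my yw]] := lebesgue01_joint_label mz w0 wm.
have mzy := labelling_pair mz my.
have yu i : mass lam y i = n^-1.
  by rewrite (mass_snd lam i mz my); under eq_bigr do rewrite yw; exact: wu.
exists y => //.
pose N : set T := (fun u => (z u, y u)) @^-1` [set ai | ai.1 != q ai.2].
have mN : measurable N by exact: labelling_measurable mzy.
have NE u : \1_N u = (z u != q (y u))%:R :> R.
  rewrite indicE; congr (nat_of_bool _)%:R; apply/idP/idP => [/set_mem//|h].
  exact/mem_set.
(* The transport cost is at most the l1 distance of the frequencies, whose square is at most |L|
   times the discrepancy, hence at most e^4. *)
have Ne : expect lam \1_N <= e ^+ 2.
  have -> : expect lam \1_N = \sum_a \sum_i (a != q i)%:R * w a i.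
    rewrite (@eq_expect _ _ _ lam _ (fun u => (fun a i => (a != q i)%:R) (z u) (y u)))//.
    rewrite (mass_marginal lam (fun a i => (a != q i)%:R) mz my).
    by apply: eq_bigr => a _; apply: eq_bigr => i _; rewrite yw.
  apply: le_trans wd _.
  rewrite -(@ler_pXn2r _ 2) ?nnegrE ?sqr_ge0 ?sumr_ge0//.
  apply: le_trans (sqr_sum_le _) _; rewrite -exprM.
  apply: le_trans disce; rewrite ler_wpM2l// /discrepancy.
  by apply: ler_sum => a _; rewrite real_normK ?num_real.
pose D1 p := M (z p.1) (z p.2) - M (q (y p.1)) (q (y p.2)).
pose D2 p := graph_kernel lo hi G (y p.1) (y p.2) - M (q (y p.1)) (q (y p.2)).
have bMz : bm (fun p => M (z p.1) (z p.2)) by exact: (@bm_label2 _ _ _ _ _ _ _ _ _ M mz mz).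
have bMy : bm (fun p => M (q (y p.1)) (q (y p.2))).
  exact: (@bm_label2 _ _ _ _ _ _ _ _ _ (fun i j => M (q i) (q j)) my my).
have bG : bm (fun p => graph_kernel lo hi G (y p.1) (y p.2)).
  exact: (@bm_label2 _ _ _ _ _ _ _ _ _ (graph_kernel lo hi G) my my).
have bD1 : bm D1 by exact: bmD bMz (bmN bMy).
have bD2 : bm D2 by exact: bmD bG (bmN bMy).
have D1e : cut_le lam D1 (4 * C * e ^+ 2).
  have C0 : 0 <= C by have := MC (z 0) (z 0); exact: le_trans.
  apply: cut_le_L1 => //; apply: (@le_trans _ _ (4 * C * expect lam \1_N)).
    apply: L1norm_mismatch => // u v; rewrite !NE /D1 /=.
    case: eqVneq => [->|_] /=; case: eqVneq => [->|_] /=;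
      rewrite ?mulr1n ?mulr0n ?subrr ?normr0 ?addr0 ?mulr0 ?add0r ?mulr1//.
    - by apply: le_trans (ler_normB _ _) _; have := MC (q (y u)) (z v);
        have := MC (q (y u)) (q (y v)); lra.
    - by apply: le_trans (ler_normB _ _) _; have := MC (z u) (q (y v));
        have := MC (q (y u)) (q (y v)); lra.
    - by apply: le_trans (ler_normB _ _) _; have := MC (z u) (z v);
        have := MC (q (y u)) (q (y v)); lra.
  by rewrite ler_wpM2l// mulr_ge0.
have D2e : cut_le lam D2 e.
  apply: cut_le_box => //.
  rewrite (box_label lam (fun i j => graph_kernel lo hi G i j - M (q i) (q j)) my).
  have -> : \sum_j (\sum_j' (\sum_i (graph_kernel lo hi G i j - M (q i) (q j)) *
        (graph_kernel lo hi G i j' - M (q i) (q j')) * mass lam y i) ^+ 2 *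
        mass lam y j') * mass lam y j =
      n^-1 ^+ 4 * graph_box lo hi (fun p => M (z p.1) (z p.2)) G x.
    rewrite graph_boxE mulr_sumr; apply: eq_bigr => j _.
    rewrite yu mulr_suml mulr_sumr; apply: eq_bigr => j' _; rewrite yu.
    under eq_bigr do rewrite yu.
    by rewrite -mulr_suml /residual /=; set S := \sum_i _; ring.
  rewrite exprVn -ler_pdivlMl ?invr_gt0 ?exprn_gt0// invrK //.
have := cut_leB bD1 bD2 D1e D2e.
by apply: eq_cut_le => p; rewrite /D1 /D2; ring.
Qed.

End graph_approximation.

(** * Concentration of the sampled graph *)

Section sampling.
Context (R : realType).
Local Notation T := (measurableTypeR R).
Local Notation lam := (lebesgue01 R).
Implicit Types (W : T * T -> R).

Definition kernel_in (lo hi : R) W : Prop :=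
  [/\ bm W, forall p, lo <= W p <= hi & forall x y, W (x, y) = W (y, x)].

Definition sample_weight lo hi W k (G : {ffun 'I_k.+1 * 'I_k.+1 -> bool}) : R :=
  expect (power_measure lam k.+1) (fun x => graph_weight lo hi W x G).

Lemma sample_weight_ge0 lo hi W k (G : {ffun 'I_k.+1 * 'I_k.+1 -> bool}) :
  lo < hi -> kernel_in lo hi W -> 0 <= sample_weight lo hi W G.
Proof. by move=> lh [_ Wlh _]; apply: ge0_expect => x; exact: graph_weight_ge0. Qed.

Lemma sum_sample_weight lo hi W k : lo < hi -> kernel_in lo hi W ->
  \sum_(G : {ffun 'I_k.+1 * 'I_k.+1 -> bool}) sample_weight lo hi W G = 1.
Proof.
move=> lh [bW Wlh _]; rewrite /sample_weight -expect_sum => [|G]; last exact: bm_graph_weight.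
by rewrite -[RHS](expect_cst (power_measure lam k.+1)); apply: eq_expect => x;
  exact: sum_graph_weight.
Qed.

(** Quadruples of distinct indices contribute the box norm of [W - U] each; for the others the
    residuals are merely bounded by 2C. *)
Lemma expect_graph_box lo hi W U k (C : R) : lo < hi -> kernel_in lo hi W ->
  bm U -> (forall x y, U (x, y) = U (y, x)) -> `|lo| <= C -> `|hi| <= C ->
  (forall p, `|U p| <= C) ->
  expect (power_measure lam k.+1) (fun x =>
    \sum_(G : {ffun 'I_k.+1 * 'I_k.+1 -> bool}) graph_weight lo hi W x G * graph_box lo hi U G x) <=
  k.+1%:R ^+ 4 * box lam (fun p => W p - U p) + 6 * k.+1%:R ^+ 3 * (2 * C) ^+ 4.
Proof.
move=> lh [bW Wlh Ws] bU Us loC hiC UC.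
have C0 : 0 <= C by exact: le_trans loC.
pose N (G : {ffun 'I_k.+1 * 'I_k.+1 -> bool}) x i j := residual lo hi U G x i j.
have bN G i j : bm (fun x => N G x i j) by exact: bm_residual.
have NC G x i j : `|N G x i j| <= 2 * C.
  rewrite /N /residual; apply: le_trans (ler_normB _ _) _.
  rewrite mulr_natl mulr2n lerD//.
  by rewrite /graph_kernel /value; do !case: ifP.
pose Fx (x : k.+1.-tuple T) i i' j j' :=
  \sum_(G : {ffun 'I_k.+1 * 'I_k.+1 -> bool}) graph_weight lo hi W x G *
    (N G x i j * N G x i' j * (N G x i j' * N G x i' j')).
have bF i i' j j' : bm (fun x => Fx x i i' j j').
  apply: bm_sum => G; apply: bmM; first exact: bm_graph_weight.
  by apply: bmM; apply: bmM.
have -> : expect (power_measure lam k.+1) (fun x =>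
    \sum_(G : {ffun 'I_k.+1 * 'I_k.+1 -> bool}) graph_weight lo hi W x G * graph_box lo hi U G x) =
    \sum_i \sum_i' \sum_j \sum_j' expect (power_measure lam k.+1) (fun x => Fx x i i' j j').
  transitivity (expect (power_measure lam k.+1) (fun x =>
      \sum_i \sum_i' \sum_j \sum_j' Fx x i i' j j')).
    apply: eq_expect => x; rewrite /graph_box.
    under eq_bigr do rewrite mulr_sumr.
    rewrite exchange_big/=; apply: eq_bigr => i _.
    under eq_bigr do rewrite mulr_sumr.
    rewrite exchange_big/=; apply: eq_bigr => i' _.
    under eq_bigr do rewrite mulr_sumr.
    rewrite exchange_big/=; apply: eq_bigr => j _.
    under eq_bigr do rewrite mulr_sumr.
    by rewrite exchange_big.
  rewrite expect_sum => [|i]; last by do 3!apply: bm_sum => ?.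
  apply: eq_bigr => i _; rewrite expect_sum => [|i']; last by do 2!apply: bm_sum => ?.
  apply: eq_bigr => i' _; rewrite expect_sum => [|j]; last by apply: bm_sum => ?.
  by apply: eq_bigr => j _; rewrite expect_sum.
have bD : bm (fun p => W p - U p) by exact: bmD bW (bmN bU).
apply: sum_quadruples; first exact: box_ge0.
- by rewrite exprn_ge0// mulr_ge0.
- move=> i i' j j' u; rewrite -(expect_box lam bD u).
  rewrite le_eqVlt; apply/orP; left; apply/eqP; apply: eq_expect => x.
  exact: (mean_residual_prod lh x Ws Us u).
- move=> i i' j j'; apply: expect_le => // x.
  apply: (@le_trans _ _ ((\sum_(G : {ffun 'I_k.+1 * 'I_k.+1 -> bool})
      graph_weight lo hi W x G) * (2 * C) ^+ 4)); last first.
    by rewrite (sum_graph_weight lh W x) mul1r.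
  rewrite mulr_suml; apply: ler_sum => G _; apply: ler_wpM2l; first exact: graph_weight_ge0.
  apply: le_trans (ler_norm _) _; rewrite !normrM.
  have -> : (2 * C) ^+ 4 = (2 * C) * (2 * C) * ((2 * C) * (2 * C)) by ring.
  by apply: ler_pM; rewrite ?mulr_ge0//; apply: ler_pM.
Qed.

(** Markov's inequality for [Q], the sum of the two quantities that [realize_sample] wants small:
    its mean is at most eta/4, and a graph fails only if it exceeds eta. *)
Lemma sampling_lemma (lo hi eps : R) : lo < hi -> 0 < eps ->
  exists k, forall W, kernel_in lo hi W ->
  \sum_(G : {ffun 'I_k.+1 * 'I_k.+1 -> bool} |
      ~~ `[< approximated W (graph_kernel lo hi G) eps >]) sample_weight lo hi W G <= 4^-1.
Proof.
move=> lh eps0.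
pose C : R := `|lo| + `|hi| + 1.
have C0 : 0 < C by rewrite ltr_wpDl// addr_ge0.
have loC : `|lo| <= C by rewrite /C; have := normr_ge0 hi; lra.
have hiC : `|hi| <= C by rewrite /C; have := normr_ge0 lo; lra.
(* As e <= 1, the error 4 C e^2 + e of [realize_sample] is at most (4 C + 1) e, hence at most
   eps/2. *)
pose e := Order.min 1 (eps / (2 * (4 * C + 1))).
have C41 : 0 < 2 * (4 * C + 1) by rewrite mulr_gt0// ltr_wpDl// mulr_ge0// ltW.
have e0 : 0 < e by rewrite lt_min ltr01 divr_gt0.
have e1 : e <= 1 by rewrite ge_min lexx.
have ee : 4 * C * e ^+ 2 + e <= eps / 2.
  have : e <= eps / (2 * (4 * C + 1)) by rewrite ge_min lexx orbT.
  rewrite ler_pdivlMr// => h; apply: (@le_trans _ _ (4 * C * e + e)).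
    by rewrite lerD2r ler_wpM2l ?mulr_ge0 ?(ltW C0)// expr2 ler_piMl// ltW.
  lra.
pose eta := e ^+ 4; have eta0 : 0 < eta by rewrite exprn_gt0.
(* Regularity may use the other eps/2; the second bound makes the box norm of [W - U] at most
   eta/8. *)
pose er := Order.min (eps / 2) (eta / (8 * (4 * (2 * C) ^+ 3))).
have C3 : 0 < 8 * (4 * (2 * C) ^+ 3) by rewrite !mulr_gt0// exprn_gt0// mulr_gt0.
have er0 : 0 < er by rewrite lt_min !divr_gt0.
have [L reg] := weak_regularity lam C er0.
(* [A / n] collects the quadruples with repetitions and |L| times the bound |L|/n on the mean
   discrepancy; [k] makes it at most eta/8. *)
pose A : R := 6 * (2 * C) ^+ 4 + #|L|%:R ^+ 2.
have A0 : 0 <= A by rewrite addr_ge0 ?sqr_ge0// mulr_ge0// exprn_ge0// mulr_ge0// ltW.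
pose k := Num.trunc (8 * A / eta); exists k => W Wk.
pose n : R := k.+1%:R; have n0 : 0 < n by rewrite ltr0n.
have nA : A / n <= eta / 8.
  rewrite ler_pdivrMr// mulrAC ler_pdivlMr// [A * 8]mulrC [eta * n]mulrC -ler_pdivrMr//.
  by apply: ltW; exact: truncnS_gt.
have [bW Wlh Ws] := Wk.
have WC p : `|W p| <= C.
  have /andP[l h] := Wlh p; rewrite ler_norml; apply/andP; split.
    rewrite /C; have := normr_ge0 hi; have := ler_norm (- lo); rewrite normrN; lra.
  by rewrite /C; have := normr_ge0 lo; have := ler_norm hi; lra.
have [z [M [mz Ms MC cut]]] := reg W bW WC Ws.
pose U p := M (z p.1) (z p.2).
have bU : bm U by exact: (@bm_label2 _ _ _ _ _ _ _ _ _ M mz mz).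
have bD : bm (fun p => W p - U p) by exact: bmD bW (bmN bU).
have boxD : box lam (fun p => W p - U p) <= eta / 8.
  apply: (@le_trans _ _ (4 * (2 * C) ^+ 3 * er)).
    apply: box_le_cut => //; first by rewrite mulr_gt0.
    move=> p; apply: le_trans (ler_normB _ _) _.
    by rewrite mulr_natl mulr2n; apply: lerD; [exact: WC|exact: MC].
  have : er <= eta / (8 * (4 * (2 * C) ^+ 3)) by rewrite ge_min lexx orbT.
  by rewrite ler_pdivlMr// ler_pdivlMr//; lra.
pose Q (G : {ffun 'I_k.+1 * 'I_k.+1 -> bool}) x :=
  n^-1 ^+ 4 * graph_box lo hi U G x + #|L|%:R * discrepancy lam z x.
have gbox0 (G : {ffun 'I_k.+1 * 'I_k.+1 -> bool}) x : 0 <= n^-1 ^+ 4 * graph_box lo hi U G x.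
  by rewrite mulr_ge0 ?graph_box_ge0// exprn_ge0// invr_ge0 ltW.
have disc0 x : 0 <= #|L|%:R * discrepancy lam z x.
  by rewrite mulr_ge0// sumr_ge0// => a _; exact: sqr_ge0.
have Qgood G x : Q G x <= eta -> approximated W (graph_kernel lo hi G) eps.
  move=> Qe.
  have [||y yu ycut] := @realize_sample R lo hi k L z M C e G x mz MC (ltW e0).
  - rewrite -ler_pdivrMl ?exprn_gt0// -exprVn.
    by apply: le_trans Qe; rewrite /Q lerDl.
  - by apply: le_trans Qe; rewrite /Q lerDr.
  exists y => //.
  have bG : bm (fun p => graph_kernel lo hi G (y p.1) (y p.2)).
    by case: yu => my _; exact: (@bm_label2 _ _ _ _ _ _ _ _ _ (graph_kernel lo hi G) my my).
  have := cut_leD bD (bmD bU (bmN bG)) cut ycut.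
  move=> /(cut_le_trans (c' := eps)) H; apply: eq_cut_le (H _).
    by move=> p; rewrite /U; ring.
  have : er <= eps / 2 by rewrite ge_min lexx.
  by move: ee; lra.
have bgb (G : {ffun 'I_k.+1 * 'I_k.+1 -> bool}) : bm (fun x => graph_box lo hi U G x).
  do 4!(apply: bm_sum => ?).
  by apply: bmM; apply: bmM; exact: bm_residual.
have bgw (G : {ffun 'I_k.+1 * 'I_k.+1 -> bool}) : bm (fun x => graph_weight lo hi W x G).
  exact: bm_graph_weight.
have bd : bm (discrepancy lam z : k.+1.-tuple T -> R) by exact: bm_discrepancy.
have bQ G : bm (Q G).
  apply: bmD; first by apply: bmM; [exact: bm_cst|exact: bgb].
  by apply: bmM; [exact: bm_cst|exact: bd].
rewrite /sample_weight -expect_sum//.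
apply: (@le_trans _ _ (expect (power_measure lam k.+1) (fun x =>
    eta^-1 * \sum_G graph_weight lo hi W x G * Q G x))).
  apply: ler_expect.
  - exact: bm_sum.
  - apply: bmM; first exact: bm_cst.
    by apply: bm_sum => G; apply: bmM.
  move=> x; rewrite big_mkcond mulr_sumr; apply: ler_sum => G _.
  have gw0 : 0 <= graph_weight lo hi W x G by exact: graph_weight_ge0.
  have Q0 : 0 <= Q G x by rewrite addr_ge0.
  case: ifPn => [/asboolPn bad|_]; last by rewrite mulr_ge0 ?invr_ge0 ?(ltW eta0)// mulr_ge0.
  rewrite mulrCA ler_peMr// ler_pdivlMl// mulr1 leNgt; apply/negP => /ltW.
  by move/Qgood.
rewrite expectZl; last by apply: bm_sum => G; apply: bmM.
rewrite ler_pdivrMl//.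
have -> : expect (power_measure lam k.+1) (fun x => \sum_G graph_weight lo hi W x G * Q G x) =
  n^-1 ^+ 4 * expect (power_measure lam k.+1) (fun x =>
    \sum_G graph_weight lo hi W x G * graph_box lo hi U G x) +
  #|L|%:R * expect (power_measure lam k.+1) (discrepancy lam z).
  rewrite -expectZl; last exact: bd.
  rewrite -expectZl; last first.
    by apply: bm_sum => G; apply: bmM; [exact: bgw|exact: bgb].
  rewrite -expectD; last 2 first.
  - apply: bmM; first exact: bm_cst.
    by apply: bm_sum => G; apply: bmM; [exact: bgw|exact: bgb].
  - by apply: bmM => //; exact: bm_cst.
  apply: eq_expect => x; transitivity (n^-1 ^+ 4 *
      (\sum_G graph_weight lo hi W x G * graph_box lo hi U G x) +
      (\sum_G graph_weight lo hi W x G) * (#|L|%:R * discrepancy lam z x)); last first.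
    by rewrite (sum_graph_weight lh W x) mul1r.
  rewrite mulr_sumr mulr_suml -big_split/=; apply: eq_bigr => G _.
  by rewrite /Q; ring.
have Us x y : U (x, y) = U (y, x) by exact: Ms.
have h1 := @expect_graph_box lo hi W U k C lh Wk bU Us loC hiC (fun p => MC _ _).
have h2 := expect_discrepancy lam (ltn0Sn k) mz.
have n4 : 0 < n^-1 ^+ 4 by rewrite exprn_gt0// invr_gt0.
move: h1; rewrite -(ler_pM2l n4) -/n => h1.
have {}h2 : #|L|%:R * expect (power_measure lam k.+1) (discrepancy lam z) <=
    #|L|%:R * (#|L|%:R / n) by rewrite ler_wpM2l.
have e3 : n^-1 ^+ 4 * (n ^+ 4 * box lam (fun p => W p - U p) + 6 * n ^+ 3 * (2 * C) ^+ 4) +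
   #|L|%:R * (#|L|%:R / n) = box lam (fun p => W p - U p) + A / n.
  by rewrite /A; field; rewrite gt_eqF.
have := lerD h1 h2; rewrite e3 => /le_trans; apply.
by apply: le_trans (lerD boxD nA) _; move: (eta) => E; lra.
Qed.

End sampling.

(** * The inverse counting lemma *)

Section inverse_counting.
Context (R : realType).
Local Notation T := (measurableTypeR R).
Local Notation lam := (lebesgue01 R).
Implicit Types (W U : T * T -> R).
Local Notation graph k := {ffun 'I_k.+1 * 'I_k.+1 -> bool}.

Definition forward_edges n (H : {ffun 'I_n * 'I_n -> bool}) : seq ('I_n * 'I_n) :=
  [seq e : 'I_n * 'I_n <- index_enum _ | (e.1 < e.2)%N && H e].

Definition density n (W : T * T -> R) (s : seq ('I_n * 'I_n)) : R :=
  expect (power_measure lam n) (edge_product (fun=> W) s).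

(** The weight of a bit is affine in [W]. Expanding the product, [H] selects the pairs that
    contribute their linear part; pairs that are not increasing have linear part 0. The coefficients
    do not involve [W]. *)
Lemma sample_weight_density lo hi k (G : {ffun 'I_k.+1 * 'I_k.+1 -> bool}) : lo < hi ->
  exists c : {ffun 'I_k.+1 * 'I_k.+1 -> bool} -> R, forall W, bm W ->
    sample_weight lo hi W G = \sum_H c H * density W (forward_edges H).
Proof.
move=> lh.
pose al (e : 'I_k.+1 * 'I_k.+1) (s : bool) : R :=
  if (e.1 < e.2)%N then (if s then 1 else -1) / (hi - lo) else 0.
pose be (e : 'I_k.+1 * 'I_k.+1) (s : bool) : R :=
  if (e.1 < e.2)%N then (if s then - lo else hi) / (hi - lo) else (~~ s)%:R.
pose c (H : {ffun 'I_k.+1 * 'I_k.+1 -> bool}) : R :=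
  \prod_e (if H e then al e (G e) else be e (G e)).
exists c => W bW.
have bep (H : {ffun 'I_k.+1 * 'I_k.+1 -> bool}) :
    bm (edge_product (fun=> W) (forward_edges H)).
  exact: bm_edge_product.
rewrite /sample_weight /density.
transitivity (expect (power_measure lam k.+1) (fun x => \sum_H c H *
    edge_product (fun=> W) (forward_edges H) x)); last first.
  rewrite expect_sum => [|H]; last by apply: bmM; [exact: bm_cst|exact: bep].
  by apply: eq_bigr => H _; rewrite expectZl.
apply: eq_expect => x; rewrite /graph_weight.
pose V (e : 'I_k.+1 * 'I_k.+1) := if (e.1 < e.2)%N then W (tnth x e.1, tnth x e.2) else 1.
transitivity (\prod_e \sum_b (if b then al e (G e) * V e else be e (G e))).
  apply: eq_bigr => e _; rewrite big_bool/= /edge_weight /coin /al /be /V.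
  case: ifP => _; last by rewrite mul0r add0r.
  by case: (G e); field; rewrite subr_eq0 gt_eqF.
rewrite (bigA_distr_bigA (fun e (b : bool) => if b then al e (G e) * V e else be e (G e))).
apply: eq_bigr => H _; rewrite /edge_product big_filter.
rewrite [X in _ = _ * X]big_mkcond/= /c -big_split/=.
apply: eq_bigr => e _; rewrite /al /be /V.
by case: (H e); case: ((e.1 < e.2)%N) => //=; rewrite ?mulr1 ?mul0r.
Qed.

(** Otherwise every graph good for [U] is bad for [W], so the total mass 1 is at most 1/4 (bad for
    [U]) plus 1/4 (bad for [W]) plus 1/4 (distance of the two laws). *)
Lemma inverse_counting_lemma (lo hi eps : R) : lo < hi -> 0 < eps ->
  exists k, exists2 eta : R, 0 < eta & forall U W, kernel_in lo hi U -> kernel_in lo hi W ->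
  (forall H : graph k,
    `|density U (forward_edges H) - density W (forward_edges H)| <= eta) ->
  exists G : graph k,
    approximated U (graph_kernel lo hi G) eps /\
    approximated W (graph_kernel lo hi G) eps.
Proof.
move=> lh eps0; have [k samp] := sampling_lemma lh eps0; exists k.
have /choice[c cE] := fun G => @sample_weight_density lo hi k G lh.
pose K : R := \sum_(G : graph k) \sum_(H : graph k) `|c G H|.
have K0 : 0 <= K by apply: sumr_ge0 => G _; apply: sumr_ge0 => H _.
have K1 : 0 < 4 * (K + 1) by rewrite mulr_gt0// ltr_wpDl.
exists (4 * (K + 1))^-1; first by rewrite invr_gt0.
move=> U W Uk Wk UW; apply: contrapT => none.
have [bU _ _] := Uk; have [bW _ _] := Wk.
have dist : \sum_(G : graph k) `|sample_weight lo hi U G - sample_weight lo hi W G| <= 4^-1.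
  apply: (@le_trans _ _ (\sum_(G : graph k) \sum_(H : graph k) `|c G H| * (4 * (K + 1))^-1)).
    apply: ler_sum => G _; rewrite !cE// -sumrB.
    apply: le_trans (ler_norm_sum _ _ _) _; apply: ler_sum => H _.
    by rewrite -mulrBr normrM ler_wpM2l.
  under eq_bigr do rewrite -mulr_suml.
  by rewrite -mulr_suml -/K ler_pdivrMr//; lra.
pose bad V (G : graph k) := ~~ `[< approximated V (graph_kernel lo hi G) eps >].
have sub (G : graph k) : ~~ bad U G -> bad W G.
  rewrite /bad negbK => /asboolP gU; apply/asboolPn => gW.
  by apply: none; exists G.
have tot := sum_sample_weight k lh Uk; rewrite (bigID (bad U))/= in tot.
have h1 := samp U Uk; have h2 := samp W Wk.
have h3 : \sum_(G : graph k | ~~ bad U G) sample_weight lo hi U G <=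
    \sum_(G : graph k | bad W G) sample_weight lo hi W G +
    \sum_(G : graph k) `|sample_weight lo hi U G - sample_weight lo hi W G|.
  apply: (@le_trans _ _ (\sum_(G : graph k | bad W G) sample_weight lo hi U G)).
    rewrite big_mkcond [leRHS]big_mkcond/=; apply: ler_sum => G _.
    have := sub G; case: (bad U G) => /= [_|->//].
    by case: ifP => // _; exact: sample_weight_ge0.
  rewrite big_mkcond [X in _ <= X + _]big_mkcond/= -big_split/=.
  apply: ler_sum => G _; case: ifP => _; last by rewrite add0r.
  by rewrite -lerBlDl ler_norm.
move: tot h1 h2 h3 dist; rewrite -/(bad U) -/(bad W).
set a1 := \sum_(G : graph k | bad U G) _; set a2 := \sum_(G : graph k | ~~ bad U G) _.
set a3 := \sum_(G : graph k | bad W G) _; set a4 := \sum_(G : graph k) _; lra.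
Qed.

End inverse_counting.

(** * Couplings *)

Section label_coupling.
Context (R : realType) (k : nat).
Local Notation T := (measurableTypeR R).
Local Notation lam := (lebesgue01 R).
Variables (y y' : T -> 'I_k.+1).
Hypotheses (uy : uniform_label y) (uy' : uniform_label y').

Definition label_match : set (T * T) := [set p | y p.1 = y' p.2].

Let my : labelling y. Proof. by case: uy. Qed.
Let my' : labelling y'. Proof. by case: uy'. Qed.

Lemma measurable_label_match : measurable label_match.
Proof.
rewrite (_ : label_match = \bigcup_(i in setT) ((y @^-1` [set i]) `*` (y' @^-1` [set i]))).
  by apply: fin_bigcup_measurable => // i _; apply: measurableX; [exact: my|exact: my'].
apply/seteqP; split => [p e|p [i _ [/= e1 e2]]].
  by exists (y p.1) => //; split.
by rewrite /label_match /= e1 e2.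
Qed.

(* Given the common label, the two coordinates are independent. *)
Definition label_coupling : set (T * T) -> \bar R :=
  mscale (k.+1%:R%:nng) (mrestr (lam \x lam)%E measurable_label_match).

HB.instance Definition _ := Measure.on label_coupling.

Lemma label_couplingX A B : measurable A -> measurable B ->
  label_coupling (A `*` B) =
  (k.+1%:R * \sum_i pr lam (A `&` y @^-1` [set i]) * pr lam (B `&` y' @^-1` [set i]))%:E.
Proof.
move=> mA mB; rewrite /label_coupling /mscale /mrestr /=.
rewrite EFinM; congr (_ * _)%E.
have mAB i : measurable ((A `&` y @^-1` [set i]) `*` (B `&` y' @^-1` [set i])).
  by apply: measurableX; apply: measurableI => //.
have E : (A `*` B) `&` label_match = \big[setU/set0]_(i < k.+1)
    ((A `&` y @^-1` [set i]) `*` (B `&` y' @^-1` [set i])).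
  rewrite -bigcup_seq; apply/seteqP; split => [p [[Ap Bp] e]|p [i _ [[/= ? <-] [/= ? e]]]].
    by exists (y p.1); [rewrite /= mem_index_enum|split; split].
  by split.
rewrite -[LHS]/((lam \x lam)%E ((A `*` B) `&` label_match)) E.
rewrite measure_bigsetU_ord//; last first.
  apply/trivIsetP => i j _ _ ij; apply/seteqP; split => // p [[[/= _ e1] _] [[/= _ e2] _]].
  by case/eqP: ij; rewrite -e1 -e2.
rewrite -sumEFin; apply: eq_bigr => i _.
have mAi : measurable (A `&` y @^-1` [set i]) by exact: measurableI.
have mBi : measurable (B `&` y' @^-1` [set i]) by exact: measurableI.
by rewrite EFinM !prE//; exact: product_measure1E.
Qed.

Lemma label_coupling_fst A : measurable A -> label_coupling (fst @^-1` A) = lam A.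
Proof.
move=> mA; rewrite (_ : fst @^-1` A = A `*` setT); last first.
  by apply/seteqP; split => [p ? //|p []].
rewrite label_couplingX// -prE//; congr (_%:E).
rewrite mulr_sumr; under eq_bigr => i _.
  (* The class of [y'] has mass 1/(k+1), which cancels the scaling factor. *)
  rewrite setTI -(mass_pr lam i my') (proj2 uy' i) mulrCA divff ?pnatr_eq0// mulr1.
over.
transitivity (expect lam (fun x => \1_A x * \sum_i \1_(y @^-1` [set i]) x)).
  under [RHS]eq_expect do rewrite mulr_sumr.
  rewrite expect_sum => [|i]; last first.
    by apply: bmM; apply: bm_indic => //; exact: my.
  apply: eq_bigr => i _; rewrite pr_expect; last by apply: measurableI => //; exact: my.
  by apply: eq_expect => x; rewrite indicI.
rewrite pr_expect//; apply: eq_expect => x.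
have := label_sum y (fun=> 1 : R) x; under eq_bigr do rewrite mul1r.
by move=> <-; rewrite mulr1.
Qed.

Lemma label_coupling_snd A : measurable A -> label_coupling (snd @^-1` A) = lam A.
Proof.
move=> mA; rewrite (_ : snd @^-1` A = setT `*` A); last first.
  by apply/seteqP; split => [p ? //|p []].
rewrite label_couplingX// -prE//; congr (_%:E).
rewrite mulr_sumr; under eq_bigr => i _.
  rewrite setTI -(mass_pr lam i my) (proj2 uy i) mulrA divff ?pnatr_eq0// mul1r.
over.
transitivity (expect lam (fun x => \1_A x * \sum_i \1_(y' @^-1` [set i]) x)).
  under [RHS]eq_expect do rewrite mulr_sumr.
  rewrite expect_sum => [|i]; last first.
    by apply: bmM; apply: bm_indic => //; exact: my'.
  apply: eq_bigr => i _; rewrite pr_expect; last by apply: measurableI => //; exact: my'.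
  by apply: eq_expect => x; rewrite indicI.
rewrite pr_expect//; apply: eq_expect => x.
have := label_sum y' (fun=> 1 : R) x; under eq_bigr do rewrite mul1r.
by move=> <-; rewrite mulr1.
Qed.

Let label_coupling_setT : label_coupling setT = 1%E.
Proof.
rewrite (_ : setT = fst @^-1` (setT : set T)); last by rewrite preimage_setT.
by rewrite label_coupling_fst// probability_setT.
Qed.

HB.instance Definition _ :=
  Measure_isProbability.Build _ _ _ label_coupling label_coupling_setT.

Lemma label_coupling_coupling : coupling label_coupling.
Proof.
by move=> A mA; split; [exact: label_coupling_fst|exact: label_coupling_snd].
Qed.

Lemma expect_label_mismatch : expect label_coupling \1_(~` label_match) = 0.
Proof.
have mE := measurable_label_match.
rewrite expect_indic; last exact: measurableC.
rewrite [X in fine X](_ : _ = 0%E)//=.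
rewrite -[LHS]/(k.+1%:R%:E * (lam \x lam)%E (~` label_match `&` label_match))%E.
by rewrite setICl measure0 mule0.
Qed.

End label_coupling.

Lemma coupling_preserving (R : realType)
    (mu : probability (measurableTypeR R * measurableTypeR R)%type R) :
  coupling mu -> measure_preserving mu (lebesgue01 R) fst /\
                 measure_preserving mu (lebesgue01 R) snd.
Proof.
move=> cm; split; split.
- exact: measurable_fst.
- by move=> A mA; case: (cm A mA).
- exact: measurable_snd.
- by move=> A mA; case: (cm A mA).
Qed.

Section approximated_close.
Context (R : realType).
Local Notation T := (measurableTypeR R).
Local Notation lam := (lebesgue01 R).
Implicit Types (W : T * T -> R).

(* Cut norms are compared across the coupling by way of the box norm, which
   is invariant under measure-preserving maps. *)
Lemma cut_le_pullback (mu : probability (T * T)%type R) (h : T * T -> T)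
    (D : T * T -> R) b c e :
  measure_preserving mu lam h -> bm D -> 0 < b -> (forall p, `|D p| <= b) ->
  0 <= e -> 4 * b ^+ 3 * c <= e ^+ 4 -> cut_le lam D c ->
  cut_le mu (fun q => D (h q.1, h q.2)) e.
Proof.
move=> hmu bD b0 Db e0 bce Dc; have [mh _] := hmu.
apply: cut_le_box => //.
  apply: (bm_comp (h := fun q => (h q.1, h q.2)) bD).
  by apply: measurable_fun_pair; apply: (measurable_fun_comp1 mh); measurable_map.
by rewrite (box_comp hmu bD); apply: le_trans bce; exact: box_le_cut.
Qed.

(** On the coupling, go from [W] to the graph labelled by [y], then to the graph labelled by [y'],
    then to [W']. The middle step is free because the labels agree almost surely; the outer two cost
    [e] each. *)
Lemma approximated_close W W' k (G : 'I_k.+1 -> 'I_k.+1 -> R) C eps e :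
  bm W -> bm W' -> 0 < C -> (forall p, `|W p| <= C) -> (forall p, `|W' p| <= C) ->
  (forall i j, `|G i j| <= C) -> 0 <= e -> 4 * (2 * C) ^+ 3 * eps <= e ^+ 4 ->
  approximated W G eps -> approximated W' G eps ->
  exists2 mu : probability (T * T)%type R, coupling mu &
    cut_le mu (fun q => W (q.1.1, q.2.1) - W' (q.1.2, q.2.2)) (2 * e).
Proof.
move=> bW bW' C0 WC W'C GC e0 Cee [y uy cy] [y' uy' cy'].
have my : labelling y by case: uy.
have my' : labelling y' by case: uy'.
have bGy : bm (fun p => G (y p.1) (y p.2)) by exact: (@bm_label2 _ _ _ _ _ _ _ _ _ G my my).
have bGy' : bm (fun p => G (y' p.1) (y' p.2)) by exact: (@bm_label2 _ _ _ _ _ _ _ _ _ G my' my').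
exists (label_coupling uy uy'); first exact: label_coupling_coupling.
set mu : probability _ _ := label_coupling uy uy'.
have [mp1 mp2] : measure_preserving mu lam fst /\ measure_preserving mu lam snd.
  by apply: coupling_preserving; exact: label_coupling_coupling.
pose D1 p := W p - G (y p.1) (y p.2).
pose D2 p := W' p - G (y' p.1) (y' p.2).
have bD1 : bm D1 by exact: bmD bW (bmN bGy).
have bD2 : bm D2 by exact: bmD bW' (bmN bGy').
have D1C p : `|D1 p| <= 2 * C.
  by apply: le_trans (ler_normB _ _) _; rewrite mulr_natl mulr2n lerD.
have D2C p : `|D2 p| <= 2 * C.
  by apply: le_trans (ler_normB _ _) _; rewrite mulr_natl mulr2n lerD.
have C2 : 0 < 2 * C by rewrite mulr_gt0.
have c1 := cut_le_pullback mp1 bD1 C2 D1C e0 Cee cy.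
have c2 := cut_le_pullback mp2 bD2 C2 D2C e0 Cee cy'.
pose D0 (q : (T * T) * (T * T)) := G (y q.1.1) (y q.2.1) - G (y' q.1.2) (y' q.2.2).
have bG1 : bm (fun q : (T * T) * (T * T) => G (y q.1.1) (y q.2.1)).
  by apply: (bm_comp (h := fun q : (T * T) * (T * T) => (q.1.1, q.2.1)) bGy); measurable_map.
have bG2 : bm (fun q : (T * T) * (T * T) => G (y' q.1.2) (y' q.2.2)).
  by apply: (bm_comp (h := fun q : (T * T) * (T * T) => (q.1.2, q.2.2)) bGy'); measurable_map.
have bD0 : bm D0 by exact: bmD bG1 (bmN bG2).
have c0 : cut_le mu D0 0.
  apply: cut_le_L1 => //.
  have mE : measurable (~` label_match y y').
    by apply: measurableC; exact: (measurable_label_match uy uy').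
  apply: (@le_trans _ _ (4 * C * expect mu \1_(~` label_match y y'))).
    apply: L1norm_mismatch => // p q; rewrite /D0 /=.
    have iE (r : T * T) : \1_(~` label_match y y') r = (y r.1 != y' r.2)%:R :> R.
      rewrite indicE; congr (nat_of_bool _)%:R; apply/idP/idP.
        by move=> /set_mem /= h; apply/eqP.
      by move=> /eqP h; exact/mem_set.
    rewrite !iE.
    case: eqVneq => [->|_] /=; case: eqVneq => [->|_] /=;
      rewrite ?mulr1n ?mulr0n ?subrr ?normr0 ?addr0 ?mulr0 ?add0r ?mulr1//;
      apply: le_trans (ler_normB _ _) _.
    - by have := GC (y' p.2) (y q.1); have := GC (y' p.2) (y' q.2); lra.
    - by have := GC (y p.1) (y' q.2); have := GC (y' p.2) (y' q.2); lra.
    - by have := GC (y p.1) (y q.1); have := GC (y' p.2) (y' q.2); lra.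
  by rewrite (expect_label_mismatch uy uy') mulr0.
have b1 : bm (fun q : (T * T) * (T * T) => D1 (q.1.1, q.2.1)) by bmt.
have b2 : bm (fun q : (T * T) * (T * T) => D2 (q.1.2, q.2.2)) by bmt.
have cc := cut_leB (bmD b1 bD0) b2 (cut_leD b1 bD0 c1 c0) c2.
rewrite (_ : 2 * e = e + 0 + e); last by ring.
by apply: eq_cut_le cc => q; rewrite /D1 /D0 /D2 /=; ring.
Qed.

End approximated_close.

(** * Weak limits and completeness for the cut norm *)

Lemma cvgn_cauchy (R : realType) (u : nat -> R) :
  (forall e, 0 < e -> exists N, forall n, (N <= n)%N -> `|u N - u n| <= e) ->
  cvgn u.
Proof.
move=> h; apply/cauchy_cvgP/cauchy_exP => e e0.
have [N hN] := h (e / 2) (divr_gt0 e0 (ltr0Sn _ _)).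
exists (u N); exists N => // n /= /hN /le_lt_trans; apply.
by rewrite ltr_pdivrMr// ltr_pMr// ltr1n.
Qed.

Lemma cvgn_near (R : realType) (u : nat -> R) l e : u @ \oo --> l -> 0 < e ->
  exists N, forall n, (N <= n)%N -> `|l - u n| <= e.
Proof. by move=> /cvgrPdist_le/(_ e) h e0; have [N _ hN] := h e0; exists N. Qed.

Lemma cvgn_sum (R : realType) (u : nat -> nat -> R) (l : nat -> R) n :
  (forall i, u i @ \oo --> l i) ->
  (fun j => \sum_(i < n) u i j) @ \oo --> \sum_(i < n) l i.
Proof.
move=> ul; elim: n => [|n ih].
  rewrite big_ord0; under eq_fun do rewrite big_ord0; exact: cvg_cst.
rewrite big_ord_recr; under eq_fun do rewrite big_ord_recr.
exact: cvgD.
Qed.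

Lemma indic_setU (T : Type) (R : realType) (A B : set T) x : A `&` B = set0 ->
  \1_(A `|` B) x = \1_A x + \1_B x :> R.
Proof.
move=> AB; rewrite !indicE in_setU.
case: (boolP (x \in A)) => xA; last by rewrite add0r.
rewrite memNset ?addr0// => xB; suff : (@set0 T) x by [].
by rewrite -AB; split => //; exact/set_mem.
Qed.

Section weak_limit.
Context d (Om : measurableType d) (R : realType) (P : probability Om R).
Variables (V : nat -> Om -> R) (B : R).
Hypotheses (bV : forall j, bm (V j)) (VB : forall j x, 0 <= V j x <= B).

Let a j A := expect P (fun x => V j x * \1_A x).

Let a0 j A : 0 <= a j A.
Proof.
by apply: ge0_expect => x; rewrite mulr_ge0 ?indicE//; have /andP[] := VB j x.
Qed.

(** The bound is uniform in [j]; this is what allows limits in [j] to be exchanged with countable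
    unions. *)
Let a_diff j A G : measurable A -> measurable G -> A `<=` G ->
  0 <= a j G - a j A <= B * (pr P G - pr P A).
Proof.
move=> mA mG AG; have bA := bm_indic R mA; have bG := bm_indic R mG.
have bVj := bV j; rewrite /a -expectB; [|by bmt..].
rewrite !pr_expect// -expectB// -expectZl; last by bmt.
have i01 x : 0 <= \1_G x - \1_A x :> R.
  rewrite !indicE; case: (boolP (x \in A)) => [xA|_]; last by rewrite subr0.
  by rewrite [x \in G]mem_set ?subrr//; apply: AG; exact/set_mem.
apply/andP; split.
  by apply: ge0_expect => x; rewrite -mulrBr mulr_ge0//; have /andP[] := VB j x.
apply: ler_expect; [by bmt..|] => x.
by rewrite -mulrBr ler_wpM2r//; have /andP[] := VB j x.
Qed.

Let aU j (F : nat -> set Om) n : (forall i, measurable (F i)) -> trivIset setT F ->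
  a j (\big[setU/set0]_(i < n) F i) = \sum_(i < n) a j (F i).
Proof.
move=> mF tF; rewrite /a -expect_sum => [|i]; last first.
  by apply: bmM; [exact: bV|exact: bm_indic].
apply: eq_expect => x; rewrite -mulr_sumr; congr (_ * _).
elim: n => [|n ih]; first by rewrite !big_ord0 indicE in_set0.
rewrite !big_ord_recr/= -ih indic_setU//.
apply/seteqP; split => // y [].
rewrite -bigcup_mkord => -[i /= ilt Fi] Fn.
have := tF i n I I (ex_intro _ y (conj Fi Fn)) => e.
by move: ilt; rewrite e ltnn.
Qed.

Let prU (F : nat -> set Om) e : (forall i, measurable (F i)) -> trivIset setT F -> 0 < e ->
  exists N, forall n, (N <= n)%N ->
    pr P (\bigcup_i F i) - pr P (\big[setU/set0]_(i < n) F i) <= e.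
Proof.
move=> mF tF e0; have mU : measurable (\bigcup_i F i) by exact: bigcupT_measurable.
have mUn n : measurable (\big[setU/set0]_(i < n) F i) by exact: bigsetU_measurable.
have : EFin \o (fun n => pr P (\big[setU/set0]_(i < n) F i)) @ \oo -->
    (pr P (\bigcup_i F i))%:E.
  rewrite prE//; have := @measure_semi_sigma_additive _ _ _ P F mF tF mU.
  rewrite (_ : (fun n => _) = EFin \o (fun n => pr P (\big[setU/set0]_(i < n) F i)))//.
  apply/funext => n; rewrite big_mkord /= prE; last exact: mUn.
  apply/esym/measure_bigsetU_ord => //.
  by move=> i j _ _ Fij; apply/val_inj; exact: tF Fij.
move=> /fine_cvg /= /cvgn_near /(_ e0)[N hN].
exists N => n Nn.
by apply: le_trans (hN n Nn); exact: ler_norm.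
Qed.

Let cvg_approx G : measurable G ->
  (forall e, 0 < e -> exists A, [/\ measurable A, A `<=` G, pr P G - pr P A <= e &
    cvgn (a ^~ A)]) -> cvgn (a ^~ G).
Proof.
move=> mG h; apply: cvgn_cauchy => e e0.
have B1 : 0 < `|B| + 1 by rewrite ltr_wpDl.
have [A [mA AG PA cA]] := h (e / 4 / (`|B| + 1)) (divr_gt0 (divr_gt0 e0 (ltr0Sn _ _)) B1).
have e4 : 0 < e / 4 by rewrite divr_gt0.
have [N hN] := cvgn_near cA e4.
have dGA j : 0 <= a j G - a j A <= e / 4.
  have /andP[h1 h2] := a_diff j mA mG AG; rewrite h1; apply: le_trans h2 _.
  apply: (@le_trans _ _ ((`|B| + 1) * (pr P G - pr P A))).
    apply: ler_wpM2r; first by rewrite subr_ge0 pr_le.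
    by have := ler_norm B; lra.
  by rewrite mulrC -ler_pdivlMr.
exists N => n Nn; have := hN N (leqnn _); have := hN n Nn.
have := dGA N; have := dGA n; rewrite !ler_norml.
move=> /andP[? ?] /andP[? ?] /andP[? ?] /andP[? ?]; apply/andP; split; lra.
Qed.

(** The sets with convergent integrals form a Dynkin system: complements by subtraction, disjoint
    unions by uniform approximation from inside by finite unions. *)
Lemma weak_cvg_dynkin (G : set (set Om)) : @measurable _ Om = <<s G >> ->
  setI_closed G -> cvgn (a ^~ setT) ->
  (forall A, G A -> cvgn (a ^~ A)) -> forall A, measurable A -> cvgn (a ^~ A).
Proof.
move=> mG IG cT cG A mA.
apply: (@dynkin_induction _ Om G (fun A => cvgn (a ^~ A)) mG IG cT cG);
  last by rewrite -mG.
- move=> S mS cS.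
  have -> : a ^~ (~` S) = (fun j => a j setT - a j S); last exact: (is_cvgB cT cS).
  apply/funext => j; have bS := bm_indic R mS; have bT := bm_indic R (@measurableT _ Om).
  have bVj := bV j; rewrite /a -expectB; [|by bmt..].
  by apply: eq_expect => x; rewrite -mulrBr indicC indicT indicE;
    case: (x \in S); rewrite ?subrr ?subr0.
- move=> F mF tF cF; apply: cvg_approx; first exact: bigcupT_measurable.
  move=> e e0; have [N hN] := prU mF tF e0.
  exists (\big[setU/set0]_(i < N) F i); split.
  + exact: bigsetU_measurable.
  + by rewrite -bigcup_mkord => x [i _ Fi]; exists i.
  + exact: hN.
  + under eq_fun do rewrite aU//.
    apply/cvg_ex; eexists; apply: (cvgn_sum (u := fun i j => a j (F i))) => i; exact: cF.
Qed.

Hypothesis cvg_a : forall A, measurable A -> cvgn (a ^~ A).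

Let l A := limn (a ^~ A).

(** The value 0 off the sigma-algebra keeps the set function nonnegative on all sets, as the measure
    structure requires. *)
Definition weak_limit_measure (A : set Om) : \bar R :=
  if `[< measurable A >] then (l A)%:E else 0%E.

Let nuE A : measurable A -> weak_limit_measure A = (l A)%:E.
Proof. by move=> mA; rewrite /weak_limit_measure asboolT. Qed.

Let nu0 : weak_limit_measure set0 = 0%E.
Proof.
rewrite nuE// /l (_ : a ^~ set0 = fun=> 0); first by rewrite lim_cst.
apply/funext => j; rewrite /a -[RHS](expect_cst P); apply: eq_expect => x.
by rewrite indic0 mulr0.
Qed.

Let nu_ge0 A : (0 <= weak_limit_measure A)%E.
Proof.
rewrite /weak_limit_measure; case: asboolP => // mA; rewrite lee_fin.
by apply: limr_ge; [exact: cvg_a|apply: nearW => j; exact: a0].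
Qed.

Let l_diff A G : measurable A -> measurable G -> A `<=` G ->
  0 <= l G - l A <= B * (pr P G - pr P A).
Proof.
move=> mA mG AG.
have h : (fun j => a j G - a j A) @ \oo --> l G - l A.
  exact: (cvgB (cvg_a mG) (cvg_a mA)).
apply/andP; split.
  by apply: (cvgr_to_ge h); apply: nearW => j; have /andP[] := a_diff j mA mG AG.
by apply: (cvgr_to_le h); apply: nearW => j; have /andP[] := a_diff j mA mG AG.
Qed.

Let nu_sigma : semi_sigma_additive weak_limit_measure.
Proof.
move=> F mF tF mU; rewrite nuE//.
have mUn n : measurable (\big[setU/set0]_(i < n) F i) by exact: bigsetU_measurable.
have lU n : \sum_(i < n) l (F i) = l (\big[setU/set0]_(i < n) F i).
  rewrite /l; under [in RHS]eq_fun do rewrite aU//.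
  apply/esym/cvg_lim => //.
  apply: (cvgn_sum (u := fun i j => a j (F i)) (l := fun i => l (F i))) => i.
  exact: cvg_a.
rewrite (_ : (fun n => _) = EFin \o (fun n => l (\big[setU/set0]_(i < n) F i))); last first.
  apply/funext => n /=; rewrite -lU -sumEFin big_mkord.
  by apply: eq_bigr => i _; rewrite nuE.
apply: cvg_EFin; first by near=> n.
apply/cvgrPdist_le => e e0.
have B1 : 0 < `|B| + 1 by rewrite ltr_wpDl.
have [N hN] := prU mF tF (divr_gt0 e0 B1).
near=> n; have Nn : (N <= n)%N by near: n; exact: nbhs_infty_ge.
have sub : \big[setU/set0]_(i < n) F i `<=` \bigcup_i F i.
  by rewrite -bigcup_mkord => x [i _ Fi]; exists i.
have /andP[h1 h2] := l_diff (mUn n) mU sub.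
rewrite ger0_norm//; apply: le_trans h2 _.
apply: (@le_trans _ _ ((`|B| + 1) * (pr P (\bigcup_i F i) - pr P (\big[setU/set0]_(i < n) F i)))).
  apply: ler_wpM2r; first by rewrite subr_ge0 pr_le.
  by have := ler_norm B; lra.
by rewrite mulrC -ler_pdivlMr// hN.
Unshelve. all: by end_near. Qed.

HB.instance Definition _ :=
  isMeasure.Build _ _ _ weak_limit_measure nu0 nu_ge0 nu_sigma.

Let nu_fin : fin_num_fun weak_limit_measure.
Proof. by move=> A mA; rewrite nuE. Qed.

HB.instance Definition _ :=
  Measure_isFinite.Build _ _ _ weak_limit_measure nu_fin.

Let l_le A : measurable A -> l A <= B * pr P A.
Proof.
move=> mA; have /andP[_] := l_diff measurable0 mA (@sub0set _ A).
have -> : l set0 = 0 by apply: EFin_inj; rewrite -nuE.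
by rewrite /pr measure0 !subr0.
Qed.

Lemma weak_limit : exists2 f : Om -> R,
  measurable_fun setT f /\ (forall x, 0 <= f x <= B) &
  forall A, measurable A -> a ^~ A @ \oo --> expect P (fun x => f x * \1_A x).
Proof.
have dom : weak_limit_measure `<< P.
  apply/null_content_dominatesP => A mA PA; rewrite nuE//; congr EFin.
  apply/eqP; rewrite eq_le; apply/andP; split.
    by apply: le_trans (l_le mA) _; rewrite /pr PA mulr0.
  by rewrite -lee_fin -nuE.
have [g [g0 gfin gint gE]] := @radon_nikodym_sigma_finite _ _ _ P weak_limit_measure dom.
have lE A : measurable A -> (\int[P]_(x in A) g x)%E = (l A)%:E.
  by move=> mA; rewrite -gE//; exact: nuE.
have mg : measurable_fun setT g := measurable_int _ gint.
pose h x := fine (g x).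
have mh : measurable_fun setT h by apply: measurableT_comp mg; exact: fine_measurable.
have hE x : (h x)%:E = g x by rewrite fineK.
have h0 x : 0 <= h x by rewrite fine_ge0.
(* The limit measure is at most [B] times [P], so the integral over [N] of g - B, which is positive
   there, is at most 0. Hence [N] is null. *)
pose N := [set x | B < h x].
have mN : measurable N.
  rewrite (_ : N = h @^-1` `]B, +oo[).
    by rewrite -[X in measurable X]setTI; exact: mh.
  by apply/seteqP; split => x /=; rewrite in_itv/= andbT.
have intg A : measurable A -> P.-integrable A g.
  by move=> mA; exact: integrableS gint.
have PN : P N = 0%E.
  have intB : P.-integrable N (cst B%:E).
    apply: (integrableS measurableT) => //; exact: (bm_integrable P (bm_cst _ B)).
  have iB : (\int[P]_(x in N) cst B%:E x)%E = (B * pr P N)%:E.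
    by rewrite integral_cst// EFinM prE.
  have : (\int[P]_(x in N) `|g x - cst B%:E x| = 0)%E.
    apply/eqP; rewrite eq_le integral_ge0// andbT.
    rewrite (eq_integral (fun x => g x - cst B%:E x)%E); last first.
      move=> x; rewrite inE /N /= => Bx; rewrite gee0_abs// -hE -EFinB lee_fin subr_ge0.
      exact: ltW.
    rewrite integralB//; last exact: intg.
    rewrite lE// iB -EFinB lee_fin subr_le0.
    exact: l_le.
  have mgN : measurable_fun N (fun x => g x - cst B%:E x)%E.
    apply: emeasurable_funB; [exact: measurable_funTS|exact: measurable_cst].
  move=> /(ae_eq_integral_abs P mN mgN)[M [mM PM subM]].
  apply/eqP; rewrite eq_le measure_ge0 andbT -PM; apply: le_measure; rewrite ?inE//.
  move=> x Nx; apply: subM => /=; apply/not_implyP; split => //.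
  rewrite -hE -EFinB => -[] /eqP; rewrite subr_eq0 => /eqP hB.
  by move: Nx; rewrite /N /= hB ltxx.
have [x0|no] := pselect (exists x : Om, True); last first.
  exfalso; have : expect P (fun=> 1) = 0 :> R.
    rewrite (_ : (fun=> 1) = fun=> 0) ?expect_cst//.
    by apply/funext => x; exfalso; apply: no; exists x.
  by rewrite expect_cst => /eqP; rewrite oner_eq0.
have B0 : 0 <= B.
  by have [x _] := x0; have /andP[] := VB 0%N x; exact: le_trans.
(* Truncation changes the density only on [N] and makes the bound hold at every point. *)
pose f x := Order.min (h x) B.
have mf : measurable_fun setT f by apply: measurable_minr => //; exact: measurable_cst.
have f0B x : 0 <= f x <= B by rewrite le_min h0 B0 ge_min lexx orbT.
have bf : bm f.
  by split => //; exists B => x; have /andP[f0 fB] := f0B x; rewrite ger0_norm.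
exists f => // A mA.
suff -> : expect P (fun x => f x * \1_A x) = l A by exact: cvg_a.
apply: EFin_inj; rewrite -lE// (negligible_integral mN mA (intg _ mA) PN).
have intf : P.-integrable A (EFin \o f).
  by apply: (integrableS measurableT) => //; exact: bm_integrable.
rewrite (eq_integral (EFin \o f)); last first.
  move=> x; rewrite inE => -[Ax nN]; rewrite /= -hE; congr EFin.
  by rewrite /f min_l// leNgt; apply/negP.
rewrite -(negligible_integral mN mA intf PN) /expect /Rintegral fineK; last first.
  apply: integrable_fin_num => //; apply: (bm_integrable P (f := fun x => f x * \1_A x)).
  by apply: bmM => //; exact: bm_indic.
rewrite [RHS]integral_mkcond; apply: eq_integral => x _.
by rewrite patchE indicE; case: (x \in A); rewrite ?mulr1 ?mulr0.
Qed.

End weak_limit.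

Lemma indicX d d' (T : measurableType d) (T' : measurableType d') (R : realType)
    (S : set T) (U : set T') (p : T * T') :
  \1_(S `*` U) p = \1_S p.1 * \1_U p.2 :> R.
Proof.
rewrite !indicE -natrM mulnb; congr (nat_of_bool _)%:R.
apply/idP/andP => [/set_mem[/mem_set ? /mem_set ?]//|[/set_mem ? /set_mem ?]].
by apply/mem_set; split.
Qed.

Lemma expect_kform d (T : measurableType d) (R : realType) (mu : probability T R)
    (D : T * T -> R) (S U : set T) : bm D -> measurable S -> measurable U ->
  expect (mu \x mu)%E (fun p => D p * \1_(S `*` U) p) = kform mu D \1_S \1_U.
Proof.
move=> bD mS mU; rewrite expect_prod; last first.
  by apply: bmM => //; apply: bm_indic; exact: measurableX.
by apply: eq_expect => x; apply: eq_expect => y; rewrite indicX.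
Qed.

Section cut_completeness.
Context (R : realType).
Local Notation T := (measurableTypeR R).
Local Notation lam := (lebesgue01 R).

(** The cut bound says that integrals over rectangles are Cauchy. Rectangles generate the product
    sigma-algebra, so a weak limit density exists. For fixed [S] and [U] the bound is a closed
    condition and survives the limit. *)
Lemma cut_complete lo hi (V : nat -> T * T -> R) (c : nat -> R) :
  (forall j, kernel_in lo hi (V j)) ->
  (forall i j, (i <= j)%N -> cut_le lam (fun p => V i p - V j p) (c i)) ->
  c @ \oo --> 0 ->
  exists2 W, kernel_in lo hi W & forall i, cut_le lam (fun p => V i p - W p) (c i).
Proof.
move=> Vk Vc c0; pose P : probability (T * T)%type R := (lam \x lam)%E.
have bV j : bm (V j) by case: (Vk j).
have Vs j x y : V j (x, y) = V j (y, x) by case: (Vk j).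
(* The shift makes the densities nonnegative, so that they define measures. *)
pose B := hi - lo; pose v j p := V j p - lo.
have bv j : bm (v j) by exact: bmD (bV j) (bm_cst _ (- lo)).
have vB j p : 0 <= v j p <= B.
  by have [_ /(_ p)/andP[h1 h2] _] := Vk j; rewrite /v /B subr_ge0 h1 lerD2r.
pose a j A := expect P (fun x => v j x * \1_A x).
have aX j S U : measurable S -> measurable U -> a j (S `*` U) = kform lam (v j) \1_S \1_U.
  by move=> mS mU; exact: expect_kform.
have cX S U : measurable S -> measurable U -> cvgn (a ^~ (S `*` U)).
  move=> mS mU; apply: cvgn_cauchy => e e0.
  have [N hN] := cvgn_near c0 e0; exists N => n Nn; rewrite !aX//.
  have bS := bm_indic R mS; have bU := bm_indic R mU.
  rewrite -(kformB lam (bv N) (bv n) bS bU).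
  apply: (@le_trans _ _ (c N)).
    rewrite (@eq_kform _ _ _ lam _ (fun p => V N p - V n p)); first exact: Vc.
    by move=> p; rewrite /v; ring.
  by have := hN N (leqnn _); rewrite sub0r normrN; apply: le_trans; exact: ler_norm.
have [f [mf f0B] fE] : exists2 f : T * T -> R,
    measurable_fun setT f /\ (forall x, 0 <= f x <= B) &
    forall A, measurable A -> a ^~ A @ \oo --> expect P (fun x => f x * \1_A x).
  apply: weak_limit => // A mA.
  apply: (@weak_cvg_dynkin _ _ _ P v B bv vB
    [set S `*` U | S in measurable & U in measurable]) => //.
  - exact: measurable_prod_measurableType.
  - move=> X Y [X1 mX1 [X2 mX2 <-{X}]] [Y1 mY1 [Y2 mY2 <-{Y}]].
    exists (X1 `&` Y1); first exact: measurableI.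
    by exists (X2 `&` Y2); [exact: measurableI|rewrite setXI].
  - by rewrite -setXTT; exact: cX.
  - by move=> X [S mS [U mU <-]]; exact: cX.
have bf : bm f.
  by split => //; exists B => x; have /andP[f0 fB] := f0B x; rewrite ger0_norm.
(* The density [f] need not be symmetric at every point. Averaging it with its transpose repairs
   this and keeps the rectangle integrals, because each [V j] is symmetric. *)
pose W p := lo + (f (p.1, p.2) + f (p.2, p.1)) / 2.
have bW : bm W by rewrite /W; bmt.
exists W.
  split => // [p|x y]; last by rewrite /W /= [f (y, x) + _]addrC.
  have := f0B (p.1, p.2); have := f0B (p.2, p.1).
  by move=> /andP[? ?] /andP[? ?]; rewrite /W; have BE : B = hi - lo by []; apply/andP; split; lra.
move=> i S U mS mU.
have bS := bm_indic R mS; have bU := bm_indic R mU.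
have fl S' U' : measurable S' -> measurable U' ->
    (fun j => kform lam (v j) \1_S' \1_U') @ \oo --> kform lam f \1_S' \1_U'.
  move=> mS' mU'; rewrite -expect_kform//.
  have := fE _ (measurableX mS' mU'); under eq_fun do rewrite aX//.
  by [].
have vsym j : kform lam (v j) \1_U \1_S = kform lam (v j) \1_S \1_U.
  have bvj := bv j.
  rewrite {1}/kform (expect_swapP lam lam (g := fun p => v j (p.1, p.2) *
    (\1_U p.1 * \1_S p.2))); [|by bmt|by []].
  apply: eq_expect => x; apply: eq_expect => y; rewrite /v Vs; ring.
have fsym : kform lam (fun p => f (p.2, p.1)) \1_S \1_U = kform lam f \1_U \1_S.
  rewrite {1}/kform (expect_swapP lam lam (g := fun p => f (p.2, p.1) *
    (\1_S p.1 * \1_U p.2))); [|by bmt|by []].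
  by apply: eq_expect => x; apply: eq_expect => y; rewrite [\1_S _ * _]mulrC.
have bfs : bm (fun p => f (p.2, p.1)) by bmt.
have bw : bm (fun p => W p - lo) by bmt.
have Wf : kform lam (fun p => W p - lo) \1_S \1_U =
    2^-1 * (kform lam f \1_S \1_U + kform lam f \1_U \1_S).
  rewrite -fsym -(kformDl lam bf bfs bS bU) -(kformZ lam _ (bmD bf bfs) bS bU).
  by apply: eq_kform => -[x y]; rewrite /W /=; ring.
have lim : (fun j => kform lam (v j) \1_S \1_U) @ \oo --> kform lam (fun p => W p - lo) \1_S \1_U.
  rewrite Wf; have l1 := fl S U mS mU; have l2 := fl U S mU mS.
  have -> : (fun j => kform lam (v j) \1_S \1_U) =
      (fun j => 2^-1 * (kform lam (v j) \1_S \1_U + kform lam (v j) \1_U \1_S)).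
    by apply/funext => j; rewrite vsym; field.
  by apply: cvgMr; exact: (cvgD l1 l2).
have lim2 : (fun j => `|kform lam (v i) \1_S \1_U - kform lam (v j) \1_S \1_U|) @ \oo -->
    `|kform lam (v i) \1_S \1_U - kform lam (fun p => W p - lo) \1_S \1_U|.
  by apply: cvg_norm; exact: (cvgB (cvg_cst _) lim).
have -> : kform lam (fun p => V i p - W p) \1_S \1_U =
    kform lam (v i) \1_S \1_U - kform lam (fun p => W p - lo) \1_S \1_U.
  rewrite -(kformB lam (bv i) bw bS bU); apply: eq_kform => p; rewrite /v; ring.
apply: (cvgr_to_le lim2); exists i => // j /= ij.
rewrite -(kformB lam (bv i) (bv j) bS bU).
rewrite (@eq_kform _ _ _ lam _ (fun p => V i p - V j p)); first exact: Vc.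
by move=> p; rewrite /v; ring.
Qed.

End cut_completeness.

(** * The limit kernel along a fast subsequence *)

Section limit_kernel.
Context (R : realType).
Local Notation T := (measurableTypeR R).
Local Notation lam := (lebesgue01 R).
Implicit Types (W : T * T -> R).

Lemma mass_fst d (Om : measurableType d) (mu : probability Om R)
    (L L' : finType) (z : Om -> L) (y : Om -> L') a : labelling z -> labelling y ->
  mass mu z a = \sum_i mass mu (fun x => (z x, y x)) (a, i).
Proof.
move=> mz my.
transitivity (expect mu (fun x => (fun b (_ : L') => (b == a)%:R) (z x) (y x)) : R).
  by apply: eq_expect => x; rewrite indic_label.
rewrite (mass_marginal mu (fun b (_ : L') => (b == a)%:R) mz my).
rewrite (bigD1 a)//= [X in _ + X]big1 ?addr0 => [|b ba].
  by apply: eq_bigr => i _; rewrite eqxx mul1r.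
by rewrite big1// => i _; rewrite (negbTE ba) mul0r.
Qed.

(** The box norm of a step kernel depends only on the law of the label, so an estimate carries over
    to any labelling with the same law. *)
Lemma box_label_mass d (Om : measurableType d) (mu : probability Om R)
    (L : finType) (z z' : Om -> L) (K : L -> L -> R) : labelling z -> labelling z' ->
  (forall a, mass mu z a = mass mu z' a) ->
  box mu (fun p => K (z p.1) (z p.2)) = box mu (fun p => K (z' p.1) (z' p.2)).
Proof.
move=> mz mz' zz'; rewrite (box_label mu K mz) (box_label mu K mz').
apply: eq_bigr => j _; rewrite zz'.
congr (_ * _); apply: eq_bigr => j' _; rewrite zz'; congr (_ ^+ 2 * _).
by apply: eq_bigr => i _; rewrite zz'.
Qed.

(** [Z] and [y] are both uniform, so the prescribed joint law has the law of [Z] as its first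
    marginal. *)
Lemma uniform_label_extend k k' (Z y : T -> 'I_k.+1) (y' : T -> 'I_k'.+1) :
  uniform_label Z -> uniform_label y -> uniform_label y' ->
  exists2 Z' : T -> 'I_k'.+1, uniform_label Z' &
    forall ab, mass lam (fun x => (Z x, Z' x)) ab = mass lam (fun x => (y x, y' x)) ab.
Proof.
move=> [mZ uZ] [my uy] [my' uy'].
have [||Z' [mZ' ZZ']] := @lebesgue01_joint_label R _ k' Z
    (fun a b => mass lam (fun x => (y x, y' x)) (a, b)) mZ.
- by move=> a b; exact: mass_ge0.
- by move=> a; rewrite -(mass_fst lam a my my') uy uZ.
exists Z'; last by case=> a b; exact: ZZ'.
split=> // i; rewrite (mass_snd lam i mZ mZ') -(uy' i) (mass_snd lam i my my').
by apply: eq_bigr => a _; exact: ZZ'.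
Qed.

Lemma exists_label_chain (k : nat -> nat) (y y' : forall j, T -> 'I_(k j).+1) :
  (forall j, uniform_label (y j)) -> (forall j, uniform_label (y' j)) ->
  exists2 Z : forall j, T -> 'I_(k j).+1, forall j, uniform_label (Z j) &
    forall j ab, mass lam (fun x => (Z j x, Z j.+1 x)) ab =
                 mass lam (fun x => (y' j x, y j.+1 x)) ab.
Proof.
move=> uy uy'.
pose S j := {Z : T -> 'I_(k j).+1 | uniform_label Z}.
have next j (s : S j) : {s' : S j.+1 | forall ab,
    mass lam (fun x => (sval s x, sval s' x)) ab =
    mass lam (fun x => (y' j x, y j.+1 x)) ab}.
  apply: cid; case: s => Z uZ.
  have [Z' uZ' h] := uniform_label_extend uZ (uy' j) (uy j.+1).
  by exists (exist _ Z' uZ').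
pose chain := nat_rect S (exist _ (y 0%N) (uy 0%N)) (fun j s => sval (next j s)).
exists (fun j => sval (chain j)) => j; first exact: svalP.
exact: (svalP (next j (chain j))).
Qed.

Lemma graph_kernel_bounds (lo hi : R) n (G : {ffun 'I_n * 'I_n -> bool}) i j :
  lo <= hi -> lo <= graph_kernel lo hi G i j <= hi.
Proof.
by move=> lh; rewrite /graph_kernel /value; do !case: ifP => _; rewrite ?lexx ?lh.
Qed.

Definition mutually_approximated (lo hi : R) W W' eps : Prop :=
  exists k (G : {ffun 'I_k.+1 * 'I_k.+1 -> bool}),
    approximated W (graph_kernel lo hi G) eps /\
    approximated W' (graph_kernel lo hi G) eps.

(** Only a subsequence is controlled, so closeness to [U] is claimed for arbitrarily large n; this
    suffices once the densities are known to converge. *)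
Lemma exists_limit_kernel (lo hi : R) (W : nat -> T * T -> R) : lo < hi ->
  (forall n, kernel_in lo hi (W n)) ->
  (forall eps, 0 < eps -> exists N, forall m n, (N <= m)%N -> (N <= n)%N ->
     mutually_approximated lo hi (W m) (W n) eps) ->
  exists2 U, kernel_in lo hi U & forall eps N, 0 < eps ->
    exists2 n, (N <= n)%N & mutually_approximated lo hi (W n) U eps.
Proof.
move=> lh Wk Wc.
pose C : R := `|lo| + `|hi| + 1.
have C0 : 0 < C by rewrite ltr_wpDl// addr_ge0.
have inC t : lo <= t <= hi -> `|t| <= C.
  move=> /andP[l h]; rewrite ler_norml; apply/andP; split.
    by rewrite /C; have := normr_ge0 hi; have := ler_norm (- lo); rewrite normrN; lra.
  by rewrite /C; have := normr_ge0 lo; have := ler_norm hi; lra.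
pose del (j : nat) : R := 2^-1 ^+ j.
have del0 j : 0 < del j by rewrite exprn_gt0.
have delS j : 2 * del j.+1 = del j by rewrite /del exprS mulVKf.
have [h20 h21] : 0 <= (2^-1 : R) /\ (2^-1 : R) <= 1.
  by split; [rewrite invr_ge0|rewrite invf_le1// ler1n].
have del1 j : del j <= 1 by exact: exprn_ile1.
have del_le i j : (i <= j)%N -> del j <= del i.
  by move=> ij; exact: ler_wiXn2l.
have delcvg : del @ \oo --> 0.
  by apply: cvg_expr; rewrite gtr0_norm// invf_lt1// ltr1n.
(* A kernel bounded by 2C with cut norm at most 2 ep_j has box norm at most c ep_j = del_j^4, hence
   cut norm at most del_j under any labelling of the same law. *)
pose c : R := 4 * (2 * C) ^+ 3 * 2.
have c0 : 0 < c by rewrite !mulr_gt0// exprn_gt0// mulr_gt0.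
pose ep j := del j ^+ 4 / c.
have ep0 j : 0 < ep j by rewrite divr_gt0// exprn_gt0.
have epS j : ep j.+1 <= ep j.
  rewrite /ep ler_wpM2r ?invr_ge0 ?(ltW c0)//.
  by rewrite ler_pXn2r// ?nnegrE ?(ltW (del0 _))// del_le.
have /choice[N NP] := fun j => Wc (ep j) (ep0 j).
(* Both n_j and n_(j+1) are at least N_j, so one graph of tolerance ep_j serves both; the summand j
   makes the indices tend to infinity. *)
pose n j := (j + \sum_(i < j.+1) N i)%N.
have nN j : (N j <= n j)%N by rewrite /n big_ord_recr/= addnA leq_addl.
have nNS j : (N j <= n j.+1)%N.
  apply: leq_trans (nN j) _; rewrite /n [in X in (_ <= X)%N]big_ord_recr/=.
  by rewrite leq_add// leq_addr.
(* The number of classes varies with j, so choice is applied to a dependent package. *)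
pose data := {k : nat & (('I_k.+1 -> 'I_k.+1 -> R) * (T -> 'I_k.+1) * (T -> 'I_k.+1))%type}.
have /choice[D DP] : forall j, exists D : data,
    [/\ exists G, (projT2 D).1.1 = graph_kernel lo hi G,
        uniform_label (projT2 D).1.2, uniform_label (projT2 D).2,
        cut_le lam (fun p => W (n j) p -
          (projT2 D).1.1 ((projT2 D).1.2 p.1) ((projT2 D).1.2 p.2)) (ep j) &
        cut_le lam (fun p => W (n j.+1) p -
          (projT2 D).1.1 ((projT2 D).2 p.1) ((projT2 D).2 p.2)) (ep j)].
  move=> j; have [k [G [[y uy yc] [y' uy' yc']]]] := NP j _ _ (nN j) (nNS j).
  by exists (existT _ k (graph_kernel lo hi G, y, y')); split;
    [exists G|exact: uy|exact: uy'|exact: yc|exact: yc'].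
pose k j := projT1 (D j).
pose H j : 'I_(k j).+1 -> 'I_(k j).+1 -> R := (projT2 (D j)).1.1.
pose y j : T -> 'I_(k j).+1 := (projT2 (D j)).1.2.
pose y' j : T -> 'I_(k j).+1 := (projT2 (D j)).2.
have HG j : exists G, H j = graph_kernel lo hi G by case: (DP j).
have uy j : uniform_label (y j) by case: (DP j).
have uy' j : uniform_label (y' j) by case: (DP j).
have cy j : cut_le lam (fun p => W (n j) p - H j (y j p.1) (y j p.2)) (ep j).
  by case: (DP j) => _ _ _ h _; exact: h.
have cy' j : cut_le lam (fun p => W (n j.+1) p - H j (y' j p.1) (y' j p.2)) (ep j).
  by case: (DP j) => _ _ _ _ h; exact: h.
clearbody k H y y'; clear D DP.
have [Z uZ ZZ] := exists_label_chain uy uy'.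
have Hlh j a b : lo <= H j a b <= hi.
  by have [G ->] := HG j; exact: graph_kernel_bounds (ltW lh).
have Hs j a b : H j a b = H j b a by have [G ->] := HG j; exact: graph_kernel_sym.
have bH j (z : T -> 'I_(k j).+1) : uniform_label z -> bm (fun p => H j (z p.1) (z p.2)).
  by move=> [mz _]; exact: (@bm_label2 _ _ _ _ _ _ _ _ _ (H j) mz mz).
pose V j (p : T * T) := H j (Z j p.1) (Z j p.2).
have Vk j : kernel_in lo hi (V j).
  by split=> [|p|u v]; [exact: bH|exact: Hlh|exact: Hs].
have bV j : bm (V j) by case: (Vk j).
have bW j : bm (W j) by case: (Wk j).
(* With [y' j] and [y j.+1] as labels, both graphs are close to the same kernel [W (n j.+1)];
   equality of the joint laws carries the box estimate over to [Z]. *)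
have step j : cut_le lam (fun p => V j p - V j.+1 p) (del j).
  have bVV : bm (fun p => V j p - V j.+1 p) by exact: bmD (bV j) (bmN (bV j.+1)).
  apply: (cut_le_box bVV (ltW (del0 j))).
  pose K (a b : 'I_(k j).+1 * 'I_(k j.+1).+1) := H j a.1 b.1 - H j.+1 a.2 b.2.
  have mZ : labelling (fun x => (Z j x, Z j.+1 x)).
    by apply: labelling_pair; [case: (uZ j)|case: (uZ j.+1)].
  have my : labelling (fun x => (y' j x, y j.+1 x)).
    by apply: labelling_pair; [case: (uy' j)|case: (uy j.+1)].
  rewrite -[box _ _]/(box lam (fun p => K (Z j p.1, Z j.+1 p.1) (Z j p.2, Z j.+1 p.2))).
  rewrite (box_label_mass K mZ my (ZZ j)).
  have b1 := bH j _ (uy' j); have b2 := bH j.+1 _ (uy j.+1).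
  have bK : bm (fun p => K (y' j p.1, y j.+1 p.1) (y' j p.2, y j.+1 p.2)).
    exact: bmD b1 (bmN b2).
  have cK := cut_leB (bmD (bW (n j.+1)) (bmN b2)) (bmD (bW (n j.+1)) (bmN b1))
    (cy j.+1) (cy' j).
  have {}cK : cut_le lam (fun p => K (y' j p.1, y j.+1 p.1) (y' j p.2, y j.+1 p.2))
      (ep j.+1 + ep j).
    by apply: eq_cut_le cK => p; rewrite /K /=; ring.
  have KC p : `|K (y' j p.1, y j.+1 p.1) (y' j p.2, y j.+1 p.2)| <= 2 * C.
    apply: le_trans (ler_normB _ _) _; rewrite mulr_natl mulr2n.
    by apply: lerD; apply: inC; exact: Hlh.
  have C2 : 0 < 2 * C by rewrite mulr_gt0.
  apply: le_trans (box_le_cut bK C2 KC cK) _.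
  apply: (@le_trans _ _ (4 * (2 * C) ^+ 3 * (ep j + ep j))).
    by rewrite ler_wpM2l ?lerD2r// mulr_ge0// exprn_ge0// ltW.
  rewrite (_ : 4 * (2 * C) ^+ 3 * (ep j + ep j) = c * ep j); last by rewrite /c; ring.
  by rewrite /ep mulrC divfK// gt_eqF.
(* The geometric sum of the steps, kept in the exact form 2 del_i - 2 del_(i+m) so that the
   induction closes. *)
have chain i m : cut_le lam (fun p => V i p - V (i + m)%N p) (2 * del i - 2 * del (i + m)%N).
  elim: m => [|m ih].
    rewrite addn0 subrr => S U' mS mU.
    rewrite (@eq_kform _ _ _ lam _ (fun p => 0 * V i p)); last by move=> p; ring.
    rewrite kformZ; [|exact: bV|exact: bm_indic|exact: bm_indic].
    by rewrite mul0r normr0.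
  have b1 : bm (fun p => V i p - V (i + m)%N p) by exact: bmD (bV _) (bmN (bV _)).
  have b2 : bm (fun p => V (i + m)%N p - V (i + m).+1 p) by exact: bmD (bV _) (bmN (bV _)).
  have := cut_leD b1 b2 ih (step (i + m)%N).
  rewrite (_ : 2 * del i - _ + _ = 2 * del i - 2 * del (i + m.+1)%N); last first.
    by rewrite addnS delS; ring.
  by apply: eq_cut_le => p; rewrite addnS; ring.
have [||U Uk Uc] := @cut_complete R lo hi V (fun i => 2 * del i) Vk.
- move=> i j ij; have := chain i (j - i)%N; rewrite subnKC//.
  by apply: cut_le_trans; have := del0 j; lra.
- rewrite -[X in _ --> X](mulr0 2); exact: cvgMr.
exists U => // eps M eps0.
(* The first bound controls 2 del_i, the distance from [V i] to the limit; the second controls ep_i,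
   which is at most del_i / c. *)
have e0 : 0 < Order.min (eps / 2) (eps * c) by rewrite lt_min divr_gt0// mulr_gt0.
have [J hJ] := cvgn_near delcvg e0.
pose i := maxn J M.
have : `|0 - del i| <= Order.min (eps / 2) (eps * c) by apply: hJ; exact: leq_maxl.
rewrite sub0r normrN gtr0_norm// le_min => /andP[d1 d2].
exists (n i); first by rewrite /n; apply: leq_trans (leq_maxr J M) (leq_addr _ _).
have [G HiG] := HG i; exists (k i), G; rewrite -HiG; split.
  exists (y i) => //; apply: cut_le_trans (cy i).
  rewrite /ep ler_pdivrMr//; apply: le_trans d2.
  by rewrite exprSr ler_piMl ?(ltW (del0 _))// exprn_ile1// ltW.
exists (Z i) => //.
have bU : bm U by case: Uk.
have bD : bm (fun p => V i p - U p) by exact: bmD (bV i) (bmN bU).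
have := cut_leN bD (Uc i).
move=> /(cut_le_trans (c' := eps)) h; apply: eq_cut_le (h _).
  by move=> p; rewrite /V; ring.
lra.
Qed.

End limit_kernel.

(** * Homomorphism densities and cut distance of graphons *)

Section bridge.
Context (R : realType).
Local Notation T := (measurableTypeR R).
Local Notation lam := (lebesgue01 R).
Implicit Types (W : T * T -> R) (F : simple_graph).

(** The filler lies in [lo, hi], so that boundedness and symmetry hold on the whole plane. *)
Definition extend_kernel (lo : R) W (p : T * T) : R :=
  if p \in @unit_square R then W p else lo.

Lemma measurable_unit_square : measurable (@unit_square R).
Proof. by apply: measurableX; exact: measurable_itv. Qed.

Lemma extend_kernel_in lo hi W : lo <= hi -> graphon W ->
  (forall p, unit_square p -> lo <= W p <= hi) -> kernel_in lo hi (extend_kernel lo W).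
Proof.
move=> lh [mW _ Ws] Wlh; have inlh p : lo <= extend_kernel lo W p <= hi.
  by rewrite /extend_kernel; case: ifPn => [/set_mem/Wlh//|_]; rewrite lexx.
split => [|//|x y].
  split; last first.
    exists (`|lo| + `|hi|) => p; have /andP[h1 h2] := inlh p.
    have := ler_norm (- lo); rewrite normrN; have := ler_norm hi.
    have := normr_ge0 lo; have := normr_ge0 hi; rewrite ler_norml => *.
    by apply/andP; split; lra.
  rewrite (_ : extend_kernel lo W = fun p => ((fun p => W p - lo) \_ (@unit_square R)) p + lo).
    apply: measurable_funD; last exact: measurable_cst.
    apply/(measurable_restrictT _ measurable_unit_square).
    by apply: measurable_funB => //; exact: measurable_cst.
  by apply/funext => p; rewrite /extend_kernel patchE; case: ifP => _;
    [rewrite subrK|rewrite add0r].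
rewrite /extend_kernel; have [xy|xy] := boolP ((x, y) \in _).
  rewrite [(y, x) \in _]mem_set; last by move: xy => /set_mem [].
  by apply: Ws; exact/set_mem.
by rewrite memNset// => yx; move/negP: xy; apply; apply/mem_set; case: yx.
Qed.

Lemma lam_outside : expect lam \1_(~` `[0, 1]) = 0.
Proof.
have mI : measurable (`[0, 1] : set T) by exact: measurable_itv.
rewrite expect_indic; last exact: measurableC.
rewrite -[LHS]/(fine (@lebesgue_measure R (~` `[0, 1] `&` `[0, 1]))).
by rewrite setICl measure0.
Qed.

Lemma expect_null d (Om : measurableType d) (P : probability Om R) (g h : Om -> R) :
  bm g -> bm h -> (forall x, 0 <= h x) -> expect P h = 0 ->
  expect P (fun x => g x * h x) = 0.
Proof.
move=> bg bh h0 Eh; have [_ [C gC]] := bg.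
apply/eqP; rewrite -normr_le0; apply: le_trans (ler_norm_expect _ _) _; first by bmt.
apply: (@le_trans _ _ (expect P (fun x => C * h x))).
  apply: ler_expect; [by bmt..|] => x.
  by rewrite normrM (ger0_norm (h0 x)) ler_wpM2r.
by rewrite expectZl// Eh mulr0.
Qed.

(** The indicator factors are removed one coordinate at a time: resampling that coordinate shows
    that the error is supported on a null set. *)
Lemma expect_unit_cube n (f : n.-tuple T -> R) : bm f ->
  \int[power_measure lam n]_(x in @unit_cube R n) f x = expect (power_measure lam n) f.
Proof.
move=> bf; rewrite Rintegral_mkcond; pose h (u : T) : R := \1_(`[0, 1] : set T) u.
have mI : measurable (`[0, 1] : set T) by exact: measurable_itv.
have bh : bm h by exact: bm_indic.
transitivity (expect (power_measure lam n) (fun x =>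
    f x * \prod_(i <- index_enum 'I_n) h (tnth x i))).
  apply: eq_expect => x; rewrite patchE; case: ifPn => [/set_mem xc|xc].
    by rewrite big1 ?mulr1// => i _; rewrite /h indicE mem_set//; exact: xc.
  have /existsNP[i xi] : ~ unit_cube x by move=> xc'; move/negP: xc; apply; exact/mem_set.
  rewrite (bigD1_seq i) ?mem_index_enum ?index_enum_uniq//= {1}/h indicE memNset//.
  by rewrite mul0r mulr0.
elim: (index_enum 'I_n) => [|i s ih].
  by apply: eq_expect => x; rewrite big_nil mulr1.
rewrite -ih; apply/eqP; rewrite -subr_eq0 -expectB; [|by bmt..].
pose h' u : R := \1_(~` `[0, 1] : set T) u.
have bh' : bm h' by apply: bm_indic; exact: measurableC.
rewrite (@eq_expect _ _ _ _ _ (fun x =>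
    (- (f x * \prod_(i <- s) h (tnth x i))) * h' (tnth x i))) => [|x].
  apply/eqP; apply: expect_null; [by bmt|by bmt|by move=> x; rewrite /h' indicE|].
  rewrite (expect_resample lam i); last by bmt.
  rewrite -[RHS](expect_cst (power_measure lam n)).
  apply: eq_expect => t; rewrite -[RHS]lam_outside.
  by apply: eq_expect => u; rewrite tnth_tset eqxx.
rewrite big_cons /h' indicC; set p := \prod_(_ <- _) _; rewrite {1}/h indicE.
by case: (_ \in _) => /=; rewrite ?mulr1n ?mulr0n; ring.
Qed.

Definition graph_edges F : seq ('I_(nverts F) * 'I_(nverts F)) :=
  [seq e : 'I_(nverts F) * 'I_(nverts F) <- index_enum _ |
     (e.1 < e.2)%N && @edge F e.1 e.2].

Lemma hom_density_extend lo hi F W : kernel_in lo hi (extend_kernel lo W) ->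
  hom_density F W = density (extend_kernel lo W) (graph_edges F).
Proof.
move=> [bW _ _]; rewrite /density -expect_unit_cube; last exact: bm_edge_product.
apply: eq_Rintegral => x /set_mem xc; rewrite /edge_product big_filter.
by apply: eq_bigr => e _; rewrite /extend_kernel mem_set//; split; exact: xc.
Qed.

Definition forward_rel n (H : {ffun 'I_n * 'I_n -> bool}) : rel 'I_n :=
  fun i j => ((i < j)%N && H (i, j)) || ((j < i)%N && H (j, i)).

Lemma forward_rel_sym n (H : {ffun 'I_n * 'I_n -> bool}) : symmetric (forward_rel H).
Proof. by move=> i j; rewrite /forward_rel orbC. Qed.

Lemma forward_rel_irr n (H : {ffun 'I_n * 'I_n -> bool}) : irreflexive (forward_rel H).
Proof. by move=> i; rewrite /forward_rel ltnn. Qed.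

Definition forward_graph n (H : {ffun 'I_n * 'I_n -> bool}) : simple_graph :=
  SimpleGraph (forward_rel_sym H) (forward_rel_irr H).

(** Every bit pattern thus comes from a simple graph, so hypotheses on simple graphs control all
    densities in the expansion of the sample law. *)
Lemma graph_edges_forward n (H : {ffun 'I_n * 'I_n -> bool}) :
  graph_edges (forward_graph H) = forward_edges H.
Proof.
apply: eq_filter => -[i j] /=; rewrite /forward_rel; case: ltngtP => //= _.
by rewrite orbF.
Qed.

Definition joint_kernel lo W W' (q : (T * T) * (T * T)) : R :=
  extend_kernel lo W (q.1.1, q.2.1) - extend_kernel lo W' (q.1.2, q.2.2).

Section coupled.
Variables (lo : R) (W W' : T * T -> R) (mu : probability (T * T)%type R).
Hypotheses (bW : bm (extend_kernel lo W)) (bW' : bm (extend_kernel lo W')).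

Lemma bm_joint_kernel : bm (joint_kernel lo W W').
Proof. by rewrite /joint_kernel; bmt. Qed.

Lemma integral_joint_kernel (S U : set (T * T)) : measurable S -> measurable U ->
  S `<=` @unit_square R -> U `<=` @unit_square R ->
  (\int[mu \x mu]_(p in S `*` U) (W (p.1.1, p.2.1) - W' (p.1.2, p.2.2))%:E)%E =
  (kform mu (joint_kernel lo W W') \1_S \1_U)%:E.
Proof.
move=> mS mU SQ UQ; have bJ := bm_joint_kernel.
rewrite -expect_kform// /expect /Rintegral fineK; last first.
  apply: integrable_fin_num => //.
  apply: (bm_integrable (mu \x mu)%E (f := fun p => joint_kernel lo W W' p * \1_(S `*` U) p)).
  by apply: bmM => //; apply: bm_indic; exact: measurableX.
rewrite [LHS]integral_mkcond; apply: eq_integral => -[[x u] [y v]] _.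
rewrite patchE indicE; case: (boolP (_ \in _)) => [/set_mem[/= /SQ[/= Ix Iu] /UQ[/= Iy Iv]]|_].
  by rewrite mulr1 /joint_kernel /extend_kernel /= !mem_set.
by rewrite mulr0.
Qed.

Lemma cut_discrepancy_le c : cut_le mu (joint_kernel lo W W') c ->
  (cut_discrepancy mu W W' <= c%:E)%E.
Proof.
move=> Dc; apply: ge_ereal_sup => _ [S [U [mS mU SQ UQ ->]]].
by rewrite integral_joint_kernel// lee_fin; exact: Dc.
Qed.

(** The marginals of a coupling live on [0,1], so the parts of [S] and [U] outside the unit square
    are null and can be cut off. *)
Lemma cut_le_discrepancy c : coupling mu -> (cut_discrepancy mu W W' <= c%:E)%E ->
  cut_le mu (joint_kernel lo W W') c.
Proof.
move=> cmu Dc S U mS mU; have bJ := bm_joint_kernel.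
have [mp1 mp2] := coupling_preserving cmu.
have mQ := measurable_unit_square.
have mI : measurable (`[0, 1] : set T) by exact: measurable_itv.
have null (A : set (T * T)) : measurable A -> expect mu \1_(A `\` @unit_square R) = 0.
  move=> mA; have bA : bm (\1_(A `\` @unit_square R) : T * T -> R).
    by apply: bm_indic; exact: measurableD.
  pose h (u : T) : R := \1_(~` `[0, 1] : set T) u.
  have bh : bm h by apply: bm_indic; exact: measurableC.
  apply/eqP; rewrite eq_le ge0_expect ?andbT => [|p]; last by rewrite indicE.
  apply: (@le_trans _ _ (expect mu (fun p => h p.1 + h p.2))).
    apply: ler_expect => //; first by bmt.
    have h0 u : 0 <= h u by rewrite /h indicE.
    have h1 u : u \notin (`[0, 1]%classic : set T) -> h u = 1.
      by move=> uI; rewrite /h indicC uI.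
    move=> [x y] /=; rewrite indicE; case: (boolP (_ \in _)) => [/set_mem[_ nQ]|_]; last first.
      by rewrite addr_ge0.
    have [xI|/h1->] := boolP (x \in (`[0, 1]%classic : set T)); last by rewrite lerDl.
    rewrite (h1 y) ?lerDr//; apply/negP => yI.
    by apply: nQ; split; exact/set_mem.
  rewrite expectD; [|by bmt..].
  by rewrite -(expect_preserving mp1 bh) -(expect_preserving mp2 bh) !lam_outside addr0.
pose S' := S `&` @unit_square R; pose U' := U `&` @unit_square R.
have mS' : measurable S' by exact: measurableI.
have mU' : measurable U' by exact: measurableI.
have bS := bm_indic R mS; have bU := bm_indic R mU.
have bS' := bm_indic R mS'; have bU' := bm_indic R mU'.
have split_ind (A : set (T * T)) p : \1_A p =
    \1_(A `&` @unit_square R) p + \1_(A `\` @unit_square R) p :> R.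
  rewrite -indic_setU.
    by rewrite setDE -setIUr setUv setIT.
  by apply/seteqP; split => // q [[_ ?] []].
have e1 : kform mu (joint_kernel lo W W') \1_S \1_U = kform mu (joint_kernel lo W W') \1_S' \1_U.
  rewrite (kformE mu bJ bS bU) (kformE mu bJ bS' bU).
  apply/eqP; rewrite -subr_eq0 -expectB; [|by bmt..].
  rewrite (@eq_expect _ _ _ _ _ (fun p =>
      expect mu (fun q => joint_kernel lo W W' (p, q) * \1_U q) *
      \1_(S `\` @unit_square R) p)) => [|p].
    apply/eqP; apply: expect_null; [by bmt|by apply: bm_indic; exact: measurableD| |exact: null].
    by move=> p; rewrite indicE.
  by have := split_ind S p; rewrite -/S' => ->; ring.
have e2 : kform mu (joint_kernel lo W W') \1_S' \1_U = kform mu (joint_kernel lo W W') \1_S' \1_U'.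
  rewrite (kformEr mu bJ bS' bU) (kformEr mu bJ bS' bU').
  apply/eqP; rewrite -subr_eq0 -expectB; [|by bmt..].
  rewrite (@eq_expect _ _ _ _ _ (fun q =>
      expect mu (fun p => joint_kernel lo W W' (p, q) * \1_S' p) *
      \1_(U `\` @unit_square R) q)) => [|p].
    apply/eqP; apply: expect_null; [by bmt|by apply: bm_indic; exact: measurableD| |exact: null].
    by move=> p; rewrite indicE.
  by have := split_ind U p; rewrite -/U' => ->; ring.
rewrite e1 e2 -lee_fin; apply: le_trans Dc; apply: ereal_sup_ubound.
have SQ : S' `<=` @unit_square R by move=> p [].
have UQ : U' `<=` @unit_square R by move=> p [].
exists S', U'; split; [exact: mS'|exact: mU'|exact: SQ|exact: UQ|].
by rewrite (integral_joint_kernel mS' mU' SQ UQ) abse_EFin.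
Qed.

End coupled.

Lemma cut_dist_ge0 W W' : (0 <= cut_dist W W')%E.
Proof.
apply: le_ereal_inf_tmp => _ [mu _ <-].
apply: le_trans (ereal_sup_ubound (ex_intro _ set0 (ex_intro _ set0
  (And5 measurable0 measurable0 (@sub0set _ _) (@sub0set _ _) erefl)))).
exact: abse_ge0.
Qed.

End bridge.

(** * Densities against cut distance for graphons *)

Section convergence.
Context (R : realType).
Local Notation T := (measurableTypeR R).
Local Notation lam := (lebesgue01 R).
Implicit Types (W : T * T -> R) (F : simple_graph).

Definition graphon_between (lo hi : R) W : Prop :=
  graphon W /\ forall p, unit_square p -> lo <= W p <= hi.

Lemma kernel_norm_le lo hi W p : kernel_in lo hi W -> `|W p| <= `|lo| + `|hi| + 1.
Proof.
move=> [_ /(_ p)/andP[l h] _]; rewrite ler_norml; apply/andP; split.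
  by have := normr_ge0 hi; have := ler_norm (- lo); rewrite normrN; lra.
by have := normr_ge0 lo; have := ler_norm hi; lra.
Qed.

Lemma counting_cut_dist (lo hi : R) F : lo <= hi -> exists2 K : R, 0 < K &
  forall W W' c, graphon_between lo hi W -> graphon_between lo hi W' ->
    (cut_dist W W' < c%:E)%E -> `|hom_density F W - hom_density F W'| <= K * c.
Proof.
move=> lh; pose b := `|lo| + `|hi| + 1; pose s := graph_edges F.
have b1 : 1 <= b by rewrite lerDr addr_ge0.
have b0 : 0 < b by exact: lt_le_trans b1.
(* The added 1 keeps the constant positive for graphs without edges. *)
exists ((size s)%:R * (4 * b ^+ size s * b ^+ size s) + 1).
  by rewrite ltr_wpDl// mulr_ge0// !mulr_ge0// exprn_ge0// ltW.
move=> W W' c [gW Wlh] [gW' W'lh] /ereal_inf_lt[_ [mu cmu <-] muc].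
have Wk := extend_kernel_in lh gW Wlh; have W'k := extend_kernel_in lh gW' W'lh.
rewrite (hom_density_extend _ Wk) (hom_density_extend _ W'k).
have [bW _ _] := Wk; have [bW' _ _] := W'k.
have cut := cut_le_discrepancy bW bW' cmu (ltW muc).
have c0 : 0 <= c.
  by apply: le_trans (cut set0 set0 measurable0 measurable0); exact: normr_ge0.
have [mp1 mp2] := coupling_preserving cmu.
pose V (q : (T * T) * (T * T)) := extend_kernel lo W (q.1.1, q.2.1).
pose V' (q : (T * T) * (T * T)) := extend_kernel lo W' (q.1.2, q.2.2).
have bV : bm V by rewrite /V; bmt.
have bV' : bm V' by rewrite /V'; bmt.
have dV : density (extend_kernel lo W) s =
    expect (power_measure mu _) (edge_product (fun=> V) s).
  rewrite /density (expect_power_map mp1); last exact: bm_edge_product.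
  apply: eq_expect => x; apply: eq_bigr => e _.
  by rewrite !tnth_mktuple.
have dV' : density (extend_kernel lo W') s =
    expect (power_measure mu _) (edge_product (fun=> V') s).
  rewrite /density (expect_power_map mp2); last exact: bm_edge_product.
  apply: eq_expect => x; apply: eq_bigr => e _.
  by rewrite !tnth_mktuple.
rewrite dV dV'.
have sall : all (fun e : 'I_(nverts F) * 'I_(nverts F) => e.1 < e.2)%N s.
  by apply/allP => e; rewrite mem_filter => /andP[/andP[]].
have suniq : uniq s by rewrite filter_uniq// index_enum_uniq.
apply: le_trans (counting_lemma bV bV' b1 _ _ sall suniq cut) _.
- by move=> p; exact: kernel_norm_le Wk.
- by move=> p; exact: kernel_norm_le W'k.
- by rewrite mulrA [leRHS]mulrDl mul1r lerDl.
Qed.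

Lemma mutually_approximated_cut_dist (lo hi eps : R) : lo < hi -> 0 < eps ->
  exists2 e : R, 0 < e & forall W W', kernel_in lo hi (extend_kernel lo W) ->
    kernel_in lo hi (extend_kernel lo W') ->
    mutually_approximated lo hi (extend_kernel lo W) (extend_kernel lo W') e ->
    (cut_dist W W' < eps%:E)%E.
Proof.
move=> lh eps0; pose C := `|lo| + `|hi| + 1.
have C0 : 0 < C by rewrite ltr_wpDl// addr_ge0.
pose e := eps / 4; have e0 : 0 < e by rewrite divr_gt0.
have D0 : 0 < 4 * (2 * C) ^+ 3 by rewrite mulr_gt0// exprn_gt0// mulr_gt0.
(* The tolerance for which [approximated_close] yields 2e = eps/2, which leaves room for the strict
   inequality. *)
exists (e ^+ 4 / (4 * (2 * C) ^+ 3)); first by rewrite divr_gt0// exprn_gt0.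
move=> W W' Wk W'k [k [G [aW aW']]].
have [bW _ _] := Wk; have [bW' _ _] := W'k.
have GC i j : `|graph_kernel lo hi G i j| <= C.
  have /andP[l h] := graph_kernel_bounds G i j (ltW lh).
  rewrite /C ler_norml; apply/andP; split.
    by have := normr_ge0 hi; have := ler_norm (- lo); rewrite normrN; lra.
  by have := normr_ge0 lo; have := ler_norm hi; lra.
have [|mu cmu cut] := approximated_close bW bW' C0 (fun p => kernel_norm_le p Wk)
  (fun p => kernel_norm_le p W'k) GC (ltW e0) _ aW aW'.
  by rewrite mulrC divfK// gt_eqF.
apply: (@le_lt_trans _ _ (2 * e)%:E); last first.
  by rewrite lte_fin /e; lra.
apply: le_trans (cut_discrepancy_le bW bW' cut).
by apply: ereal_inf_lbound; exists mu.
Qed.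

(** The limit kernel is built on the plane, while cut distances are computed from extensions; the
    two differ only off the unit square. *)
Lemma cut_le_extend_kernel (lo hi : R) U : kernel_in lo hi U ->
  kernel_in lo hi (extend_kernel lo U) ->
  cut_le lam (fun p => extend_kernel lo U p - U p) 0.
Proof.
move=> Uk Uk'; have [bU _ _] := Uk; have [bU' _ _] := Uk'.
pose b := `|lo| + `|hi| + 1; pose N : set T := ~` `[0, 1].
have b0 : 0 <= 2 * b by rewrite mulr_ge0// addr_ge0// addr_ge0.
have mN : measurable N by apply: measurableC; exact: measurable_itv.
have bD : bm (fun p => extend_kernel lo U p - U p) by exact: bmD bU' (bmN bU).
apply: cut_le_L1 => //.
apply: (@le_trans _ _ (4 * b * expect lam \1_N)); last by rewrite lam_outside mulr0.
apply: L1norm_mismatch => // x y.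
have [xy|nxy] := pselect (unit_square (x, y)).
  by rewrite /extend_kernel mem_set// subrr normr0 mulr_ge0// addr_ge0// indicE.
apply: (@le_trans _ _ (2 * b)).
  apply: le_trans (ler_normB _ _) _; rewrite mulr_natl mulr2n.
  by apply: lerD; [exact: kernel_norm_le Uk'|exact: kernel_norm_le Uk].
rewrite ler_peMr//; have [xI|xI] := pselect (N x).
  by rewrite [X in X + _]indicE mem_set// lerDl indicE.
have yN : N y by move=> yI; apply: nxy; split => //; apply: contrapT.
by rewrite [X in _ + X]indicE mem_set// lerDr indicE.
Qed.

Lemma eventually_all (I : finType) (P : I -> nat -> Prop) :
  (forall i, exists N, forall n, (N <= n)%N -> P i n) ->
  exists N, forall i n, (N <= n)%N -> P i n.
Proof.
move=> /choice[N hN]; exists (\max_i N i) => i n Nn.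
by apply: hN; apply: leq_trans Nn; exact: leq_bigmax.
Qed.

Lemma hom_density_mutually_approximated (lo hi eps : R) : lo < hi -> 0 < eps ->
  exists k, exists2 eta : R, 0 < eta & forall W W',
    graphon_between lo hi W -> graphon_between lo hi W' ->
    (forall H : {ffun 'I_k.+1 * 'I_k.+1 -> bool},
       `|hom_density (forward_graph H) W - hom_density (forward_graph H) W'| <= eta) ->
    mutually_approximated lo hi (extend_kernel lo W) (extend_kernel lo W') eps.
Proof.
move=> lh eps0; have [k [eta eta0 inv]] := inverse_counting_lemma lh eps0.
exists k, eta => // W W' [gW Wlh] [gW' W'lh] WW'.
have Wk := extend_kernel_in (ltW lh) gW Wlh.
have W'k := extend_kernel_in (ltW lh) gW' W'lh.
have [|G GG] := inv _ _ Wk W'k; last by exists k, G.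
move=> H; have := WW' H.
by rewrite (hom_density_extend _ Wk) (hom_density_extend _ W'k) -graph_edges_forward.
Qed.

Lemma hom_density_cut_dist (lo hi eps : R) : lo < hi -> 0 < eps ->
  exists k, exists2 eta : R, 0 < eta & forall W W',
    graphon_between lo hi W -> graphon_between lo hi W' ->
    (forall H : {ffun 'I_k.+1 * 'I_k.+1 -> bool},
       `|hom_density (forward_graph H) W - hom_density (forward_graph H) W'| <= eta) ->
    (cut_dist W W' < eps%:E)%E.
Proof.
move=> lh eps0; have [e e0 h] := mutually_approximated_cut_dist lh eps0.
have [k [eta eta0 h']] := hom_density_mutually_approximated lh e0.
exists k, eta => // W W' gW gW' WW'; apply: h; last exact: h'.
- by case: gW => gW Wlh; exact: extend_kernel_in (ltW lh) gW Wlh.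
- by case: gW' => gW' Wlh; exact: extend_kernel_in (ltW lh) gW' Wlh.
Qed.

Lemma cvg_hom_density_cauchy (W : nat -> T * T -> R) k (eta : R) :
  (forall F, cvgn (fun n => hom_density F (W n))) -> 0 < eta ->
  exists N, forall m n, (N <= m)%N -> (N <= n)%N ->
    forall H : {ffun 'I_k.+1 * 'I_k.+1 -> bool},
    `|hom_density (forward_graph H) (W m) - hom_density (forward_graph H) (W n)| <= eta.
Proof.
move=> cW eta0; have eta2 : 0 < eta / 2 by rewrite divr_gt0.
have [N hN] := eventually_all (fun H : {ffun 'I_k.+1 * 'I_k.+1 -> bool} =>
  cvgn_near (cW (forward_graph H)) eta2).
exists N => m n Nm Nn H; have h1 := hN H m Nm; have h2 := hN H n Nn.
rewrite -(subrKA (limn (fun n => hom_density (forward_graph H) (W n)))).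
apply: le_trans (ler_normD _ _) _; rewrite [leRHS]splitr lerD//.
by rewrite distrC.
Qed.

Lemma graphon_in_between (I : set R) lo hi W : (forall x, I x -> lo <= x <= hi) ->
  graphon_in I W -> graphon_between lo hi W.
Proof. by move=> Ilh [gW WI]; split => // p /WI/Ilh. Qed.

Lemma exists_limit_graphon (lo hi : R) (W : nat -> T * T -> R) : lo < hi ->
  (forall n, graphon_between lo hi (W n)) ->
  (forall F, cvgn (fun n => hom_density F (W n))) ->
  exists2 U, graphon_between lo hi U &
    forall F, hom_density F (W n) @[n --> \oo] --> hom_density F U.
Proof.
move=> lh Wlh cW.
have Wk n : kernel_in lo hi (extend_kernel lo (W n)).
  by have [gW h] := Wlh n; exact: extend_kernel_in (ltW lh) gW h.
have [|U Uk UW] := exists_limit_kernel lh Wk.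
  move=> eps eps0; have [k [eta eta0 h]] := hom_density_mutually_approximated lh eps0.
  have [N hN] := cvg_hom_density_cauchy k cW eta0.
  by exists N => m n Nm Nn; apply: h => //; exact: hN.
have [[mU [B UB]] Ulh Us] := Uk.
have gU : graphon U.
  split; first exact: measurable_funTS.
    by exists B; split; rewrite ?num_real// => D /ltW BD p _; exact: le_trans (UB p) BD.
  by move=> x y _; exact: Us.
exists U; first by split.
have Ulh' : graphon_between lo hi U by split.
have Uk' := extend_kernel_in (ltW lh) gU (fun p _ => Ulh p).
(* The limit exists by assumption, so a single large n close to [U] determines it up to e. *)
move=> F; suff -> : hom_density F U = limn (fun n => hom_density F (W n)) by exact: cW.
apply/eqP; rewrite eq_sym -subr_eq0 -normr_le0; apply/ler_addgt0Pl => e e0; rewrite addr0.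
have [K K0 count] := counting_cut_dist F (ltW lh).
have e2 : 0 < e / 2 by rewrite divr_gt0.
have [N hN] := cvgn_near (cW F) e2.
have [d d0 hd] := mutually_approximated_cut_dist lh (divr_gt0 e2 K0).
have [n Nn [k [G [aW aU]]]] := UW d N d0.
have : (cut_dist (W n) U < (e / 2 / K)%:E)%E.
  apply: (hd _ _ (Wk n) Uk'); exists k, G; split; first exact: aW.
  have [y uy cy] := aU; exists y; first exact: uy.
  have [my _] := uy.
  have bG : bm (fun p => graph_kernel lo hi G (y p.1) (y p.2)).
    exact: (@bm_label2 _ _ _ _ _ _ _ _ _ (graph_kernel lo hi G) my my).
  have [bU bU' bG'] : [/\ bm U, bm (extend_kernel lo U) &
      bm (fun p => - graph_kernel lo hi G (y p.1) (y p.2))].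
    by split; [case: Uk|case: Uk'|exact: bmN].
  have := cut_leD (bmD bU' (bmN bU)) (bmD bU bG') (cut_le_extend_kernel Uk Uk') cy.
  by rewrite add0r; apply: eq_cut_le => p; ring.
move=> /(count _ _ _ (Wlh n) Ulh'); rewrite mulrC divfK ?gt_eqF// => h.
rewrite -(subrKA (hom_density F (W n))).
by apply: le_trans (ler_normD _ _) _; rewrite [leRHS]splitr lerD// hN.
Qed.

End convergence.

(** * Intervals and the equivalences *)

Lemma bounded_set_itv (R : realType) (I : set R) : bounded_set I ->
  exists2 b : R, 0 < b & forall x, I x -> - b <= x <= b.
Proof.
move=> [M [_ hM]]; exists (`|M| + 1); first by rewrite ltr_wpDl.
move=> x Ix; rewrite -ler_norml; apply: (hM (`|M| + 1)) => //.
by have := ler_norm M; lra.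
Qed.

Lemma closed_interval_endpoints (R : realType) (I : set R) : is_interval I ->
  bounded_set I -> closed I -> I !=set0 -> exists lo hi : R,
  [/\ lo <= hi, forall x, I x -> lo <= x <= hi & forall x, lo <= x <= hi -> I x].
Proof.
move=> iI bI cI I0; have [b _ hb] := bounded_set_itv bI.
have uI : has_ubound I by exists b => x /hb/andP[].
have lI : has_lbound I by exists (- b) => x /hb/andP[].
have supI : I (sup I) by rewrite {1}(closure_id I).1//; exact: closure_sup.
have infI : I (inf I).
  rewrite {1}(closure_id I).1// => A /nbhs_ballP[e /= e0 eA].
  have [x Ix xe] := inf_adherent e0 (conj I0 lI); exists x; split => //.
  have infx := ge_inf lI Ix.
  by apply: eA; rewrite /ball /= distrC ger0_norm ?subr_ge0// ltrBlDl.
exists (inf I), (sup I); split.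
- exact: ub_le_sup.
- by move=> x Ix; rewrite ge_inf// ub_le_sup.
- move=> x; exact: (iI _ _ infI supI).
Qed.

Theorem theorem3p8 (R : realType) (I : set R)
    (W_ : nat -> measurableTypeR R * measurableTypeR R -> R)
    (I_itv : is_interval I) (I_bnd : bounded_set I)
    (W_I : forall n, graphon_in I (W_ n)) :
  let a := forall F : simple_graph, cvgn (fun n => hom_density F (W_ n)) in
  let b := cut_cauchy W_ in
  let c := exists W : measurableTypeR R * measurableTypeR R -> R,
    graphon_in I W /\
    forall F : simple_graph,
      hom_density F (W_ n) @[n --> \oo] --> hom_density F W in
  [/\ a <-> b,
      c -> a,
      closed I -> a -> c &
      forall W : measurableTypeR R * measurableTypeR R -> R, graphon W ->
        (forall F : simple_graph,
           hom_density F (W_ n) @[n --> \oo] --> hom_density F W) <->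
        cut_dist (W_ n) W @[n --> \oo] --> 0%E].
Proof.
move=> a b c; have [B B0 IB] := bounded_set_itv I_bnd.
have BB : - B < B by rewrite gtrN.
have WB n : graphon_between (- B) B (W_ n) by exact: graphon_in_between IB (W_I n).
split.
- split=> [ca eps eps0|cb F].
    have [k [eta eta0 h]] := hom_density_cut_dist BB eps0.
    have [N hN] := cvg_hom_density_cauchy k ca eta0.
    by exists N => m n Nm Nn; apply: h => //; exact: hN.
  have [K K0 count] := counting_cut_dist F (ltW BB).
  apply: cvgn_cauchy => e e0; have [N hN] := cb (e / K) (divr_gt0 e0 K0).
  exists N => n Nn; have := count _ _ _ (WB N) (WB n) (hN N n (leqnn _) Nn).
  by rewrite mulrC divfK// gt_eqF.
- by move=> [W [_ cW]] F; apply/cvg_ex; exists (hom_density F W); exact: cW.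
- move=> cI ca.
  have I0 : I !=set0.
    exists (W_ 0%N (0, 0)); case: (W_I 0%N) => _; apply.
    by split; rewrite /= in_itv/= lexx ler01.
  have [lo [hi [lohi Ilh lhI]]] := closed_interval_endpoints I_itv I_bnd cI I0.
  (* Sampling needs lo < hi. If the interval is a single point, all graphons of the sequence are the
     same constant on the square and the first one is a limit. *)
  move: lohi; rewrite le_eqVlt => /predU1P[lh|lh].
    exists (W_ 0%N); split=> // F.
    rewrite (_ : (fun n => _) = fun=> hom_density F (W_ 0%N)); first exact: cvg_cst.
    apply/funext => n; apply: eq_Rintegral => x /set_mem xc; apply: eq_bigr => e _.
    have sq : unit_square (tnth x e.1, tnth x e.2) by split; exact: xc.
    have W1 m : W_ m (tnth x e.1, tnth x e.2) = lo.
      have [_ /(_ _ sq)/Ilh] := W_I m.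
      by rewrite -lh -eq_le => /eqP.
    by rewrite !W1.
  have [U [gU Ulh] cU] := exists_limit_graphon lh
    (fun n => graphon_in_between Ilh (W_I n)) ca.
  by exists U; split=> //; split=> // p /Ulh/lhI.
- move=> W gW; have [_ [M [_ hM]] _] := gW.
  (* The limit [W] is not assumed to have values in [I], so the interval is enlarged to contain its
     range as well. *)
  pose D := B + (`|M| + 1).
  have M1 : 0 < `|M| + 1 by rewrite ltr_wpDl.
  have D0 : 0 < D by rewrite addr_gt0.
  have DD : - D < D by rewrite gtrN.
  have WD n : graphon_between (- D) D (W_ n).
    apply: (graphon_in_between _ (W_I n)) => x /IB/andP[h1 h2].
    by rewrite /D; apply/andP; split; lra.
  have gWD : graphon_between (- D) D W.
    split=> // p sp; rewrite -ler_norml; apply: (@le_trans _ _ (`|M| + 1)).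
      by apply: (hM (`|M| + 1)) => //; have := ler_norm M; lra.
    by rewrite lerDr ltW.
  split=> [cW|cd F].
    have near0 eps : 0 < eps -> exists N, forall n, (N <= n)%N ->
        (cut_dist (W_ n) W < eps%:E)%E.
      move=> eps0; have [k [eta eta0 h]] := hom_density_cut_dist DD eps0.
      have [N hN] := eventually_all (fun H : {ffun 'I_k.+1 * 'I_k.+1 -> bool} =>
        cvgn_near (cW (forward_graph H)) eta0).
      by exists N => n Nn; apply: h => // H; rewrite distrC; exact: hN.
    have fin eps n : (cut_dist (W_ n) W < eps%:E)%E -> cut_dist (W_ n) W \is a fin_num.
      by move=> h; rewrite ge0_fin_numE ?cut_dist_ge0// (lt_trans h)// ltry.
    apply/fine_cvgP; split.
      have [N hN] := near0 1 ltr01; exists N => // n /= Nn; exact: fin (hN n Nn).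
    apply/cvgrPdist_le => e e0; have [N hN] := near0 e e0.
    exists N => // n /= Nn; have h := hN n Nn.
    rewrite sub0r normrN ger0_norm ?fine_ge0 ?cut_dist_ge0// -lee_fin.
    by rewrite fineK ?ltW//; exact: fin h.
  have [K K0 count] := counting_cut_dist F (ltW DD).
  apply/cvgrPdist_le => e e0.
  move/fine_cvgP: cd => [[N1 _ fin] /cvgn_near].
  have e2 : 0 < e / 2 / K by rewrite divr_gt0// divr_gt0.
  move=> /(_ _ e2)[N2 hN2]; exists (maxn N1 N2) => // n /=.
  rewrite geq_max => /andP[n1 n2].
  have : (cut_dist (W_ n) W < (e / K)%:E)%E.
    rewrite -(fineK (fin n n1)) lte_fin; apply: (@le_lt_trans _ _ (e / 2 / K)).
      by apply: le_trans (hN2 n n2); rewrite sub0r normrN; exact: ler_norm.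
    by rewrite ltr_pM2r ?invr_gt0// ltr_pdivrMr// ltr_pMr// ltr1n.
  move=> /(count _ _ _ (WD n) gWD); rewrite mulrC divfK ?gt_eqF// distrC.
  exact.
Qed.
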